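(* Let $(\xi_k)_{k\in\mathbb{Z}}$ be i.i.d. real random variables with $\mathbb{E}\xi_0=0$, $\mathbb{E}\xi_0^2>0$ and $\mathbb{E}e^{\alpha\xi_0^2}<\infty$ for some $\alpha>0$. Let $(\theta_n)_{n\ge1}$ satisfy $\theta_n\in[0,1)$ and $\theta_n\to1$, and let $(b_n)_{n\ge 1}$ be positive numbers with $b_n\to\infty$ and $\frac{\sqrt n(1-\theta_n)^2}{b_n}\to\infty$. Let $X_{k,n}$ be the stationary autoregressive process with coefficient $\theta_n$ and noise $(\xi_k)$, and let $C^*_{l,n}$ be its empirical covariance at lag $l$ (both defined in the context). Let $M$ be a non-negative integer. Then for all $r>0$ and every integer $0\le l\le M$, $$\lim_{n\to\infty}\frac{1}{b_n^2}\log\mathbb{P}\left(\frac{(1-\theta_n^2)^{3/2}\sqrt n}{b_n}\left|C^*_{l,n}-\mathbb{E}C^*_{l,n}\right|\ge r\right)=-\frac{r^2}{8(\mathbb{E}\xi_0^2)^2}.$$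
   Context: For every $n\ge1$, $X_{k,n}=\sum_{p=0}^\infty\theta_n^p\xi_{k-p}$ for $k\ge0$ (with $0^0=1$); this is the stationary solution of $X_{k,n}=\theta_nX_{k-1,n}+\xi_k$. For integers $0\le l<n$, $C^*_{l,n}=\frac{1}{n-l}\sum_{k=1}^{n-l}X_{k+l,n}X_{k,n}$. *)

(* Defs.v *)
From HB Require Import structures.
From mathcomp Require Import all_boot all_order all_algebra.
From mathcomp Require Import all_classical all_reals all_analysis.

Set Implicit Arguments.
Unset Strict Implicit.
Unset Printing Implicit Defensive.

Import Order.TTheory GRing.Theory Num.Theory.
Import numFieldNormedType.Exports.

Local Open Scope classical_set_scope.
Local Open Scope ring_scope.

Definition mutually_independent (I : eqType) (d : measure_display)
    (T : measurableType d) (R : realType) (P : probability T R)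
    (xi : I -> {RV P >-> R}) : Prop :=
  forall (J : seq I) (B : I -> set R),
    uniq J -> (forall i, measurable (B i)) ->
    (P [set w | forall i, i \in J -> B i (xi i w)]
      = \prod_(i <- J) P (xi i @^-1` B i))%E.

Definition identically_distributed (I : Type) (d : measure_display)
    (T : measurableType d) (R : realType) (P : probability T R)
    (xi : I -> {RV P >-> R}) : Prop :=
  forall (i j : I) (B : set R), measurable B ->
    distribution P (xi i) B = distribution P (xi j) B.

(* The limit is taken pointwise; at the sample points where the series
   diverges, [limn] is a default value.  Under the moment assumptions on the
   noise and for [0 <= theta < 1] this only happens on a negligible set. *)
Definition ar_process (T : Type) (R : realType) (theta : R)
    (xi : int -> T -> R) (k : nat) (w : T) : R :=
  limn (series (fun p : nat => theta ^+ p * xi (k%:Z - p%:Z) w)).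

Definition empirical_covariance (T : Type) (R : realType)
    (X : nat -> T -> R) (n l : nat) (w : T) : R :=
  (n - l)%:R^-1 * \sum_(1 <= k < (n - l).+1) X (k + l)%N w * X k w.

(* Main.v *)
Require Import Defs.
From mathcomp Require Import all_boot all_order all_algebra.
From mathcomp Require Import all_classical all_reals all_analysis.
From mathcomp Require Import measurable_realfun.
From mathcomp Require Import ring lra zify.

Import Order.TTheory GRing.Theory Num.Theory.
Import numFieldNormedType.Exports.

(** The rate is that of a Gaussian.  Write [B] for [b n ^+ 2], [rho] for
    [1 - theta n ^+ 2], [s2] for the variance of the noise, and let [W] be the
    rescaled covariance [rho^(3/2) sqrt n / b (C - center)].  The heart of the
    proof is that for every real [lam]
      [log E exp (lam B W) = B (v lam^2 / 2 + o(1))] with [v = 4 s2^2]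
    (scaled_cov_log_mgf); the large deviation principle for such sequences
    (gaussian_log_mgf_ldp) then gives the rate [r^2 / (2 v) = r^2 / (8 s2^2)].

    The logarithmic Laplace transform is computed by comparison with an
    exponential martingale (exp_martingale).  Let [Y] be the autoregression
    driven by the same noise [z] but started from 0, and [phi] the cumulant
    generating function of the noise.  Since [Y k] depends only on the noise
    before [z k],
      [E exp (sum_k (t Y_k z_k - phi (t Y_k))) = 1]   exactly, for every [t].
    Squaring the recursion of [Y] and summing gives the energy identity
      [rho sum Y_k^2 = 2 theta sum Y_k z_k + sum z_k^2 - Y_N^2],
    so that, up to small terms, [sum Y_k^2] is an affine function of the
    martingale [sum Y_k z_k], and so is every lagged sum [sum Y_(k+l) Y_k].
    As [phi u] is [s2 u^2 / 2] to leading order, with the choice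
    [t = 2 lam b sqrt rho / sqrt n] the difference between [lam B W] and
    [v lam^2 B / 2] plus the exponent above is an explicit sum of remainders
    (tilting_decomposition).

    Each remainder [D] is exponentially negligible: all its exponential
    moments [E exp (s |D|)] are [exp (o(B))].  The choice of [t] gives
    [n t^2 = O(B (1 - theta))], and the growth condition on [theta] and [b] gives
    [t = o((1 - theta)^2)] and [n (1 - theta) >= 1] eventually.  The nonlinear functionals of [Y] are controlled by
    convexity: [Y_(k+1) = theta Y_k + (1 - theta) (z_k / (1 - theta))] is a
    convex combination, so [sum f (Y_k) <= sum f (z_k / (1 - theta))] for
    nonnegative convex [f] vanishing at 0, and the right-hand side is a sum of independent
    terms.  The remainder of [phi], cubic at the origin, is dominated by
    the convex function [|u|^3 / (1 + |u|)], which grows only quadratically and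
    therefore has exponential moments.  Hoelder's inequality with exponents
    close to 1 and infinity absorbs the remainders
    (gaussian_log_mgf_of_tilting).

    Two reductions complete the argument.  The stationary process is
    [X_k = Y_k + theta^k X_0] almost surely, and the initial term is one more
    negligible remainder.  Finally, the exact expectation of the covariance is
    never computed: by Jensen's inequality the estimate on the Laplace
    transform forces the mean of [W] to tend to 0 (gaussian_log_mgf_mean), so
    [W] may be recentered at its mean. *)

Set Implicit Arguments.
Unset Strict Implicit.
Unset Printing Implicit Defensive.

Local Open Scope classical_set_scope.
Local Open Scope ring_scope.

(** * Independence from the past *)

Section general_probability.
Context d (T : measurableType d) (R : realType) (P : probability T R).

Lemma integral_cst_probability (c : R) : (\int[P]_w c%:E = c%:E)%E.
Proof.
have -> := @integral_cst _ _ _ P setT measurableT c%:E.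
by rewrite -[RHS]mule1; congr (_ * _)%E; exact: probability_setT.
Qed.

End general_probability.

Section independent_sequence.
Context d (T : measurableType d) (R : realType) (P : probability T R).
Variable zeta : nat -> {RV P >-> R}.

(** The pi-system of cylinders in the first [k] variables, on which mutual
    independence applies directly. *)
Definition past_events (k : nat) : set (set T) :=
  [set A | exists B : nat -> set R, (forall i, measurable (B i)) /\
    A = [set w | forall i, (i < k)%N -> B i (zeta i w)]].

(** The sample space with the sigma-algebra of the first [k] variables: being a
    measurable type of its own, it lets the product measure and Tonelli theorems
    apply to functions of the past. *)
Definition past k : measurableType (past_events k).-sigma :=
  g_sigma_algebraType (past_events k).

Lemma past_events_measurable k : past_events k `<=` measurable.
Proof.
move=> _ [B [mB ->]].
rewrite (_ : [set _ | _] = \bigcap_(i in `I_k) (zeta i @^-1` B i)); last first.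
  by apply/seteqP; split => w /= h i /= ik; exact: h.
apply: bigcap_measurableType => i _.
by rewrite -[X in measurable X]setTI; exact: measurable_funP.
Qed.

Lemma past_eventsI k : setI_closed (past_events k).
Proof.
move=> _ _ [B [mB ->]] [C [mC ->]].
exists (fun i => B i `&` C i); split; first by move=> i; exact: measurableI.
apply/seteqP; split => w /=; first by move=> [h1 h2] i ik; split; [exact: h1|exact: h2].
by move=> h; split => i ik; have [] := h i ik.
Qed.

Lemma past_eventsT k : past_events k setT.
Proof. by exists (fun=> setT); split => //; apply/seteqP; split. Qed.

Lemma measurable_past_id k : measurable_fun setT (id : T -> past k).
Proof.
apply: (@measurability _ _ T (past k) setT id (past_events k)) => //.
by move=> _ [A GA <-]; rewrite setTI; apply: past_events_measurable GA.
Qed.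

Lemma measurable_past_le j k : (j <= k)%N ->
  measurable_fun setT (id : past k -> past j).
Proof.
move=> jk; apply: (@measurability _ _ (past k) (past j) setT id (past_events j)) => //.
move=> _ [_ [B [mB ->]] <-]; rewrite setTI; apply: sub_sigma_algebra.
exists (fun i => if (i < j)%N then B i else setT); split.
  by move=> i; case: ifP.
apply/seteqP; split => w /= h i; first by move=> _; case: ifP => // ij; exact: h.
by move=> ij; have := h i (leq_trans ij jk); rewrite ij.
Qed.

Lemma measurable_past k i : (i < k)%N ->
  measurable_fun setT (zeta i : past k -> R).
Proof.
move=> ik _ C mC; rewrite setTI; apply: sub_sigma_algebra.
exists (fun j => if j == i then C else setT); split; first by move=> j; case: ifP.
apply/seteqP; split => w /=; first by move=> h j _; case: eqP => // ->.
by move=> /(_ i ik); rewrite eqxx.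
Qed.

Hypothesis indep : mutually_independent zeta.

(** Both sides are finite measures in [A] that agree on the pi-system of
    cylinders. *)
Lemma past_independent k (A : set T) (B : set R) :
  measurable (A : set (past k)) -> measurable B ->
  (P (A `&` zeta k @^-1` B) = P A * P (zeta k @^-1` B))%E.
Proof.
move=> mA mB.
have mzB : measurable (zeta k @^-1` B).
  by rewrite -[X in measurable X]setTI; exact: measurable_funP.
have r0 : 0 <= fine (P (zeta k @^-1` B)) by exact: fine_ge0.
have Pfin : P (zeta k @^-1` B) \is a fin_num by exact: fin_num_measure.
pose m1 : {measure set T -> \bar R} := mrestr P mzB.
pose m2 : {measure set T -> \bar R} := mscale (NngNum r0) P.
suff : m1 A = m2 A.
  move=> h; transitivity (m1 A) => //; rewrite h.
  transitivity ((fine (P (zeta k @^-1` B)))%:E * P A)%E => //.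
  by rewrite fineK// muleC.
apply: (g_sigma_algebra_measure_unique (past_events k) _ (fun=> setT)) => //.
- exact: past_events_measurable.
- by move=> _; exact: past_eventsT.
- by apply/seteqP; split => // w _; exists 0%N.
- exact: past_eventsI.
- move=> _ [C [mC ->]].
  set E := [set w | _].
  suff : (P (E `&` zeta k @^-1` B) = P E * P (zeta k @^-1` B))%E.
    move=> h; transitivity (P (E `&` zeta k @^-1` B)) => //; rewrite h muleC.
    transitivity ((fine (P (zeta k @^-1` B)))%:E * P E)%E => //.
    by rewrite fineK.
  rewrite {}/E.
  have := @indep (iota 0 k) C (iota_uniq 0 k) mC.
  have := @indep (iota 0 k.+1) (fun i => if (i < k)%N then C i else B)
    (iota_uniq 0 k.+1) _.
  rewrite -addn1 iotaD add0n big_cat/= big_cons big_nil mule1 ltnn => h1 h2.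
  transitivity (P [set w | forall i, i \in iota 0 k ++ [:: k] ->
    (if (i < k)%N then C i else B) (zeta i w)]).
    congr (P _); apply/seteqP; split => w /=.
      move=> [hC hB] i; rewrite mem_cat mem_iota add0n/= inE => /orP[ik|/eqP ->].
        by rewrite ik; exact: hC.
      by rewrite ltnn.
    move=> h; split.
      move=> i ik; have := h i; rewrite ik; apply.
      by rewrite mem_cat mem_iota add0n ik.
    by have := h k; rewrite ltnn; apply; rewrite mem_cat inE eqxx orbT.
  rewrite h1; last by move=> i; case: ifP.
  congr (_ * _)%E.
  rewrite (_ : [set w | _] = [set w | forall i, i \in iota 0 k -> C i (zeta i w)]).
    rewrite h2; apply: eq_big_seq => i; rewrite mem_iota add0n => /andP[_ ik].
    by rewrite ik.
  by apply/seteqP; split => w /= h i; have := h i; rewrite mem_iota add0n.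
- move=> _; apply: (@le_lt_trans _ _ 1%E); last exact: ltry.
  change (P (setT `&` zeta k @^-1` B) <= 1)%E.
  by apply: probability_le1; apply: measurableI.
Qed.

(** The pair formed by the past and [zeta k] has the product law, so that
    [zeta k] can be integrated out first while the past is kept fixed. *)
Lemma past_fubini k (F : past k * R -> \bar R) :
  measurable_fun setT F -> (forall z, (0 <= F z)%E) ->
  (\int[P]_w F (w, zeta k w) =
   \int[P]_w \int[distribution P (zeta k)]_y F (w, y))%E.
Proof.
move=> mF F0.
have mid := @measurable_past_id k.
pose U : {mfun T >-> past k} := mfun_Sub (mem_set mid).
have mUV : measurable_fun setT (fun w => (U w, zeta k w)).
  by apply/measurable_fun_pairP; split; [exact: mid|exact: measurable_funP].
pose UV : {mfun T >-> (past k * R)%type} := mfun_Sub (mem_set mUV).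
transitivity (\int[distribution P UV]_z F z)%E.
  by rewrite ge0_integral_distribution.
transitivity (\int[distribution P U \x distribution P (zeta k)]_z F z)%E.
  apply: eq_measure_integral => A mA _; apply/esym.
  apply: product_measure_unique => // B C mB mC.
  exact: (@past_independent k B C).
rewrite fubini_tonelli1//.
rewrite ge0_integral_distribution//.
  exact: measurable_fun_fubini_tonelli_F.
by move=> x; apply: integral_ge0.
Qed.

(** The most recent factor is integrated out at each step of the induction; by
    hypothesis its integral does not depend on the past.  Exponential martingales
    and products of independent factors are both instances. *)
Lemma expectation_prod_predictable (F : nat -> T -> R -> R) (kappa : R) :
  (forall k, measurable_fun setT (fun z : past k * R => F k z.1 z.2)) ->
  (forall k w y, 0 <= F k w y) ->
  (forall k w, (\int[distribution P (zeta k)]_y (F k w y)%:E = kappa%:E)%E) ->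
  forall N, (\int[P]_w (\prod_(i < N) F i w (zeta i w))%:E = (kappa ^+ N)%:E)%E.
Proof.
move=> mF F0 Fk; elim=> [|N IH].
  under eq_integral do rewrite big_ord0.
  by rewrite expr0 integral_cst_probability.
have mN i : (i < N)%N -> measurable_fun setT ((fun w => F i w (zeta i w)) : past N -> R).
  move=> iN.
  apply: (measurableT_comp (f := fun z : past i * R => F i z.1 z.2)
    (g := fun w : past N => ((w : past i), zeta i w))) => //.
  apply/measurable_fun_pairP; split; last exact: measurable_past.
  exact: (measurable_past_le (ltnW iN)).
have mprod : measurable_fun setT
    ((fun w => \prod_(i < N) F i w (zeta i w)) : past N -> R).
  by apply: measurable_prod => i _; exact: mN.
pose G (z : past N * R) := ((\prod_(i < N) F i z.1 (zeta i z.1)) * F N z.1 z.2)%:E.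
under eq_integral => w _ do rewrite big_ord_recr/=.
rewrite (@past_fubini N G).
- under eq_integral => w _.
    rewrite /G/=.
    under eq_integral do rewrite EFinM.
    rewrite ge0_integralZl_EFin//; first last.
      by apply: prodr_ge0 => i _; exact: F0.
      apply/measurable_EFinP.
      apply: (measurableT_comp (f := fun z : past N * R => F N z.1 z.2)
        (g := fun y => ((w : past N), y))) => //.
      apply/measurable_fun_pairP; split; first exact: measurable_cst.
      exact: measurable_id.
      by move=> y _; rewrite lee_fin.
    rewrite Fk.
    over.
  rewrite /= ge0_integralZr//.
  - by rewrite IH -EFinM exprSr.
  - apply/measurable_EFinP.
    exact: (measurableT_comp mprod (@measurable_past_id N)).
  - by move=> w _; rewrite lee_fin; apply: prodr_ge0 => i _; exact: F0.
  - by rewrite -(Fk N point); apply: integral_ge0 => y _; rewrite lee_fin.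
- rewrite /G.
  apply/measurable_EFinP; apply: measurable_funM; last exact: mF.
  exact: (measurableT_comp mprod measurable_fst).
- by move=> z; rewrite lee_fin mulr_ge0// prodr_ge0.
Qed.

End independent_sequence.

(** * Exponential moments *)

Section exp_moment.
Context d (T : measurableType d) (R : realType) (P : probability T R).
Implicit Types f g : T -> R.

Definition exp_moment f : \bar R := (\int[P]_w (expR (f w))%:E)%E.

Lemma measurable_exp_fun f : measurable_fun setT f ->
  measurable_fun setT (fun w => (expR (f w))%:E).
Proof.
move=> mf; apply/measurable_EFinP; exact: (measurableT_comp (@measurable_expR R) mf).
Qed.

Lemma exp_moment_ge0 f : (0 <= exp_moment f)%E.
Proof. by apply: integral_ge0 => w _; rewrite lee_fin expR_ge0. Qed.

Lemma exp_moment_le f g : measurable_fun setT f -> measurable_fun setT g ->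
  {ae P, forall w, f w <= g w} -> (exp_moment f <= exp_moment g)%E.
Proof.
move=> mf mg fg; apply: ae_ge0_le_integral => //.
- exact: measurable_exp_fun.
- exact: measurable_exp_fun.
- by apply: filterS fg => w fgw _; rewrite lee_fin ler_expR.
Qed.

Lemma exp_momentD f (c : R) : measurable_fun setT f ->
  exp_moment (fun w => f w + c) = ((expR c)%:E * exp_moment f)%E.
Proof.
move=> mf; rewrite /exp_moment -ge0_integralZl_EFin//.
- by apply: eq_integral => w _; rewrite -EFinM expRD mulrC.
- exact: measurable_exp_fun.
Qed.

Lemma exp_moment_cst (c : R) : exp_moment (fun=> c) = (expR c)%:E.
Proof. exact: integral_cst_probability. Qed.

(** The weights may add up to less than 1; the missing mass is put at 0, where the
    exponential is 1. *)
Lemma expR_jensen (I : Type) (s : seq I) (p x : I -> R) :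
  (forall i, 0 <= p i) -> \sum_(i <- s) p i <= 1 ->
  expR (\sum_(i <- s) p i * x i) <=
  \sum_(i <- s) p i * expR (x i) + (1 - \sum_(i <- s) p i).
Proof.
move=> p0 p1; set m := \sum_(i <- s) p i * x i.
have tangent (y : R) : expR m * (1 + (y - m)) <= expR y.
  rewrite -[in leRHS](subrK m y) expRD mulrC ler_wpM2r ?expR_ge0//.
  exact: expR_ge1Dx.
have h1 : \sum_(i <- s) p i * (expR m * (1 + (x i - m))) <=
    \sum_(i <- s) p i * expR (x i).
  by apply: ler_sum => i _; rewrite ler_wpM2l.
have h2 : (1 - \sum_(i <- s) p i) * (expR m * (1 + (0 - m))) <=
    1 - \sum_(i <- s) p i.
  rewrite -[leRHS]mulr1; apply: ler_wpM2l; first by rewrite subr_ge0.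
  by rewrite -[leRHS](@expR0 R); exact: tangent.
apply: le_trans (lerD h1 h2).
have -> : \sum_(i <- s) p i * (expR m * (1 + (x i - m))) =
    expR m * (m + (1 - m) * \sum_(i <- s) p i).
  under eq_bigr => i _ do rewrite mulrCA mulrDr mulr1 mulrBr.
  by rewrite -mulr_sumr big_split/= sumrB -mulr_suml; congr (_ * _); rewrite -/m; ring.
by rewrite le_eqVlt; apply/orP; left; apply/eqP; ring.
Qed.

Lemma exp_moment_jensen (I : Type) (s : seq I) (p : I -> R) (F : I -> T -> R)
    (a : R) : (forall i, measurable_fun setT (F i)) ->
  (forall i, 0 <= p i) -> \sum_(i <- s) p i <= 1 -> 0 <= a ->
  (forall i, exp_moment (F i) <= (expR a)%:E)%E ->
  (exp_moment (fun w => \sum_(i <- s) p i * F i w)%R <= (expR a)%:E)%E.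
Proof.
move=> mF p0 p1 a0 Fa.
have mpF i : measurable_fun setT (fun w => p i * expR (F i w)).
  apply: measurable_funM; first exact: measurable_cst.
  exact: (measurableT_comp (@measurable_expR R) (mF i)).
have q0 : 0 <= 1 - \sum_(i <- s) p i by rewrite subr_ge0.
apply: (@le_trans _ _ (\int[P]_w ((\sum_(i <- s) p i * expR (F i w)) +
    (1 - \sum_(i <- s) p i))%:E)%E).
  apply: ge0_le_integral => //.
  - apply: measurable_exp_fun; apply: measurable_sum => i.
    by apply: measurable_funM; [exact: measurable_cst|exact: mF].
  - apply/measurable_EFinP; apply: measurable_funD; last exact: measurable_cst.
    exact: measurable_sum.
  - by move=> w _; rewrite lee_fin; exact: expR_jensen.
under eq_integral do rewrite EFinD -sumEFin.
rewrite ge0_integralD//.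
- rewrite ge0_integral_sum//.
  + apply: (@le_trans _ _ ((\sum_(i <- s) p i * expR a)%:E +
      (1 - \sum_(i <- s) p i)%:E)%E).
      apply: leeD; last by rewrite integral_cst_probability.
      rewrite -sumEFin; apply: lee_sum => i _.
      under eq_integral do rewrite EFinM.
      rewrite ge0_integralZl_EFin//.
      * by rewrite EFinM; apply: lee_wpmul2l; [rewrite lee_fin|exact: Fa].
      * exact: measurable_exp_fun.
    rewrite -EFinD lee_fin -mulr_suml.
    have : 1 <= expR a by rewrite -[leLHS](@expR0 R) ler_expR.
    set S := \sum_(i <- s) p i in p1 q0 *; nra.
  + by move=> i; exact/measurable_EFinP.
  + by move=> i w _; rewrite lee_fin mulr_ge0// expR_ge0.
- by move=> w _; rewrite sumEFin lee_fin sumr_ge0// => i _; rewrite mulr_ge0// expR_ge0.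
- apply: emeasurable_sum => i; exact/measurable_EFinP.
Qed.

Lemma exp_moment_le_shift f (a : R) : measurable_fun setT f ->
  (exp_moment f <= (expR a)%:E)%E -> (exp_moment (fun w => f w - a)%R <= 1)%E.
Proof.
move=> mf fa; rewrite exp_momentD// expRN.
apply: (@le_trans _ _ ((expR a)^-1%:E * (expR a)%:E)%E).
  by rewrite lee_wpmul2l// lee_fin invr_ge0 expR_ge0.
by rewrite -EFinM mulVf// gt_eqF ?expR_gt0.
Qed.

(** Hoelder's inequality for exponents, obtained from the convexity of the exponential
    after normalizing both moments to 1. *)
Lemma exp_moment_hoelder f g (p a b : R) :
  measurable_fun setT f -> measurable_fun setT g -> 0 <= p <= 1 ->
  (exp_moment f <= (expR a)%:E)%E -> (exp_moment g <= (expR b)%:E)%E ->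
  (exp_moment (fun w => p * f w + (1 - p) * g w)%R <=
   (expR (p * a + (1 - p) * b))%:E)%E.
Proof.
move=> mf mg /andP[p0 p1] fa gb.
pose F (i : bool) w := if i then f w - a else g w - b.
pose q (i : bool) := if i then p else 1 - p.
have mF i : measurable_fun setT (F i).
  by case: i; apply: measurable_funB => //; exact: measurable_cst.
have -> : (fun w => p * f w + (1 - p) * g w) =
    (fun w => \sum_(i <- [:: true; false]) q i * F i w + (p * a + (1 - p) * b)).
  by apply/funext => w; rewrite !big_cons big_nil /q /F; ring.
rewrite exp_momentD; last first.
  apply: measurable_sum => i; apply: measurable_funM => //; exact: measurable_cst.
rewrite -[leRHS]mule1; apply: lee_wpmul2l; first by rewrite lee_fin expR_ge0.
rewrite -[leRHS]/(1%:E) -(@expR0 R); apply: exp_moment_jensen => //.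
- by case; rewrite /q ?subr_ge0.
- by rewrite !big_cons big_nil /q addr0 subrKC.
- by case; rewrite /F expR0; exact: exp_moment_le_shift.
Qed.

Lemma exp_moment_scale f (p a : R) : measurable_fun setT f -> 0 <= p <= 1 ->
  (exp_moment f <= (expR a)%:E)%E ->
  (exp_moment (fun w => p * f w)%R <= (expR (p * a))%:E)%E.
Proof.
move=> mf p01 fa.
have := @exp_moment_hoelder f (fun=> 0) p a 0 mf (measurable_cst _) p01 fa.
rewrite exp_moment_cst lexx => /(_ isT); rewrite mulr0 addr0.
by under [X in exp_moment X]eq_fun do rewrite addr0.
Qed.

(** From [exp |x| <= exp x + exp (- x)]. *)
Lemma exp_moment_abs f (a : R) : measurable_fun setT f ->
  (exp_moment f <= (expR a)%:E)%E ->
  (exp_moment (fun w => - f w)%R <= (expR a)%:E)%E ->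
  (exp_moment (fun w => `|f w|)%R <= (expR (a + ln 2))%:E)%E.
Proof.
move=> mf fa Nfa.
have mNf : measurable_fun setT (fun w => - f w) by exact: measurable_funN.
apply: (@le_trans _ _ (exp_moment f + exp_moment (fun w => (- f w)%R))%E).
  rewrite /exp_moment -ge0_integralD//.
  - apply: ge0_le_integral => //.
    + by apply: measurable_exp_fun; exact: measurableT_comp.
    + by apply: emeasurable_funD; exact: measurable_exp_fun.
    + move=> w _; rewrite -EFinD lee_fin.
      by case: (ger0P (f w)) => _; rewrite ?lerDl ?lerDr expR_ge0.
  - exact: measurable_exp_fun.
  - exact: measurable_exp_fun.
apply: (le_trans (leeD fa Nfa)).
by rewrite -EFinD lee_fin expRD lnK ?posrE// mulr_natr mulr2n.
Qed.

End exp_moment.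

(** * Gaussian asymptotics of the Laplace transform by tilting *)

Lemma eventually_and (p q : nat -> Prop) : (\forall n \near \oo, p n) ->
  (\forall n \near \oo, q n) -> \forall n \near \oo, p n /\ q n.
Proof. by move=> hp hq; apply: filterS2 hp hq => n; split. Qed.

Section log_mgf.
Context d (T : measurableType d) (R : realType) (P : probability T R).
Implicit Types (W D Z : nat -> T -> R) (B : nat -> R) (v : R).

(** [D n] does not contribute at the exponential scale [B n], whatever its
    dependence on the other variables. *)
Definition exp_negligible B D := forall s eta : R, 0 < s -> 0 < eta ->
  \forall n \near \oo,
    (exp_moment P (fun w => s * `|D n w|)%R <= (expR (eta * B n))%:E)%E.

(** The asymptotics [log E exp (l B W) = B (v l^2 / 2 + o(1))], which a centered
    Gaussian [W] of variance [v / B] satisfies exactly. *)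
Definition gaussian_log_mgf B W v := forall l eta : R, 0 < eta ->
  \forall n \near \oo,
    ((expR (B n * (v * l ^+ 2 / 2 - eta)))%:E <=
      exp_moment P (fun w => l * (B n * W n w))%R <=
      (expR (B n * (v * l ^+ 2 / 2 + eta)))%:E)%E.

(** [exp (Z n)] is a probability density for which the exponent [l B W] is known up
    to a negligible error.  Hoelder's inequality separates the density from the
    error at the cost of an exponent [p < 1] close to 1, so the tilting is
    applied at the neighbouring parameters [l / p] and [p l]. *)
Lemma gaussian_log_mgf_of_tilting B W v : 0 < v ->
  B n @[n --> \oo] --> +oo -> (forall n, measurable_fun setT (W n)) ->
  (forall l, exists Z, [/\ forall n, measurable_fun setT (Z n),
     \forall n \near \oo, exp_moment P (Z n) = 1%E &
     exp_negligible B (fun n w =>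
       l * (B n * W n w) - v * l ^+ 2 / 2 * B n - Z n w)]) ->
  gaussian_log_mgf B W v.
Proof.
move=> v0 Boo mW tilt l eta eta0.
pose k := v * l ^+ 2 + 1.
have k0 : 0 < k by rewrite /k ltr_wpDl// mulr_ge0 ?sqr_ge0// ltW.
(* makes [p^-1 = 1 + eta / k], so that replacing [l] by [l / p] costs at most
   half of [eta] *)
pose p := k / (k + eta).
have ke0 : k + eta != 0 by rewrite gt_eqF// addr_gt0.
have p0 : 0 < p by rewrite divr_gt0// addr_gt0.
have p1 : p < 1 by rewrite /p ltr_pdivrMr ?mul1r ?ltrDl//; exact: addr_gt0.
have q0 : 0 < 1 - p by rewrite subr_gt0.
have p01 : 0 <= p <= 1 by rewrite !ltW.
have mlW (c : R) n : measurable_fun setT (fun w => c * (B n * W n w)).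
  by do 2 (apply: measurable_funM; first exact: measurable_cst).
have mD (c : R) Z n : (forall n, measurable_fun setT (Z n)) ->
    measurable_fun setT (fun w => c * (B n * W n w) - v * c ^+ 2 / 2 * B n - Z n w).
  move=> mZ; apply: measurable_funB => //; apply: measurable_funB => //.
have msabsD (s c : R) Z n : (forall n, measurable_fun setT (Z n)) ->
    measurable_fun setT (fun w =>
      s * `|c * (B n * W n w) - v * c ^+ 2 / 2 * B n - Z n w|).
  move=> mZ; apply: measurable_funM => //.
  by apply: measurableT_comp => //; exact: mD.
have [Z1 [mZ1 Z1E Z1n]] := tilt (l / p).
have [Z2 [mZ2 Z2E Z2n]] := tilt (p * l).
have s10 : 0 < p / (1 - p) by rewrite divr_gt0.
have s20 : 0 < (1 - p)^-1 by rewrite invr_gt0.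
have e10 : 0 < eta / 2 by rewrite divr_gt0.
have e20 : 0 < p * eta by rewrite mulr_gt0.
have B0 : \forall n \near \oo, 0 < B n by move/cvgryPgt : Boo; exact.
move: (Z1n _ _ s10 e10) (Z2n _ _ s20 e20) => {}Z1n {}Z2n.
have := eventually_and B0 (eventually_and (eventually_and Z1E Z2E)
  (eventually_and Z1n Z2n)).
apply: filterS => n [Bn0 [[{}Z1E {}Z2E] [{}Z1n {}Z2n]]] {B0}.
have mg1 := msabsD (p / (1 - p)) (l / p) _ n mZ1.
have mg2 := msabsD (1 - p)^-1 (p * l) _ n mZ2.
apply/andP; split; last first.
(* upper bound: [l B W] is [p] times the exponent at [l / p] *)
- have Z1le : (exp_moment P (Z1 n) <= (expR 0)%:E)%E by rewrite Z1E expR0.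
  have := exp_moment_hoelder (mZ1 n) mg1 p01 Z1le Z1n.
  rewrite mulr0 add0r.
  set g := (fun w => _) in mg1 *; set h := (fun w => p * _ + _) => hh.
  have mh : measurable_fun setT h.
    by apply: measurable_funD; apply: measurable_funM.
  pose c := v * l ^+ 2 / (2 * p) * B n.
  apply: (@le_trans _ _ (exp_moment P (fun w => h w + c)%R)).
    apply: exp_moment_le; [exact: mlW|exact: measurable_funD|].
    apply: aeW => w /=; rewrite /h /g.
    set D := (X in `|X|).
    have -> : l * (B n * W n w) = p * Z1 n w + p * D + c.
      by rewrite /D /c; field; exact: lt0r_neq0.
    rewrite lerD2r lerD2l mulrA [(1 - p) * _]mulrC divfK ?lt0r_neq0//.
    by apply: ler_wpM2l; [exact: ltW|exact: ler_norm].
  rewrite exp_momentD//.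
  apply: (@le_trans _ _ ((expR c)%:E * (expR ((1 - p) * (eta / 2 * B n)))%:E)%E).
    by apply: lee_wpmul2l => //; rewrite lee_fin.
  rewrite -EFinM -expRD lee_fin ler_expR /c.
  have pe : p^-1 = 1 + eta / k.
    by rewrite /p invf_div; field; exact: lt0r_neq0.
  have ek : v * l ^+ 2 * (eta / k) <= eta.
    rewrite mulrA ler_pdivrMr// mulrC ler_wpM2l ?ltW// /k.
    by rewrite ltrDl.
  have -> : v * l ^+ 2 / (2 * p) = (v * l ^+ 2 + v * l ^+ 2 * (eta / k)) / 2.
    by rewrite invfM pe; field; exact: lt0r_neq0.
  have : B n * (v * l ^+ 2 * (eta / k)) <= B n * eta by rewrite ler_wpM2l// ltW.
  have : 0 <= p * (eta * B n) by apply: mulr_ge0; [exact: ltW|apply: mulr_ge0; exact: ltW].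
  lra.
(* lower bound: a smaller moment at [l] would make that of [Z2], the
   density at [p l], smaller than 1 *)
- rewrite leNgt; apply/negP => lt.
  have {}lt := ltW lt.
  have := exp_moment_hoelder (mlW l n) mg2 p01 lt Z2n.
  set g := (fun w => _) in mg2 *; set h := (fun w => p * _ + _) => hh.
  have mh : measurable_fun setT h.
    by apply: measurable_funD; apply: measurable_funM.
  pose c := - (v * (p * l) ^+ 2 / 2 * B n).
  have : (exp_moment P (Z2 n) <= exp_moment P (fun w => h w + c)%R)%E.
    apply: exp_moment_le; [exact: mZ2|exact: measurable_funD|].
    apply: aeW => w /=; rewrite /h /g.
    set D := (X in `|X|).
    have -> : Z2 n w = p * (l * (B n * W n w)) - D + c.
      by rewrite /D /c; ring.
    rewrite lerD2r lerD2l mulrA divff ?lt0r_neq0// mul1r.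
    by rewrite -normrN ler_norm.
  rewrite exp_momentD// Z2E => le1.
  have : (1 <= (expR c)%:E * (expR (p * (B n * (v * l ^+ 2 / 2 - eta)) +
        (1 - p) * (p * eta * B n)))%:E)%E.
    by apply: (le_trans le1); apply: lee_wpmul2l => //; rewrite lee_fin.
  rewrite -EFinM -expRD lee_fin -[leLHS](@expR0 R) ler_expR /c leNgt => /negP; apply.
  have -> : - (v * (p * l) ^+ 2 / 2 * B n) + (p * (B n * (v * l ^+ 2 / 2 - eta)) +
     (1 - p) * (p * eta * B n)) =
     p * B n * ((1 - p) * (v * l ^+ 2 / 2) - p * eta) by field.
  have pB : 0 < p * B n by exact: mulr_gt0.
  rewrite (pmulr_rlt0 _ pB) subr_lt0.
  have -> : 1 - p = eta * (k + eta)^-1 by rewrite /p; field.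
  rewrite -subr_gt0 {pB}.
  have -> : p * eta - eta * (k + eta)^-1 * (v * l ^+ 2 / 2) =
      eta * (k + eta)^-1 * (k - v * l ^+ 2 / 2) by rewrite /p; field.
  apply: mulr_gt0; first by rewrite divr_gt0// addr_gt0.
  have : 0 <= v * l ^+ 2 by rewrite mulr_ge0 ?sqr_ge0// ltW.
  by rewrite /k; lra.
Qed.

End log_mgf.

(** * From the Laplace transform to the probabilities of deviations *)

Section moderate_deviations.
Context d (T : measurableType d) (R : realType) (P : probability T R).
Implicit Types (f : T -> R) (W : nat -> T -> R) (B : nat -> R) (v : R).

Local Notation integrable_fun f := (P.-integrable setT (EFin \o f)).

Lemma integrable_mull f (c : R) : integrable_fun f ->
  integrable_fun (fun w => c * f w).
Proof.
move=> intf.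
rewrite (_ : EFin \o _ = (fun w => c%:E * (EFin \o f) w)%E); last first.
  by apply/funext => w /=; rewrite EFinM.
exact: integrableZl.
Qed.

Lemma exp_moment_integrable f (a : R) : measurable_fun setT f ->
  (exp_moment P f <= (expR a)%:E)%E -> integrable_fun (fun w => expR (f w)).
Proof.
move=> mf fa; apply/integrableP; split; first exact: measurable_exp_fun.
apply: (@le_lt_trans _ _ (exp_moment P f)); last exact: le_lt_trans fa (ltry _).
rewrite le_eqVlt; apply/orP; left; apply/eqP; apply: eq_integral => w _ /=.
by rewrite ger0_norm// expR_ge0.
Qed.

(** From [c |x| <= exp (c x) + exp (- c x)]. *)
Lemma integrable_of_exp_moment f (c a a' : R) : 0 < c -> measurable_fun setT f ->
  (exp_moment P (fun w => c * f w)%R <= (expR a)%:E)%E ->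
  (exp_moment P (fun w => - c * f w)%R <= (expR a')%:E)%E ->
  integrable_fun f.
Proof.
move=> c0 mf fa fa'.
have mcf (x : R) : measurable_fun setT (fun w => x * f w) by exact: measurable_funM.
have i1 := exp_moment_integrable (mcf c) fa.
have i2 := exp_moment_integrable (mcf (- c)) fa'.
apply: (@le_integrable _ _ _ P _ measurableT _
  (fun w => (c^-1)%:E * ((EFin \o (fun w => expR (c * f w))) w +
     (EFin \o (fun w => expR (- c * f w))) w))%E).
- exact/measurable_EFinP.
- move=> w _.
  change (`|(f w)%:E| <=
    `|(c^-1 * (expR (c * f w) + expR (- c * f w)))%:E|)%E.
  rewrite !abse_EFin lee_fin.
  rewrite [leRHS]ger0_norm; last first.
    by rewrite mulr_ge0 ?invr_ge0 ?(ltW c0)// addr_ge0// expR_ge0.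
  rewrite mulrC ler_pdivlMr// mulrC.
  have := expR_ge1Dx (c * f w); have := expR_ge1Dx (- c * f w).
  have := expR_ge0 (c * f w); have := expR_ge0 (- c * f w).
  case: (ger0P (f w)) => _; rewrite ?mulrN mulNr; lra.
- apply: integrableZl => //; exact: integrableD.
Qed.

Lemma Rintegral_cst_probability (c : R) : \int[P]_w c = c.
Proof.
rewrite Rintegral_cst// -[RHS]mulr1; congr (_ * _).
by apply: EFin_inj; rewrite fineK ?fin_num_measure//; exact: probability_setT.
Qed.

(** Jensen's inequality for the exponential, by integrating its tangent line at
    [a]. *)
Lemma Rintegral_le_log_exp_moment f (a : R) : measurable_fun setT f ->
  integrable_fun f ->
  (exp_moment P f <= (expR a)%:E)%E -> \int[P]_w f w <= a.
Proof.
move=> mf intf fa.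
have inte := exp_moment_integrable mf fa.
have Ee : \int[P]_w (expR (f w)) <= expR a.
  rewrite /Rintegral -lee_fin fineK//; apply: integrable_fin_num => //.
have ie2 : integrable_fun (fun w => expR (- a) * expR (f w)).
  exact: integrable_mull.
have ic : integrable_fun (cst (a - 1)).
  exact: (finite_measure_integrable_cst P).
apply: (@le_trans _ _ (\int[P]_w ((a - 1) + expR (- a) * expR (f w)))).
  apply: le_Rintegral => //; first exact: (integrableD measurableT ic ie2).
  move=> w _; rewrite -expRD.
  have := expR_ge1Dx (- a + f w); lra.
rewrite RintegralD// Rintegral_cst_probability RintegralZl//.
have : expR (- a) * \int[P]_w (expR (f w)) <= expR (- a) * expR a.
  by rewrite ler_wpM2l// expR_ge0.
rewrite -[leRHS]expRD addrC subrr expR0; lra.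
Qed.

(** By Jensen, [s E W <= v s^2 / 2 + o(1)] for every [s]; taking [s] small of
    either sign squeezes the mean. *)
Lemma gaussian_log_mgf_mean B W v : 0 < v -> B n @[n --> \oo] --> +oo ->
  (forall n, measurable_fun setT (W n)) -> gaussian_log_mgf P B W v ->
  (\forall n \near \oo, integrable_fun (W n)) /\
  (forall eps : R, 0 < eps ->
    \forall n \near \oo, `|\int[P]_w W n w| <= eps).
Proof.
move=> v0 Boo mW H.
have B0 : \forall n \near \oo, 0 < B n by move/cvgryPgt : Boo; exact.
have int : \forall n \near \oo, integrable_fun (W n).
  have := eventually_and B0 (eventually_and (H 1 1 ltr01) (H (-1) 1 ltr01)).
  apply: filterS => n [Bn0 [/andP[_ h1] /andP[_ h2]]].
  apply: (@integrable_of_exp_moment _ (B n)) => //.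
    by move: h1; under [X in exp_moment P X]eq_fun do rewrite mul1r; exact.
  by move: h2; under [X in exp_moment P X]eq_fun do rewrite mulN1r -mulNr; exact.
split => // eps eps0.
(* with this slope the bound is [v s / 2 + eps / 2 = eps] *)
pose s := eps / v.
have s0 : 0 < s by rewrite divr_gt0.
have e0 : 0 < s * eps / 2 by rewrite divr_gt0// mulr_gt0.
have := eventually_and B0 (eventually_and int
  (eventually_and (H s _ e0) (H (- s) _ e0))).
apply: filterS => n [Bn0 [intn [/andP[_ h1] /andP[_ h2]]]].
have mlW (c : R) : measurable_fun setT (fun w => c * (B n * W n w)).
  by do 2 (apply: measurable_funM; first exact: measurable_cst).
have iBW : integrable_fun (fun w => B n * W n w) by exact: integrable_mull.
have ilW (c : R) : integrable_fun (fun w => c * (B n * W n w)).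
  exact: integrable_mull.
have := Rintegral_le_log_exp_moment (mlW s) (ilW s) h1.
have := Rintegral_le_log_exp_moment (mlW (- s)) (ilW (- s)) h2.
rewrite !RintegralZl// sqrrN.
have -> : B n * (v * s ^+ 2 / 2 + s * eps / 2) = s * (B n * eps).
  by rewrite /s; field; exact: lt0r_neq0.
rewrite mulNr -mulrN !ler_pM2l// -mulrN !ler_pM2l// => g1 g2.
by rewrite ler_norml g2 andbT lerNl.
Qed.

Lemma gaussian_log_mgf_shift B W v (e : nat -> R) :
  B n @[n --> \oo] --> +oo ->
  (forall n, measurable_fun setT (W n)) ->
  (forall eps : R, 0 < eps -> \forall n \near \oo, `|e n| <= eps) ->
  gaussian_log_mgf P B W v -> gaussian_log_mgf P B (fun n w => W n w - e n) v.
Proof.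
move=> Boo mW e0 H l eta eta0.
have B0 : \forall n \near \oo, 0 < B n by move/cvgryPgt : Boo; exact.
have eta20 : 0 < eta / 2 by rewrite divr_gt0.
have l0 : 0 < `|l| + 1 by rewrite ltr_wpDl.
have d0 : 0 < eta / 2 / (`|l| + 1) by rewrite divr_gt0.
have := eventually_and B0 (eventually_and (e0 _ d0) (H l _ eta20)).
apply: filterS => n [Bn0 [{}e0 h]].
have mlW : measurable_fun setT (fun w => l * (B n * W n w)).
  by do 2 (apply: measurable_funM; first exact: measurable_cst).
have le : `|l * e n| <= eta / 2.
  move: e0; rewrite ler_pdivlMr// normrM => e0; apply: le_trans e0.
  by rewrite mulrC ler_wpM2l// lerDl.
move: le; rewrite ler_norml => /andP[le1 le2].
under [X in exp_moment P X]eq_fun do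
  rewrite mulrBr mulrBr.
rewrite exp_momentD//; move/andP : h => [h1 h2]; apply/andP; split.
  apply: (@le_trans _ _ ((expR (- (l * (B n * e n))))%:E *
      (expR (B n * (v * l ^+ 2 / 2 - eta / 2)))%:E)%E); last first.
    by apply: lee_wpmul2l => //; rewrite lee_fin expR_ge0.
  rewrite -EFinM -expRD lee_fin ler_expR.
  have : B n * (l * e n) <= B n * (eta / 2) by rewrite ler_pM2l.
  lra.
apply: (@le_trans _ _ ((expR (- (l * (B n * e n))))%:E *
      (expR (B n * (v * l ^+ 2 / 2 + eta / 2)))%:E)%E).
  by apply: lee_wpmul2l => //; rewrite lee_fin expR_ge0.
rewrite -EFinM -expRD lee_fin ler_expR.
have : B n * - (eta / 2) <= B n * (l * e n) by rewrite ler_pM2l.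
lra.
Qed.

(** The logarithm is extended-real valued; two-sided exponential bounds make it
    finite eventually. *)
Lemma cvg_log_probability B (p : nat -> \bar R) (I : R) :
  B n @[n --> \oo] --> +oo ->
  (forall eps : R, 0 < eps -> \forall n \near \oo,
    ((expR (B n * (- I - eps)))%:E <= p n <= (expR (B n * (- I + eps)))%:E)%E) ->
  ((B n)^-1%:E * lne (p n))%E @[n --> \oo] --> (- I)%:E.
Proof.
move=> Boo H.
have B0 : \forall n \near \oo, 0 < B n by move/cvgryPgt : Boo; exact.
have key (eps : R) : 0 < eps -> \forall n \near \oo,
    exists2 x : R, ((B n)^-1%:E * lne (p n))%E = x%:E & `|- I - x| <= eps.
  move=> eps0; have := eventually_and B0 (H _ eps0).
  apply: filterS => n [Bn0 /andP[h1 h2]].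
  have pfin : p n \is a fin_num.
    rewrite ge0_fin_numE; first exact: le_lt_trans h2 (ltry _).
    by apply: le_trans h1; rewrite lee_fin expR_ge0.
  move: h1 h2; rewrite -(fineK pfin); set q := fine _; rewrite !lee_fin => h1 h2.
  have q0 : 0 < q by apply: lt_le_trans h1; exact: expR_gt0.
  exists ((B n)^-1 * ln q); first by rewrite lne_EFin.
  have {}h1 : B n * (- I - eps) <= ln q by rewrite -ler_expR lnK.
  have {}h2 : ln q <= B n * (- I + eps) by rewrite -ler_expR lnK.
  have {}h1 : - I - eps <= (B n)^-1 * ln q by rewrite ler_pdivlMl.
  have {}h2 : (B n)^-1 * ln q <= - I + eps by rewrite ler_pdivrMl.
  rewrite ler_norml; lra.
apply/fine_cvgP; split.
  by apply: filterS (key 1 ltr01) => n [x -> _].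
apply/cvgrPdist_le => eps eps0; apply: filterS (key _ eps0) => n [x xE xle] /=.
by rewrite xE.
Qed.

Lemma measurable_ge (f : T -> R) (r : R) : measurable_fun setT f ->
  measurable [set w | r <= f w].
Proof.
move=> mf; rewrite (_ : [set w | _] = setT `&` f @^-1` `[r, +oo[%classic).
  by apply: mf => //; exact: measurable_itv.
by rewrite setTI; apply/seteqP; split => w /=; rewrite in_itv/= andbT.
Qed.

Lemma integral_scaled_indic (A : set T) (c : R) : 0 <= c -> measurable A ->
  (\int[P]_w (c * \1_A w)%:E = c%:E * P A)%E.
Proof.
move=> c0 mA; under eq_integral do rewrite EFinM.
rewrite ge0_integralZl_EFin//.
  by rewrite integral_indic// setIT.
by apply/measurable_EFinP; exact: measurable_indic.
Qed.

Lemma chernoff_exp_moment (f : T -> R) (c : R) : measurable_fun setT f ->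
  ((expR c)%:E * P [set w | (c <= f w)%R] <= exp_moment P f)%E.
Proof.
move=> mf; have mA := measurable_ge c mf.
rewrite -integral_scaled_indic ?expR_ge0//; apply: ge0_le_integral => //.
- apply/measurable_EFinP; apply: measurable_funM => //; exact: measurable_indic.
- exact: measurable_exp_fun.
- move=> w _; rewrite lee_fin indicE.
  case: (boolP (w \in _)); last by rewrite mulr0 expR_ge0.
  by rewrite inE/= mulr1 ler_expR.
Qed.

(** The upper bound is Chernoff's with the optimal slope [r / v].  For the lower
    bound, the slope [l = (r + de) / v] centers the tilted law at [r + de]; on
    [W < r] and on [W > r + 2 de] the tilted density is dominated by tilts with
    slopes [l - s] and [l + s], whose moments are exponentially smaller.  Hence
    at least half of the moment of slope [l] comes from [r <= W <= r + 2 de], where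
    [exp (l B W)] is at most [exp (l B (r + 2 de))]. *)
Lemma gaussian_log_mgf_ldp B W v (r : R) : 0 < v -> 0 < r ->
  B n @[n --> \oo] --> +oo ->
  (forall n, measurable_fun setT (W n)) -> gaussian_log_mgf P B W v ->
  ((B n)^-1%:E * lne (P [set w | (r <= `|W n w|)%R]))%E @[n --> \oo] -->
  (- (r ^+ 2 / (2 * v)))%:E.
Proof.
move=> v0 r0 Boo mW H.
have B0 : \forall n \near \oo, 0 < B n by move/cvgryPgt : Boo; exact.
have mlW (c : R) n : measurable_fun setT (fun w => c * (B n * W n w)).
  by do 2 (apply: measurable_funM; first exact: measurable_cst).
have mabs n : measurable_fun setT (fun w => `|W n w|) by exact: measurableT_comp.
have mA n := measurable_ge r (mabs n).
apply: cvg_log_probability => // eps eps0.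
have Bbig (c : R) : \forall n \near \oo, c < B n by move/cvgryPgt : Boo; exact.
have upper : \forall n \near \oo, (P [set w | (r <= `|W n w|)%R] <=
    (expR (B n * (- (r ^+ 2 / (2 * v)) + eps)))%:E)%E.
  pose l := r / v.
  have l0 : 0 < l by rewrite divr_gt0.
  have e20 : 0 < eps / 2 by rewrite divr_gt0.
  have := eventually_and B0 (eventually_and (Bbig (2 * ln 2 / eps))
    (eventually_and (H l _ e20) (H (- l) _ e20))).
  apply: filterS => n [Bn0 [Bn1 [/andP[_ h1] /andP[_ h2]]]].
  have h3 : (exp_moment P (fun w => - (l * (B n * W n w)))%R <=
      (expR (B n * (v * l ^+ 2 / 2 + eps / 2)))%:E)%E.
    by move: h2; rewrite sqrrN; under [X in exp_moment P X]eq_fun do rewrite mulNr; exact.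
  have h4 := exp_moment_abs (mlW l n) h1 h3.
  have mabsl : measurable_fun setT (fun w => `|l * (B n * W n w)|).
    exact: measurableT_comp.
  have := le_trans (chernoff_exp_moment (l * B n * r) mabsl) h4.
  have -> : [set w | l * B n * r <= `|l * (B n * W n w)|] =
      [set w | r <= `|W n w|].
    have lB : 0 < l * B n by exact: mulr_gt0.
    apply/seteqP; split => w /=;
      by rewrite mulrA normrM (gtr0_norm lB) ler_pM2l.
  rewrite muleC -lee_pdivlMr ?expR_gt0//.
  move=> /le_trans; apply.
  rewrite -expRN -EFinM -expRD lee_fin ler_expR.
  have : ln 2 <= B n * (eps / 2).
    by move: Bn1; rewrite ltr_pdivrMr// => /ltW; lra.
  have -> : v * l ^+ 2 / 2 = r ^+ 2 / (2 * v) by rewrite /l; field; exact: lt0r_neq0.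
  have -> : l * B n * r = B n * (2 * (r ^+ 2 / (2 * v))).
    by rewrite /l; field; exact: lt0r_neq0.
  lra.
have lower : \forall n \near \oo, ((expR (B n * (- (r ^+ 2 / (2 * v)) - eps)))%:E <=
    P [set w | (r <= `|W n w|)%R])%E.
  pose de := Num.min 1 (eps * v / (4 * r + 4)).
  have r22 : 0 < 4 * r + 4 by rewrite addr_gt0// mulr_gt0.
  have de0 : 0 < de by rewrite lt_min ltr01/= divr_gt0// mulr_gt0.
  have de1 : de <= 1 by rewrite ge_min lexx.
  have dee : de * (4 * r + 4) <= eps * v.
    by rewrite -ler_pdivlMr// ge_min lexx orbT.
  (* this [s] maximizes the gain [s de - v s^2 / 2] of the neighbouring tilts; its
     value is [s de / 2], and [eta] has to be a fraction of it *)
  pose l := (r + de) / v; pose s := de / v; pose eta := s * de / 8.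
  have s0 : 0 < s by rewrite divr_gt0.
  have eta0 : 0 < eta by rewrite divr_gt0// mulr_gt0.
  have := eventually_and B0 (eventually_and
    (eventually_and (Bbig (ln 4 / (s * de / 4))) (Bbig (2 * ln 2 / eps)))
    (eventually_and (H l _ eta0) (eventually_and (H (l - s) _ eta0) (H (l + s) _ eta0)))).
  apply: filterS => n [Bn0 [[Bn1 Bn2] [/andP[h1 _] [/andP[_ h2] /andP[_ h3]]]]].
  set A := [set w | _].
  pose x1 := B n * (v * l ^+ 2 / 2 - eta).
  pose x2 := B n * (v * l ^+ 2 / 2 - s * de / 2 + eta).
  have e1 : (exp_moment P (fun w => (l - s) * (B n * W n w) + s * B n * r)%R <= (expR x2)%:E)%E.
    rewrite exp_momentD//.
    apply: (@le_trans _ _ ((expR (s * B n * r))%:E *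
      (expR (B n * (v * (l - s) ^+ 2 / 2 + eta)))%:E)%E).
      by apply: lee_wpmul2l => //; rewrite lee_fin expR_ge0.
    rewrite -EFinM -expRD lee_fin ler_expR /x2 le_eqVlt; apply/orP; left; apply/eqP.
    by rewrite /l /s; field; exact: lt0r_neq0.
  have e2 : (exp_moment P (fun w => (l + s) * (B n * W n w) +
      - (s * B n * (r + 2 * de)))%R <= (expR x2)%:E)%E.
    rewrite exp_momentD//.
    apply: (@le_trans _ _ ((expR (- (s * B n * (r + 2 * de))))%:E *
      (expR (B n * (v * (l + s) ^+ 2 / 2 + eta)))%:E)%E).
      by apply: lee_wpmul2l => //; rewrite lee_fin expR_ge0.
    rewrite -EFinM -expRD lee_fin ler_expR /x2 le_eqVlt; apply/orP; left; apply/eqP.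
    by rewrite /l /s; field; exact: lt0r_neq0.
  pose K := expR (l * B n * (r + 2 * de)).
  have K0 : 0 <= K by exact: expR_ge0.
  have mI : measurable_fun setT (fun w => (K * \1_A w)%:E).
    by apply/measurable_EFinP; apply: measurable_funM => //; apply: measurable_indic; exact: mA.
  have I0 w : (0 <= (K * \1_A w)%:E)%E by rewrite lee_fin mulr_ge0// indicE.
  have mE (x y : R) : measurable_fun setT (fun w => x * (B n * W n w) + y).
    exact: measurable_funD.
  have main : (exp_moment P (fun w => l * (B n * W n w))%R <=
      K%:E * P A + (expR x2)%:E + (expR x2)%:E)%E.
    apply: (@le_trans _ _ (\int[P]_w ((K * \1_A w)%:E +
        (expR ((l - s) * (B n * W n w) + s * B n * r))%:E +
        (expR ((l + s) * (B n * W n w) + - (s * B n * (r + 2 * de))))%:E))%E).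
      apply: ge0_le_integral => //.
      + exact: measurable_exp_fun.
      + apply: emeasurable_funD; last by apply: measurable_exp_fun; exact: mE.
        by apply: emeasurable_funD; [exact: mI|apply: measurable_exp_fun; exact: mE].
      + move=> w _; rewrite -!EFinD lee_fin.
        have := expR_ge0 ((l - s) * (B n * W n w) + s * B n * r).
        have := expR_ge0 ((l + s) * (B n * W n w) + - (s * B n * (r + 2 * de))).
        have [Wr|rW] := ltP (W n w) r.
          have : expR (l * (B n * W n w)) <=
              expR ((l - s) * (B n * W n w) + s * B n * r).
            rewrite ler_expR.
            have : s * B n * W n w <= s * B n * r.
              by rewrite ler_wpM2l ?ltW// mulr_gt0.
            lra.
          have : 0 <= K * \1_A w by rewrite mulr_ge0// indicE.
          lra.
        have -> : \1_A w = 1 :> R.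
          by rewrite indicE mem_set//= /A/=; apply: le_trans rW (ler_norm _).
        have [Wr2|rW2] := leP (W n w) (r + 2 * de).
          have : expR (l * (B n * W n w)) <= K.
            rewrite ler_expR.
            have : l * B n * W n w <= l * B n * (r + 2 * de).
              by rewrite ler_wpM2l// mulr_ge0// ?ltW// divr_gt0// addr_gt0.
            lra.
          lra.
        have : expR (l * (B n * W n w)) <=
            expR ((l + s) * (B n * W n w) + - (s * B n * (r + 2 * de))).
          rewrite ler_expR.
          have : s * B n * (r + 2 * de) <= s * B n * W n w.
            by rewrite ler_wpM2l ?ltW// mulr_gt0.
          lra.
        lra.
    rewrite ge0_integralD//.
    - rewrite ge0_integralD//.
      + rewrite integral_scaled_indic//; last exact: mA.
        by do !apply: leeD.
      + by apply: measurable_exp_fun; exact: mE.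
    - by move=> w _; rewrite adde_ge0// lee_fin expR_ge0.
    - by apply: emeasurable_funD; [exact: mI|apply: measurable_exp_fun; exact: mE].
    - by apply: measurable_exp_fun; exact: mE.
  have pfin : P A \is a fin_num.
    by apply: fin_num_measure; exact: mA.
  have := le_trans h1 main; rewrite -/x1 -(fineK pfin).
  set q := fine _; rewrite -EFinM -!EFinD !lee_fin => hq.
  have x12 : 4 * expR x2 <= expR x1.
    have -> : 4 = expR (ln 4) :> R by rewrite lnK// posrE.
    rewrite -expRD ler_expR.
    have sd0 : 0 < s * de / 4 by rewrite divr_gt0// mulr_gt0.
    have : ln 4 <= B n * (s * de / 4).
      by move: Bn1; rewrite (ltr_pdivrMr _ _ sd0) => /ltW.
    rewrite /x1 /x2 /eta; lra.
  have {}hq : expR (x1 - ln 2) <= K * q.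
    rewrite expRB lnK ?posrE//.
    lra.
  have : expR (x1 - ln 2 - l * B n * (r + 2 * de)) <= q.
    by rewrite expRB ler_pdivrMr ?expR_gt0// mulrC.
  apply: le_trans; rewrite ler_expR.
  have hl2 : ln 2 <= B n * (eps / 2).
    by move: Bn2; rewrite ltr_pdivrMr// => /ltW; lra.
  suff : B n * (- (r ^+ 2 / (2 * v)) - eps / 2) <= x1 - l * B n * (r + 2 * de) by lra.
  have -> : x1 - l * B n * (r + 2 * de) =
      B n * (- (r ^+ 2 / (2 * v)) - (4 * r * de + 3 * de ^+ 2 + de ^+ 2 / 4) / (2 * v)).
    by rewrite /x1 /eta /l /s; field; exact: lt0r_neq0.
  rewrite ler_pM2l// lerD2l lerN2.
  rewrite ler_pdivrMr ?mulr_gt0//.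
  nra.
by apply: filterS2 upper lower => n h1 h2; rewrite h1 h2.
Qed.

End moderate_deviations.

(** * Real inequalities *)

Section real_inequalities.
Context {R : realType}.
Implicit Types x y u : R.

(** The mean value theorem for [exp (- z) (1 + z + z^2 / 2)], whose derivative is the
    single term [- exp (- z) z^2 / 2]. *)
Lemma expR_taylor2_kernel y :
  exists c : R, [/\ `|c| <= `|y|, y - c <= `|y| &
  1 - expR (- y) * (1 + y + y ^+ 2 / 2) = expR (- c) * c ^+ 2 / 2 * y].
Proof.
pose h (z : R) : R := expR (- z) * (1 + z + z ^+ 2 / 2).
pose dh (z : R) : R := - (expR (- z) * z ^+ 2 / 2).
have hd (z : R) : is_derive z 1 h (dh z).
  rewrite /h; apply: is_derive_eq; rewrite /dh /GRing.scale/=.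
  by field.
have hc : continuous h.
  by move=> z; apply/differentiable_continuous/derivable1_diffP; case: (hd z).
have h0 : h 0 = 1 by rewrite /h oppr0 expR0 addr0 expr0n/= mul0r addr0 mulr1.
have [y0|y0] := leP 0 y.
  have [c /andP[c0 cy] hE] := @MVT_segment R h dh 0 y y0 (fun z _ => hd z)
    (continuous_subspaceT hc).
  exists c; split; [by rewrite !ger0_norm//|by rewrite ger0_norm// gerBl|].
  by move: hE; rewrite h0 subr0 /h /dh => hE; rewrite -opprB hE; ring.
have [c /andP[cy c0] hE] := @MVT_segment R h dh y 0 (ltW y0) (fun z _ => hd z)
    (continuous_subspaceT hc).
exists c; split; first by rewrite !ler0_norm ?lerN2// ltW.
  by apply: (@le_trans _ _ 0) => //; rewrite subr_le0.
by move: hE; rewrite h0 sub0r /h /dh => hE; rewrite hE; ring.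
Qed.

Lemma expR_taylor2 y : `|expR y - (1 + y + y ^+ 2 / 2)| <= `|y| ^+ 3 * expR `|y|.
Proof.
have [c [cy yc hE]] := expR_taylor2_kernel y.
have -> : expR y - (1 + y + y ^+ 2 / 2) =
    expR y * (1 - expR (- y) * (1 + y + y ^+ 2 / 2)).
  by rewrite mulrBr mulr1 mulrA -expRD subrr expR0 mul1r.
rewrite hE.
have -> : `|expR y * (expR (- c) * c ^+ 2 / 2 * y)| =
    expR y * expR (- c) * (`|c| ^+ 2 * `|y|) / 2.
  rewrite !normrM !(ger0_norm (expR_ge0 _)) [`|2^-1|]ger0_norm ?invr_ge0//.
  by ring.
have e1 : expR y * expR (- c) <= expR `|y| by rewrite -expRD ler_expR.
have c2 : `|c| ^+ 2 * `|y| <= `|y| ^+ 3.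
  by rewrite [leRHS]exprSr ler_wpM2r// lerXn2r ?nnegrE.
have := ler_pM (mulr_ge0 (expR_ge0 y) (expR_ge0 (- c)))
  (mulr_ge0 (sqr_ge0 `|c|) (normr_ge0 y)) e1 c2.
have : 0 <= expR y * expR (- c) * (`|c| ^+ 2 * `|y|).
  by rewrite !mulr_ge0 ?expR_ge0 ?sqr_ge0.
lra.
Qed.

Lemma expR_ge_sqr y : 0 <= y -> y ^+ 2 / 2 <= expR y.
Proof.
move=> y0; have [c [cy yc hE]] := expR_taylor2_kernel y.
have : 0 <= 1 - expR (- y) * (1 + y + y ^+ 2 / 2).
  by rewrite hE mulr_ge0// mulr_ge0// mulr_ge0 ?expR_ge0// sqr_ge0.
rewrite subr_ge0 expRN mulrC ler_pdivrMr ?expR_gt0// mul1r; lra.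
Qed.

Lemma expR_taylor1 y : `|expR y - (1 + y)| <= y ^+ 2 * expR `|y|.
Proof.
have h1 := expR_ge1Dx y; have h2 := expR_ge1Dx (- y).
have e0 := expR_gt0 y.
have h3 : expR y - 1 <= y * expR y.
  move: h2; rewrite expRN -(ler_pM2r e0) mulVf ?gt_eqF//; lra.
rewrite ger0_norm; last by rewrite subr_ge0.
have [y0|y0] := leP 0 y.
  rewrite ger0_norm//.
  have : y * (expR y - 1) <= y * (y * expR y) by rewrite ler_wpM2l.
  rewrite expr2; lra.
apply: (@le_trans _ _ (y ^+ 2)).
  have : - y * (1 - expR y) <= - y * - y.
    by rewrite ler_wpM2l ?oppr_ge0 ?(ltW y0)//; lra.
  rewrite expr2; lra.
by rewrite ler_peMr ?sqr_ge0// -[leLHS](@expR0 R) ler_expR.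
Qed.

Lemma cube_le_expR x : `|x| ^+ 3 <= 2 * expR (2 * `|x|).
Proof.
have h1 : `|x| <= expR `|x| by have := expR_ge1Dx `|x|; lra.
have h2 : `|x| ^+ 2 <= 2 * expR `|x|.
  have := @expR_ge_sqr `|x| (normr_ge0 x); lra.
rewrite [2 * `|x|]mulr_natl mulr2n expRD exprS.
have := ler_pM (normr_ge0 x) (sqr_ge0 `|x|) h1 h2; lra.
Qed.

(** After [|x|^3 <= 2 exp (2 |x|)] the exponent is linear in [|x|]; completing the
    square produces the constant [9 / (4 a)]. *)
Lemma cube_expR_le x (a : R) : 0 < a ->
  `|x| ^+ 3 * expR `|x| <= 2 * expR (9 / (4 * a)) * expR (a * x ^+ 2).
Proof.
move=> a0; apply: (@le_trans _ _ (2 * expR (2 * `|x|) * expR `|x|)).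
  by rewrite ler_wpM2r ?expR_ge0// cube_le_expR.
rewrite -[leLHS]mulrA -[leRHS]mulrA -!expRD ler_pM2l// ler_expR.
have : 0 <= a * (`|x| - 3 / (2 * a)) ^+ 2 by rewrite mulr_ge0 ?sqr_ge0// ltW.
have -> : a * (`|x| - 3 / (2 * a)) ^+ 2 = a * `|x| ^+ 2 - 3 * `|x| + 9 / (4 * a).
  by field; exact: lt0r_neq0.
rewrite real_normK ?num_real//; lra.
Qed.

Lemma cube_expR_sqr_le x (a : R) : 0 < a ->
  `|x| ^+ 3 * expR (a / 2 * x ^+ 2) <= 2 * expR (2 / a) * expR (a * x ^+ 2).
Proof.
move=> a0; apply: (@le_trans _ _ (2 * expR (2 * `|x|) * expR (a / 2 * x ^+ 2))).
  by rewrite ler_wpM2r ?expR_ge0// cube_le_expR.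
rewrite -[leLHS]mulrA -[leRHS]mulrA -!expRD ler_pM2l// ler_expR.
have : 0 <= a / 2 * (`|x| - 2 / a) ^+ 2 by rewrite mulr_ge0 ?sqr_ge0// divr_ge0// ltW.
have -> : a / 2 * (`|x| - 2 / a) ^+ 2 = a / 2 * `|x| ^+ 2 - 2 * `|x| + 2 / a.
  by field; exact: lt0r_neq0.
rewrite real_normK ?num_real//; lra.
Qed.

Lemma sqr_le_exp x (a : R) : 0 < a ->
  x ^+ 2 <= a^-1 * expR (a * x ^+ 2).
Proof.
move=> a0; rewrite mulrC ler_pdivlMr// mulrC.
by apply: le_trans (expR_ge1Dx _); rewrite lerDr.
Qed.

Lemma abs_le_exp x (a : R) : 0 < a ->
  `|x| <= (1 + a^-1) * expR (a * x ^+ 2).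
Proof.
move=> a0; have h := sqr_le_exp x a0.
have e1 : 1 <= expR (a * x ^+ 2) by rewrite -expR0 ler_expR mulr_ge0 ?sqr_ge0// ltW.
have ax : `|x| <= 1 + x ^+ 2.
  rewrite -(real_normK (num_real x)); have := sqr_ge0 (`|x| - 1).
  have := normr_ge0 x; rewrite sqrrB1; lra.
by rewrite mulrDl mul1r; apply: le_trans ax _; exact: lerD.
Qed.

Lemma sqr_expR_le (q a : R) : 0 < a -> 0 <= q ->
  q ^+ 2 * expR (a / 2 * q) <= 8 / a ^+ 2 * expR (a * q).
Proof.
move=> a0 q0; have -> : a * q = a / 2 * q + a / 2 * q by field.
rewrite expRD mulrA ler_wpM2r ?expR_ge0//.
have a2 : 0 <= a / 2 * q by rewrite mulr_ge0// divr_ge0// ltW.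
have -> : q ^+ 2 = 8 / a ^+ 2 * ((a / 2 * q) ^+ 2 / 2) by field; exact: lt0r_neq0.
by rewrite ler_wpM2l ?expR_ge_sqr// divr_ge0// sqr_ge0.
Qed.

(** Comparable to [|u|^3] near the origin and to [u^2] far from it: small enough to have
    exponential moments, sharp enough to bound a third-order Taylor remainder,
    and convex. *)
Definition capped_cube u := `|u| ^+ 3 / (1 + `|u|).

Lemma capped_cube_ge0 u : 0 <= capped_cube u.
Proof. by rewrite /capped_cube divr_ge0// ?exprn_ge0// addr_ge0. Qed.

Lemma measurable_capped_cube : measurable_fun setT capped_cube.
Proof.
have -> : capped_cube = (fun u => `|u| ^+ 3 * (1 + `|u|) `^ (- 1)).
  by apply/funext => u; rewrite powR_inv1// addr_ge0.
apply: measurable_funM; first by apply: measurable_funX.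
by apply: (measurableT_comp (measurable_powR (- 1))); exact: measurable_funD.
Qed.

Lemma capped_cube_le_sqr u : capped_cube u <= u ^+ 2.
Proof.
rewrite /capped_cube ler_pdivrMr ?ltr_pwDl//.
by rewrite -(real_normK (num_real u)) mulrDr mulr1 exprSr lerDr sqr_ge0.
Qed.

Lemma capped_cube_le_cube u : capped_cube u <= `|u| ^+ 3.
Proof.
by rewrite /capped_cube ler_pdivrMr ?ltr_pwDl// ler_peMr ?exprn_ge0// lerDl.
Qed.

Lemma capped_cube_ge u : `|u| <= 1 -> `|u| ^+ 3 <= 2 * capped_cube u.
Proof.
move=> u1; rewrite /capped_cube mulrA ler_pdivlMr ?ltr_pwDl// mulrC.
by rewrite ler_wpM2r ?exprn_ge0//; lra.
Qed.

Lemma capped_cube_ge_sqr u : 1 <= `|u| -> u ^+ 2 <= 2 * capped_cube u.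
Proof.
move=> u1; rewrite /capped_cube mulrA ler_pdivlMr ?ltr_pwDl//.
rewrite -(real_normK (num_real u)).
have : `|u| ^+ 2 * (1 + `|u|) <= `|u| ^+ 2 * (2 * `|u|).
  by rewrite ler_wpM2l ?sqr_ge0//; lra.
rewrite [`|u| ^+ 3]exprSr; lra.
Qed.

(** Convexity on the half-line, as a supporting line.  Its slope is the derivative
    of [x^3 / (1 + x)], and being nonnegative it also gives monotonicity. *)
Lemma capped_cube_tangent x : 0 <= x -> exists2 m : R, 0 <= m &
  forall y, 0 <= y -> capped_cube x + m * (y - x) <= capped_cube y.
Proof.
move=> x0; exists ((3 * x ^+ 2 + 2 * x ^+ 3) / (1 + x) ^+ 2).
  by rewrite divr_ge0 ?sqr_ge0// addr_ge0// mulr_ge0 ?exprn_ge0.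
move=> y y0; rewrite /capped_cube !ger0_norm//.
have x1 : 0 < 1 + x by rewrite ltr_pwDl.
have y1 : 0 < 1 + y by rewrite ltr_pwDl.
rewrite -subr_ge0.
have -> : y ^+ 3 / (1 + y) - (x ^+ 3 / (1 + x) +
   (3 * x ^+ 2 + 2 * x ^+ 3) / (1 + x) ^+ 2 * (y - x)) =
   (y - x) ^+ 2 * ((2 * x + x ^+ 2) + y * (1 + x) ^+ 2) / ((1 + x) ^+ 2 * (1 + y)).
  by field; rewrite !lt0r_neq0.
rewrite divr_ge0//; last by rewrite mulr_ge0 ?sqr_ge0 ?ltW.
rewrite mulr_ge0 ?sqr_ge0// addr_ge0//.
  by rewrite addr_ge0 ?sqr_ge0// mulr_ge0.
by rewrite mulr_ge0 ?sqr_ge0.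
Qed.

End real_inequalities.

(** * Exponential moments of the noise *)

Section noise_law.
Context {R : realType} (mu : probability R R) (alpha Ea s2 : R).
Hypothesis alpha0 : 0 < alpha.
Hypothesis muE : (\int[mu]_x (expR (alpha * x ^+ 2))%:E = Ea%:E)%E.
Hypothesis mu1 : (\int[mu]_x x%:E = 0)%E.
Hypothesis mu2 : (\int[mu]_x (x ^+ 2)%:E = s2%:E)%E.

Local Notation mu_integrable f := (mu.-integrable setT (EFin \o f)).

(** The functions whose integral follows from the three known moments; the
    exponential moments below are obtained by pointwise comparison with them. *)
Definition quad (a b c e x : R) : R := a + b * x + c * x ^+ 2 + e * expR (alpha * x ^+ 2).

Let mid : measurable_fun setT (fun x : R => x). Proof. exact: measurable_id. Qed.
Let mX (n : nat) : measurable_fun setT (fun x : R => x ^+ n).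
Proof. exact: measurable_funX. Qed.
Let mex : measurable_fun setT (fun x : R => alpha * x ^+ 2).
Proof. exact: measurable_funM. Qed.

Let int_e : mu_integrable (fun x => expR (alpha * x ^+ 2)).
Proof.
apply: (exp_moment_integrable (a := ln (Num.max 1 Ea))) => //.
by rewrite /exp_moment muE lnK ?lee_fin ?le_max ?lexx ?orbT// posrE lt_max ltr01.
Qed.

Let int_2 : mu_integrable (fun x => x ^+ 2).
Proof.
apply: (@le_integrable _ _ _ mu _ measurableT _
  (EFin \o (fun x => alpha^-1 * expR (alpha * x ^+ 2)))).
- by apply/measurable_EFinP; exact: mX.
- move=> x _ /=; rewrite lee_fin ger0_norm ?sqr_ge0//.
  by apply: le_trans (sqr_le_exp x alpha0) _; exact: ler_norm.
- exact: integrable_mull.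
Qed.

Let int_1 : mu_integrable (fun x => x).
Proof.
apply: (@le_integrable _ _ _ mu _ measurableT _
  (EFin \o (fun x => (1 + alpha^-1) * expR (alpha * x ^+ 2)))).
- by apply/measurable_EFinP; exact: mid.
- move=> x _ /=; rewrite lee_fin.
  by apply: le_trans (abs_le_exp x alpha0) _; exact: ler_norm.
- exact: integrable_mull.
Qed.

Lemma quad_integrable a b c e : mu_integrable (quad a b c e).
Proof.
have ha : mu_integrable (cst a) by exact: (finite_measure_integrable_cst mu).
have hb := integrable_mull b int_1.
have hc := integrable_mull c int_2.
have he := integrable_mull e int_e.
exact: (integrableD measurableT (integrableD measurableT (integrableD measurableT ha hb) hc) he).
Qed.

Lemma quad_Rintegral a b c e : \int[mu]_x quad a b c e x = a + c * s2 + e * Ea.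
Proof.
have ha : mu_integrable (cst a) by exact: (finite_measure_integrable_cst mu).
have hb := integrable_mull b int_1.
have hc := integrable_mull c int_2.
have he := integrable_mull e int_e.
have hab : mu_integrable (fun x => a + b * x) by exact: (integrableD measurableT ha hb).
have habc : mu_integrable (fun x => a + b * x + c * x ^+ 2).
  exact: (integrableD measurableT hab hc).
rewrite /quad RintegralD// RintegralD// RintegralD// !RintegralZl//.
rewrite Rintegral_cst_probability.
have -> : \int[mu]_x x = 0 by rewrite /Rintegral mu1.
have -> : \int[mu]_x (x ^+ 2) = s2 by rewrite /Rintegral mu2.
have -> : \int[mu]_x expR (alpha * x ^+ 2) = Ea by rewrite /Rintegral muE.
by rewrite mulr0 addr0.
Qed.

Lemma exp_moment_le_quad (h : R -> R) a b c e : measurable_fun setT h ->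
  (forall x, expR (h x) <= quad a b c e x) ->
  (exp_moment mu h <= (a + c * s2 + e * Ea)%:E)%E.
Proof.
move=> mh hq; rewrite -(quad_Rintegral a b c e) /Rintegral fineK; last first.
  exact: (integrable_fin_num measurableT (quad_integrable a b c e)).
apply: ge0_le_integral => //.
- exact: measurable_exp_fun.
- by case/integrableP : (quad_integrable a b c e).
- by move=> x _; rewrite lee_fin.
Qed.

Lemma exp_moment_ge_quad (h : R -> R) a b c e M : measurable_fun setT h ->
  (exp_moment mu h <= M%:E)%E -> (forall x, quad a b c e x <= expR (h x)) ->
  ((a + c * s2 + e * Ea)%:E <= exp_moment mu h)%E.
Proof.
move=> mh hM hq; rewrite -(quad_Rintegral a b c e) /Rintegral fineK; last first.
  exact: (integrable_fin_num measurableT (quad_integrable a b c e)).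
apply: le_integral => //.
- exact: quad_integrable.
- apply/integrableP; split; first exact: measurable_exp_fun.
  apply: (@le_lt_trans _ _ (exp_moment mu h)); last exact: le_lt_trans hM (ltry _).
  rewrite le_eqVlt; apply/orP; left; apply/eqP; apply: eq_integral => x _ /=.
  by rewrite ger0_norm// expR_ge0.
- by move=> x _; rewrite lee_fin.
Qed.

Lemma noise_Ea_ge1 : 1 <= Ea.
Proof.
have := @exp_moment_ge_quad (fun x => alpha * x ^+ 2) 1 0 0 0 Ea mex.
rewrite /exp_moment muE lexx !mul0r !addr0 lee_fin; apply => // x.
rewrite /quad !mul0r !addr0 -[leLHS](@expR0 R) ler_expR.
by rewrite mulr_ge0 ?sqr_ge0// ltW.
Qed.

Definition noise_mgf (u : R) : R := fine (exp_moment mu (fun x => u * x)%R).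

Definition noise_cgf (u : R) : R := ln (noise_mgf u).

Let mux (u : R) : measurable_fun setT (fun x : R => u * x).
Proof. exact: measurable_funM. Qed.

(** Completing the square: [u x <= alpha x^2 + u^2 / (4 alpha)]. *)
Lemma noise_mgf_le_gauss u :
  (exp_moment mu (fun x => u * x)%R <= (expR (u ^+ 2 / (4 * alpha)) * Ea)%:E)%E.
Proof.
have := @exp_moment_le_quad (fun x => u * x) 0 0 0 (expR (u ^+ 2 / (4 * alpha))) (mux u).
rewrite mul0r !add0r; apply => x.
rewrite /quad !mul0r !add0r -expRD ler_expR.
have : 0 <= alpha * (x - u / (2 * alpha)) ^+ 2 by rewrite mulr_ge0 ?sqr_ge0// ltW.
have -> : alpha * (x - u / (2 * alpha)) ^+ 2 = alpha * x ^+ 2 - u * x + u ^+ 2 / (4 * alpha).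
  by field; exact: lt0r_neq0.
lra.
Qed.

Lemma noise_mgfE u : exp_moment mu (fun x => u * x)%R = (noise_mgf u)%:E.
Proof.
rewrite /noise_mgf fineK// ge0_fin_numE ?exp_moment_ge0//.
exact: le_lt_trans (noise_mgf_le_gauss u) (ltry _).
Qed.

(** The tangent [1 + u x] of the exponential integrates to 1, the noise being
    centered. *)
Lemma noise_mgf_ge1 u : 1 <= noise_mgf u.
Proof.
have := @exp_moment_ge_quad (fun x => u * x) 1 u 0 0 _ (mux u) (noise_mgf_le_gauss u).
rewrite noise_mgfE lee_fin !mul0r !addr0; apply => x.
by rewrite /quad !mul0r !addr0 expR_ge1Dx.
Qed.

Lemma noise_cgfE u : exp_moment mu (fun x => u * x)%R = (expR (noise_cgf u))%:E.
Proof.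
by rewrite noise_mgfE /noise_cgf lnK// posrE (lt_le_trans ltr01)// noise_mgf_ge1.
Qed.

Let C3 := 2 * expR (9 / (4 * alpha)).
Let C3_ge0 : 0 <= C3. Proof. by rewrite mulr_ge0// expR_ge0. Qed.

Lemma noise_mgf_taylor u : `|u| <= 1 ->
  `|noise_mgf u - (1 + s2 * u ^+ 2 / 2)| <= C3 * Ea * `|u| ^+ 3.
Proof.
move=> u1.
have pw x : `|expR (u * x) - (1 + u * x + u ^+ 2 / 2 * x ^+ 2)| <=
    C3 * `|u| ^+ 3 * expR (alpha * x ^+ 2).
  have := expR_taylor2 (u * x).
  rewrite exprMn -[u ^+ 2 * x ^+ 2 / 2]mulrAC => /le_trans; apply.
  rewrite normrM exprMn.
  apply: (@le_trans _ _ (`|u| ^+ 3 * (`|x| ^+ 3 * expR `|x|))).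
    rewrite -mulrA; do 2 (apply: ler_wpM2l; first by rewrite exprn_ge0).
    by rewrite ler_expR ler_piMl.
  rewrite [C3 * _]mulrC -[leRHS]mulrA; apply: ler_wpM2l; first by rewrite exprn_ge0.
  exact: cube_expR_le.
have up := @exp_moment_le_quad (fun x => u * x) 1 u (u ^+ 2 / 2) (C3 * `|u| ^+ 3) (mux u).
have lo := @exp_moment_ge_quad (fun x => u * x) 1 u (u ^+ 2 / 2) (- (C3 * `|u| ^+ 3)) _ (mux u) (noise_mgf_le_gauss u).
move: up lo; rewrite noise_mgfE !lee_fin => up lo.
rewrite ler_norml; apply/andP; split.
  suff : 1 + u ^+ 2 / 2 * s2 + - (C3 * `|u| ^+ 3) * Ea <= noise_mgf u by lra.
  by apply: lo => x; have := pw x; rewrite ler_norml /quad => /andP[]; lra.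
suff : noise_mgf u <= 1 + u ^+ 2 / 2 * s2 + (C3 * `|u| ^+ 3) * Ea by lra.
by apply: up => x; have := pw x; rewrite ler_norml /quad => /andP[]; lra.
Qed.

Let s2_ge0 : 0 <= s2.
Proof. by rewrite -lee_fin -mu2; apply: integral_ge0 => x _; rewrite lee_fin sqr_ge0. Qed.

Let D := s2 / 2 + C3 * Ea.
Let lnEa_ge0 : 0 <= ln Ea. Proof. exact: ln_ge0 noise_Ea_ge1. Qed.
Let CE_ge0 : 0 <= C3 * Ea.
Proof. by rewrite mulr_ge0// (le_trans ler01)// noise_Ea_ge1. Qed.

Let cube_le_sqr (u : R) : `|u| <= 1 -> `|u| ^+ 3 <= u ^+ 2.
Proof.
move=> u1; rewrite -(real_normK (num_real u)) exprSr.
by rewrite ler_piMr// sqr_ge0.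
Qed.

Lemma noise_cgf_ge0 u : 0 <= noise_cgf u.
Proof. exact: ln_ge0 (noise_mgf_ge1 u). Qed.

(** Taylor's formula gives the quadratic growth near 0, and the Gaussian bound gives it
    away from 0. *)
Lemma noise_cgf_le_sqr u : noise_cgf u <= (D + (4 * alpha)^-1 + ln Ea) * u ^+ 2.
Proof.
have a4 : 0 <= (4 * alpha)^-1 by rewrite invr_ge0 mulr_ge0// ltW.
have u0 : 0 <= u ^+ 2 by exact: sqr_ge0.
have mp : 0 < noise_mgf u by rewrite (lt_le_trans ltr01)// noise_mgf_ge1.
have := ln_ge0 noise_Ea_ge1.
have D0 : 0 <= D by rewrite addr_ge0// divr_ge0.
have [u1|/ltW u1] := leP `|u| 1.
  have := noise_mgf_taylor u1; rewrite ler_norml => /andP[_ h].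
  have h2 : C3 * Ea * `|u| ^+ 3 <= C3 * Ea * u ^+ 2 by rewrite ler_wpM2l// cube_le_sqr.
  have h3 : noise_cgf u <= noise_mgf u - 1.
    rewrite /noise_cgf; have := expR_ge1Dx (ln (noise_mgf u)); rewrite lnK ?posrE//; lra.
  have := mulr_ge0 a4 u0; have := mulr_ge0 lnEa_ge0 u0.
  rewrite /D; lra.
have u2 : 1 <= u ^+ 2 by rewrite -(real_normK (num_real u)) expr_ge1.
have h : noise_cgf u <= u ^+ 2 / (4 * alpha) + ln Ea.
  rewrite /noise_cgf -ler_expR lnK ?posrE// expRD lnK ?posrE; last first.
    by rewrite (lt_le_trans ltr01)// noise_Ea_ge1.
  by have := noise_mgf_le_gauss u; rewrite noise_mgfE lee_fin.
have := mulr_ge0 D0 u0.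
have : ln Ea <= ln Ea * u ^+ 2 by rewrite ler_peMr.
lra.
Qed.

(** Near 0 the logarithm is linearized, [x - x^2 <= ln (1 + x) <= x], with [x] of order
    [u^2]; away from 0 both terms are quadratic and so is [capped_cube]. *)
Lemma noise_cgf_taylor u : `|noise_cgf u - s2 * u ^+ 2 / 2| <=
  2 * (C3 * Ea + D ^+ 2 + (D + (4 * alpha)^-1 + ln Ea) + s2) * capped_cube u.
Proof.
have a4 : 0 <= (4 * alpha)^-1 by rewrite invr_ge0 mulr_ge0// ltW.
have u0 : 0 <= u ^+ 2 by exact: sqr_ge0.
have D0 : 0 <= D by rewrite addr_ge0// divr_ge0.
have mp : 0 < noise_mgf u by rewrite (lt_le_trans ltr01)// noise_mgf_ge1.
have cc0 := capped_cube_ge0 u.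
set G := D + _ + _.
have G0 : 0 <= G by rewrite addr_ge0// addr_ge0.
have p1 := mulr_ge0 CE_ge0 cc0.
have p2 := mulr_ge0 (sqr_ge0 D) cc0.
have p3 := mulr_ge0 G0 cc0.
have p4 := mulr_ge0 s2_ge0 cc0.
have [u1|/ltW u1] := leP `|u| 1.
  have := noise_mgf_taylor u1; rewrite ler_norml => /andP[h1 h2].
  have c3 := capped_cube_ge u1.
  have h3 : noise_cgf u <= noise_mgf u - 1.
    rewrite /noise_cgf; have := expR_ge1Dx (ln (noise_mgf u)); rewrite lnK ?posrE//; lra.
  set x := noise_mgf u - 1.
  have x0 : 0 <= x by rewrite subr_ge0 noise_mgf_ge1.
  have h4 : x - x ^+ 2 <= noise_cgf u.
    have := expR_ge1Dx (- noise_cgf u); rewrite expRN /noise_cgf lnK ?posrE//.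
    have -> : noise_mgf u = 1 + x by rewrite /x; ring.
    have x1 : 0 < 1 + x by rewrite ltr_pwDl.
    suff : x - x ^+ 2 <= 1 - (1 + x)^-1 by lra.
    rewrite -subr_ge0.
    have -> : 1 - (1 + x)^-1 - (x - x ^+ 2) = x ^+ 3 / (1 + x).
      by field; exact: lt0r_neq0.
    by rewrite divr_ge0 ?exprn_ge0// ltW.
  have h5 : C3 * Ea * `|u| ^+ 3 <= C3 * Ea * u ^+ 2 by rewrite ler_wpM2l// cube_le_sqr.
  have xD : x <= D * u ^+ 2 by rewrite /D /x; lra.
  have x2 : x ^+ 2 <= D ^+ 2 * `|u| ^+ 3.
    apply: (@le_trans _ _ ((D * u ^+ 2) ^+ 2)).
      by rewrite lerXn2r ?nnegrE// mulr_ge0.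
    rewrite exprMn ler_wpM2l ?sqr_ge0// -(real_normK (num_real u)) -exprM.
    by rewrite [leLHS]exprSr ler_piMr ?exprn_ge0.
  have q1 : C3 * Ea * `|u| ^+ 3 <= C3 * Ea * (2 * capped_cube u) by rewrite ler_wpM2l.
  have q2 : D ^+ 2 * `|u| ^+ 3 <= D ^+ 2 * (2 * capped_cube u) by rewrite ler_wpM2l ?sqr_ge0.
  rewrite ler_norml; apply/andP; split; rewrite /x in h4 x2; lra.
have c2 := capped_cube_ge_sqr u1.
have := noise_cgf_le_sqr u; have := noise_cgf_ge0 u; rewrite -/G => n0 nG.
have := mulr_ge0 G0 u0 => GU.
have q1 : G * u ^+ 2 <= G * (2 * capped_cube u) by rewrite ler_wpM2l.
have q2 : s2 * u ^+ 2 <= s2 * (2 * capped_cube u) by rewrite ler_wpM2l.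
have q3 := mulr_ge0 s2_ge0 u0.
rewrite ler_norml; apply/andP; split; lra.
Qed.

(** The linear term of the exponential integrates to 0, which leaves a bound
    quadratic in [c]. *)
Lemma noise_centered_square c : `|c| <= alpha / 2 ->
  (exp_moment mu (fun x => c * (x ^+ 2 - s2))%R <=
   (expR (8 / alpha ^+ 2 * expR (alpha * s2) * Ea * c ^+ 2))%:E)%E.
Proof.
move=> ca.
have mh : measurable_fun setT (fun x : R => c * (x ^+ 2 - s2)).
  by apply: measurable_funM => //; exact: measurable_funB.
set K := 8 / alpha ^+ 2 * expR (alpha * s2).
have := @exp_moment_le_quad _ (1 - c * s2) 0 c (K * c ^+ 2) mh.
have -> : 1 - c * s2 + c * s2 + K * c ^+ 2 * Ea = 1 + K * Ea * c ^+ 2 by ring.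
move=> H; apply: (@le_trans _ _ (1 + K * Ea * c ^+ 2)%:E); last first.
  by rewrite lee_fin expR_ge1Dx.
apply: H => x; rewrite /quad.
set z := c * (x ^+ 2 - s2).
have := expR_taylor1 z; rewrite ler_norml => /andP[_ h].
suff : z ^+ 2 * expR `|z| <= K * c ^+ 2 * expR (alpha * x ^+ 2).
  by move: h; rewrite /z; lra.
pose q := x ^+ 2 + s2.
have q0 : 0 <= q by rewrite addr_ge0// sqr_ge0.
have zq : `|z| <= `|c| * q.
  rewrite normrM ler_wpM2l//; apply: le_trans (ler_normB _ _) _.
  by rewrite !ger0_norm// ?sqr_ge0.
have z2 : z ^+ 2 <= c ^+ 2 * q ^+ 2.
  rewrite -(real_normK (num_real z)) -(real_normK (num_real c)) -exprMn.
  by rewrite lerXn2r ?nnegrE// mulr_ge0.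
have ez : expR `|z| <= expR (alpha / 2 * q).
  by rewrite ler_expR; apply: le_trans zq _; rewrite ler_wpM2r.
have := ler_pM (sqr_ge0 z) (expR_ge0 _) z2 ez.
move=> /le_trans; apply.
rewrite -[leLHS]mulrA [K * _]mulrC -[leRHS]mulrA; apply: ler_wpM2l; first exact: sqr_ge0.
apply: le_trans (sqr_expR_le alpha0 q0) _.
rewrite /K -[leRHS]mulrA -expRD; apply: ler_wpM2l.
  by rewrite divr_ge0 ?sqr_ge0.
by rewrite ler_expR /q; lra.
Qed.

(** From [exp y <= 1 + y exp y]: the factor [y] is bounded by the cube, the exponential
    by the square, whose coefficient is small enough for integrability. *)
Lemma noise_capped_cube s u : 0 <= s -> s * u ^+ 2 <= alpha / 2 ->
  (exp_moment mu (fun x => s * capped_cube (u * x))%R <=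
   (expR (2 * expR (2 / alpha) * Ea * (s * `|u| ^+ 3)))%:E)%E.
Proof.
move=> s0 su.
have mh : measurable_fun setT (fun x : R => s * capped_cube (u * x)).
  apply: measurable_funM => //.
  exact: (measurableT_comp measurable_capped_cube (mux u)).
set K := 2 * expR (2 / alpha).
have := @exp_moment_le_quad _ 1 0 0 (K * (s * `|u| ^+ 3)) mh.
rewrite mul0r addr0 => H.
apply: (@le_trans _ _ (1 + K * Ea * (s * `|u| ^+ 3))%:E); last first.
  by rewrite lee_fin expR_ge1Dx.
have -> : K * Ea * (s * `|u| ^+ 3) = K * (s * `|u| ^+ 3) * Ea by ring.
apply: H => x; rewrite /quad !mul0r !addr0.
set y := s * _.
have y0 : 0 <= y by rewrite mulr_ge0// capped_cube_ge0.
have h : expR y <= 1 + y * expR y.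
  have := expR_ge1Dx (- y); rewrite expRN -(ler_pM2r (expR_gt0 y)) mulVf ?gt_eqF ?expR_gt0//.
  lra.
apply: le_trans h _; rewrite lerD2l.
have y1 : y <= s * `|u| ^+ 3 * `|x| ^+ 3.
  rewrite -mulrA -exprMn -normrM ler_wpM2l// capped_cube_le_cube//.
have y2 : expR y <= expR (alpha / 2 * x ^+ 2).
  rewrite ler_expR; apply: (@le_trans _ _ (s * (u * x) ^+ 2)).
    by rewrite ler_wpM2l// capped_cube_le_sqr.
  by rewrite exprMn mulrA ler_wpM2r ?sqr_ge0.
have := ler_pM y0 (expR_ge0 y) y1 y2 => /le_trans; apply.
rewrite -[leLHS]mulrA [K * _]mulrC -[leRHS]mulrA; apply: ler_wpM2l.
  by rewrite mulr_ge0 ?exprn_ge0.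
exact: cube_expR_sqr_le.
Qed.

(** Interpolation between the exponents 0 and [alpha]. *)
Lemma noise_square c : 0 <= c <= alpha ->
  (exp_moment mu (fun x => c * x ^+ 2)%R <= (expR (ln Ea / alpha * c))%:E)%E.
Proof.
move=> /andP[c0 ca].
have p01 : 0 <= c / alpha <= 1.
  by rewrite divr_ge0 ?(ltW alpha0)//= ler_pdivrMr// mul1r.
have h : (exp_moment mu (fun x => alpha * x ^+ 2)%R <= (expR (ln Ea))%:E)%E.
  by rewrite /exp_moment muE lnK// posrE (lt_le_trans ltr01)// noise_Ea_ge1.
have := exp_moment_scale mex p01 h.
rewrite mulrAC [_ / alpha * c]mulrAC [ln Ea * c]mulrC.
by under [X in exp_moment _ X]eq_fun do rewrite mulrA divfK ?lt0r_neq0//.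
Qed.

(** The moment generating function is a partial integral of a jointly measurable
    function. *)
Lemma measurable_noise_cgf : measurable_fun setT noise_cgf.
Proof.
apply: measurableT_comp; first exact: measurable_ln.
apply: measurableT_comp; first exact: fine_measurable.
apply: (@measurable_fun_fubini_tonelli_F _ _ R R R mu (fun z : R * R => (expR (z.1 * z.2))%:E)) => //.
apply/measurable_EFinP; apply: measurableT_comp => //.
by apply: measurable_funM.
Qed.

End noise_law.

(** * The autoregressive recursion *)

Section ar_filter.
Context {R : realType}.
Implicit Types (theta : R) (a : nat -> R).

Fixpoint ar_filter theta a k : R :=
  if k is k'.+1 then theta * ar_filter theta a k' + a k' else 0.

Lemma ar_filterE theta a k :
  ar_filter theta a k = \sum_(i < k) theta ^+ (k.-1 - i) * a i.
Proof.
elim: k => [|k IH]; first by rewrite big_ord0.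
rewrite big_ord_recr/= IH subnn expr0 mul1r mulr_sumr; congr (_ + _).
apply: eq_bigr => i _; rewrite mulrA -exprS; congr (theta ^+ _ * _).
by case: k i {IH} => [[]//|k] i /=; rewrite subSn// -ltnS.
Qed.

(** Summing the recursion: the sum of the inputs is [(1 - theta)] times the sum of the
    states, plus the last state. *)
Lemma ar_filter_le_sum theta a N : 0 <= theta < 1 -> (forall i, 0 <= a i) ->
  \sum_(k < N) ((1 - theta) * ar_filter theta a k) <= \sum_(i < N) a i.
Proof.
move=> /andP[t0 t1] a0.
have f0 k : 0 <= ar_filter theta a k.
  by elim: k => //= k IH; rewrite addr_ge0// mulr_ge0.
suff -> : \sum_(i < N) a i =
    \sum_(k < N) ((1 - theta) * ar_filter theta a k) + ar_filter theta a N.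
  by rewrite lerDl.
elim: N => [|N IH]; first by rewrite !big_ord0 addr0.
by rewrite !big_ord_recr/= IH; ring.
Qed.

Lemma sqr_convex (p x y : R) : 0 <= p <= 1 ->
  (p * x + (1 - p) * y) ^+ 2 <= p * x ^+ 2 + (1 - p) * y ^+ 2.
Proof.
move=> /andP[p0 p1]; rewrite -subr_ge0.
have -> : p * x ^+ 2 + (1 - p) * y ^+ 2 - (p * x + (1 - p) * y) ^+ 2 =
  p * (1 - p) * (x - y) ^+ 2 by ring.
by rewrite mulr_ge0 ?sqr_ge0// mulr_ge0// subr_ge0.
Qed.

Lemma capped_cube_convex (p x y : R) : 0 <= p <= 1 ->
  capped_cube (p * x + (1 - p) * y) <= p * capped_cube x + (1 - p) * capped_cube y.
Proof.
move=> /andP[p0 p1]; have q0 : 0 <= 1 - p by rewrite subr_ge0.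
pose m := p * `|x| + (1 - p) * `|y|.
have m0 : 0 <= m by rewrite addr_ge0// mulr_ge0.
have cabs (z : R) : capped_cube z = capped_cube `|z|.
  by rewrite /capped_cube normr_id.
have le_m : `|p * x + (1 - p) * y| <= m.
  by apply: le_trans (ler_normD _ _) _; rewrite !normrM !(ger0_norm p0) (ger0_norm q0).
rewrite cabs [capped_cube x]cabs [capped_cube y]cabs.
apply: (@le_trans _ _ (capped_cube m)).
  have [s s0 hs] := capped_cube_tangent (normr_ge0 (p * x + (1 - p) * y)).
  apply: le_trans (hs _ m0); rewrite lerDl mulr_ge0// subr_ge0//.
have [s s0 hs] := capped_cube_tangent m0.
have h1 := ler_wpM2l p0 (hs _ (normr_ge0 x)).
have h2 := ler_wpM2l q0 (hs _ (normr_ge0 y)).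
apply: le_trans (lerD h1 h2); rewrite /m le_eqVlt; apply/orP; left; apply/eqP.
by ring.
Qed.

(** One step of the recursion is the convex combination of the state and of
    [a k / (1 - theta)] with weights [theta] and [1 - theta]; the right-hand side is the
    same recursion applied to the values of [f]. *)
Lemma ar_filter_convex theta a (f : R -> R) k : 0 <= theta < 1 ->
  f 0 = 0 ->
  (forall p x y, 0 <= p <= 1 -> f (p * x + (1 - p) * y) <= p * f x + (1 - p) * f y) ->
  f (ar_filter theta a k) <=
    (1 - theta) * ar_filter theta (fun i => f (a i / (1 - theta))) k.
Proof.
move=> /andP[t0 t1] f0 fc.
have e0 : 1 - theta != 0 by rewrite subr_eq0 gt_eqF.
elim: k => [|k IH] /=; first by rewrite f0 mulr0.
have -> : theta * ar_filter theta a k + a k =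
   theta * ar_filter theta a k + (1 - theta) * (a k / (1 - theta)).
  by rewrite [(1 - theta) * _]mulrC divfK.
apply: (le_trans (fc _ _ _ _)); first by rewrite t0 ltW.
have := ler_wpM2l t0 IH.
rewrite mulrDr; lra.
Qed.

Lemma ar_filter_sum_convex theta a (f : R -> R) N : 0 <= theta < 1 ->
  (forall x, 0 <= f x) -> f 0 = 0 ->
  (forall p x y, 0 <= p <= 1 -> f (p * x + (1 - p) * y) <= p * f x + (1 - p) * f y) ->
  \sum_(k < N) f (ar_filter theta a k) <= \sum_(i < N) f (a i / (1 - theta)).
Proof.
move=> t01 fge0 f0 fc.
apply: le_trans (ar_filter_le_sum (a := fun i => f (a i / (1 - theta))) N t01 _) => //.
by apply: ler_sum => k _; exact: ar_filter_convex.
Qed.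

Lemma ar_filter_sum_sqr theta a N : 0 <= theta < 1 ->
  \sum_(k < N) ar_filter theta a k ^+ 2 <=
  (1 - theta) ^- 2 * \sum_(i < N) a i ^+ 2.
Proof.
move=> t01; have := @ar_filter_sum_convex theta a (fun x => x ^+ 2) N t01
  (fun x => sqr_ge0 x) (expr0n _ _) sqr_convex.
move=> /le_trans; apply; rewrite mulr_sumr; apply: ler_sum => i _.
by rewrite expr_div_n mulrC.
Qed.

(** The square of one step, [y'^2 = theta^2 y^2 + 2 theta y a + a^2], summed: the
    sums of squares of consecutive states differ by the last state only. *)
Lemma ar_filter_energy theta a N :
  (1 - theta ^+ 2) * \sum_(k < N) ar_filter theta a k ^+ 2 =
  2 * theta * \sum_(k < N) ar_filter theta a k * a k + \sum_(k < N) a k ^+ 2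
  - ar_filter theta a N ^+ 2.
Proof.
elim: N => [|N IH]; first by rewrite !big_ord0/= expr0n/=; ring.
rewrite !big_ord_recr mulrDr IH/=; ring.
Qed.

Lemma ar_filter_shift theta a l k :
  ar_filter theta a (k + l) = theta ^+ l * ar_filter theta a k +
    \sum_(i < l) theta ^+ (l.-1 - i) * a (k + i)%N.
Proof.
elim: l => [|l IH]; first by rewrite big_ord0 addn0 mul1r addr0.
rewrite addnS/= IH big_ord_recr/= subnn expr0 mul1r exprS mulrDr !addrA mulrA.
congr (_ + _ + _); rewrite mulr_sumr; apply: eq_bigr => i _.
rewrite mulrA -exprS; congr (theta ^+ _ * _).
by case: l i {IH} => [[]//|l] i /=; rewrite subSn// -ltnS.
Qed.

Lemma geometric_sum_le1 theta N : 0 <= theta ->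
  (1 - theta) * \sum_(i < N) theta ^+ i <= 1.
Proof.
move=> t0.
have := subrX1 theta N; rewrite -opprB -[X in _ = X * _]opprB mulNr => /oppr_inj <-.
by rewrite gerBl exprn_ge0.
Qed.

End ar_filter.

(** * Exponential moments of functionals of the autoregression *)

Section iid_estimates.
Context d (T : measurableType d) (R : realType) (P : probability T R).
Variables (mu : probability R R) (zeta : nat -> {RV P >-> R}).
Hypothesis indep : mutually_independent zeta.
Hypothesis law : forall i (B : set R), measurable B ->
  distribution P (zeta i) B = mu B.

Lemma exp_moment_law i (h : R -> R) : measurable_fun setT h ->
  exp_moment P (fun w => h (zeta i w)) = exp_moment mu h.
Proof.
move=> mh; rewrite /exp_moment.
rewrite -(@ge0_integral_distribution _ _ _ _ _ P (zeta i) (fun x => (expR (h x))%:E)).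
- by apply: eq_measure_integral => A mA _; exact: law.
- exact: measurable_exp_fun.
- by move=> y; rewrite lee_fin expR_ge0.
Qed.

Lemma exp_moment_sum_iid (h : R -> R) (a : R) N : measurable_fun setT h ->
  (exp_moment mu h <= (expR a)%:E)%E ->
  (exp_moment P (fun w => \sum_(i < N) h (zeta i w))%R <= (expR (N%:R * a))%:E)%E.
Proof.
move=> mh ha.
have fin : exp_moment mu h \is a fin_num.
  by rewrite ge0_fin_numE ?exp_moment_ge0//; exact: le_lt_trans ha (ltry _).
have E := @expectation_prod_predictable _ _ _ P zeta indep
  (fun _ _ y => expR (h y)) (fine (exp_moment mu h)) _ _ _ N.
rewrite /exp_moment; under eq_integral do rewrite expR_sum.
rewrite E.
- rewrite lee_fin expRM_natl; apply: lerXn2r; rewrite ?nnegrE ?expR_ge0//.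
    by rewrite fine_ge0// exp_moment_ge0.
  by rewrite -lee_fin fineK.
- move=> k; apply: measurableT_comp => //.
  exact: (measurableT_comp mh measurable_snd).
- by move=> k w y; rewrite expR_ge0.
- move=> k w; rewrite fineK// /exp_moment.
  by apply: eq_measure_integral => A mA _; exact: law.
Qed.

Section martingale.
Variables (phi : R -> R) (C : R).
Hypothesis phiE : forall u, exp_moment mu (fun x => u * x)%R = (expR (phi u))%:E.
Hypothesis mphi : measurable_fun setT phi.
Hypothesis phi_le : forall u, phi u <= C * u ^+ 2.

(** Given the past, [V k] is a constant and [phi] normalizes the exponential of
    [V k * zeta k]. *)
Lemma exp_martingale (V : nat -> T -> R) N :
  (forall k, measurable_fun setT (V k : past zeta k -> R)) ->
  exp_moment P (fun w => \sum_(k < N) (V k w * zeta k w - phi (V k w)))%R = 1%E.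
Proof.
move=> mV.
have E := @expectation_prod_predictable _ _ _ P zeta indep
  (fun k w y => expR (V k w * y - phi (V k w))) 1 _ _ _ N.
rewrite /exp_moment; under eq_integral do rewrite expR_sum.
rewrite E ?expr1n//.
- move=> k; apply: measurableT_comp => //; apply: measurable_funB.
    by apply: measurable_funM => //; exact: (measurableT_comp (mV k) measurable_fst).
  apply: measurableT_comp => //; exact: (measurableT_comp (mV k) measurable_fst).
- move=> k w.
  transitivity (exp_moment mu (fun y => V k w * y + - phi (V k w))%R).
    by apply: eq_measure_integral => A mA _; exact: law.
  rewrite exp_momentD; last exact: measurable_funM.
  by rewrite phiE -EFinM -expRD addNr expR0.
Qed.

(** Cauchy-Schwarz: [sum V z] is the half-sum of the exponent of the martingale for
    [2 V] and of [phi (2 V) <= 4 C V^2]. *)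
Lemma exp_moment_predictable (V : nat -> T -> R) N (b : R) :
  (forall k, measurable_fun setT (V k : past zeta k -> R)) ->
  (exp_moment P (fun w => 4 * C * \sum_(k < N) V k w ^+ 2)%R <= (expR b)%:E)%E ->
  (exp_moment P (fun w => \sum_(k < N) V k w * zeta k w)%R <= (expR (b / 2))%:E)%E.
Proof.
move=> mV hb.
have mV' k : measurable_fun setT (V k).
  exact: (measurableT_comp (mV k) (@measurable_past_id _ _ _ _ zeta k)).
have mS : measurable_fun setT (fun w => 4 * C * \sum_(k < N) V k w ^+ 2).
  by apply: measurable_funM => //; apply: measurable_sum => k; exact: measurable_funX.
pose f w := \sum_(k < N) (2 * V k w * zeta k w - phi (2 * V k w)).
have mf : measurable_fun setT f.
  apply: measurable_sum => k; apply: measurable_funB.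
    by apply: measurable_funM => //; exact: measurable_funM.
  by apply: measurableT_comp => //; exact: measurable_funM.
have fE : exp_moment P f = 1%E.
  by apply: (@exp_martingale (fun k w => 2 * V k w)) => k; exact: measurable_funM.
have f1 : (exp_moment P f <= (expR 0)%:E)%E by rewrite fE expR0.
have h01 : 0 <= (2^-1 : R) <= 1 by apply/andP; split; lra.
have := exp_moment_hoelder mf mS h01 f1 hb.
rewrite mulr0 add0r (_ : (1 - 2^-1) * b = b / 2); last by field.
apply: le_trans; apply: exp_moment_le.
- by apply: measurable_sum => k; exact: measurable_funM.
- by apply: measurable_funD; apply: measurable_funM.
apply: aeW => w /=; rewrite /f (_ : 1 - 2^-1 = 2^-1 :> R); last by field.
rewrite -mulrDr mulr_sumr -big_split mulr_sumr; apply: ler_sum => k _ /=.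
have := phi_le (2 * V k w); rewrite exprMn; lra.
Qed.

End martingale.

Section ar_estimates.
Variables (theta : R).
Hypothesis theta01 : 0 <= theta < 1.

Let e0 : 0 < 1 - theta. Proof. by case/andP : theta01; rewrite subr_gt0. Qed.

(** The autoregression started from 0 at time 0; its state at time [k] depends on
    the first [k] variables only. *)
Definition ar_from0 k w := ar_filter theta (fun i => zeta i w) k.

Lemma measurable_ar_from0_past j k : (j <= k)%N ->
  measurable_fun setT (ar_from0 j : past zeta k -> R).
Proof.
elim: j => [|j IH] jk; first exact: measurable_cst.
rewrite /ar_from0/=; apply: measurable_funD.
  by apply: measurable_funM => //; exact: (IH (ltnW jk)).
exact: measurable_past.
Qed.

Lemma measurable_ar_from0 k : measurable_fun setT (ar_from0 k).
Proof.
apply: (@measurableT_comp _ _ _ T (past zeta k) _ (ar_from0 k) _ (id : T -> past zeta k)).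
  exact: measurable_ar_from0_past.
exact: measurable_past_id.
Qed.

Section exponential_moments.
Variables (alpha kap : R).
Hypothesis alpha0 : 0 < alpha.
Hypothesis mu_sqr : forall c, 0 <= c <= alpha ->
  (exp_moment mu (fun x => c * x ^+ 2)%R <= (expR (kap * c))%:E)%E.

Lemma exp_moment_sum_sqr c N : 0 <= c -> c / (1 - theta) ^+ 2 <= alpha ->
  (exp_moment P (fun w => c * \sum_(k < N) ar_from0 k w ^+ 2)%R <=
   (expR (N%:R * (kap * (c / (1 - theta) ^+ 2))))%:E)%E.
Proof.
move=> c0 ca.
have mh : measurable_fun setT (fun x : R => c / (1 - theta) ^+ 2 * x ^+ 2).
  by apply: measurable_funM => //; exact: measurable_funX.
have c1 : 0 <= c / (1 - theta) ^+ 2 <= alpha by rewrite ca andbT divr_ge0// sqr_ge0.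
apply: le_trans (exp_moment_sum_iid N mh (mu_sqr c1)); apply: exp_moment_le.
- apply: measurable_funM => //; apply: measurable_sum => k; apply: measurable_funX.
  exact: measurable_ar_from0.
- by apply: measurable_sum => k; exact: (measurableT_comp mh (measurable_funP (zeta k))).
apply: aeW => w; rewrite -mulr_sumr -mulrA; apply: ler_wpM2l => //.
exact: ar_filter_sum_sqr.
Qed.

(** The predictable coefficient of [zeta i] is [c * ar_from0 (i - j)], and 0 for
    [i < j].  The terms [zeta (k + j)] are shifted [j] steps into the future of the
    factor [ar_from0 k], so the products stay martingale differences. *)
Lemma exp_moment_cross_product (phi : R -> R) (C c : R) j N :
  (forall u, exp_moment mu (fun x => u * x)%R = (expR (phi u))%:E) ->
  measurable_fun setT phi -> 0 <= C -> (forall u, phi u <= C * u ^+ 2) ->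
  4 * C * c ^+ 2 / (1 - theta) ^+ 2 <= alpha ->
  (exp_moment P (fun w => c * \sum_(k < N) ar_from0 k w * zeta (k + j)%N w)%R <=
   (expR (N%:R * (kap * (4 * C * c ^+ 2 / (1 - theta) ^+ 2)) / 2))%:E)%E.
Proof.
move=> phiE mphi C0 phiC ca.
pose V k w := if (j <= k)%N then c * ar_from0 (k - j) w else 0.
have mV k : measurable_fun setT (V k : past zeta k -> R).
  have -> : V k = if (j <= k)%N then fun w => c * ar_from0 (k - j) w else cst 0.
    by rewrite /V; case: ifP.
  case: ifP => [jk|_]; last exact: measurable_cst.
  apply: measurable_funM => //.
  exact: measurable_ar_from0_past (leq_subr j k).
have shift (g : nat -> nat -> R) :
    \sum_(i < j + N) (if (j <= i)%N then g (i - j)%N i else 0) = \sum_(k < N) g k (k + j)%N.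
  rewrite big_split_ord/= big1 ?add0r; last by move=> i _; rewrite leqNgt ltn_ord.
  by apply: eq_bigr => k _; rewrite leq_addr addKn addnC.
have SE w : \sum_(k < j + N) V k w * zeta k w =
    c * \sum_(k < N) ar_from0 k w * zeta (k + j)%N w.
  rewrite mulr_sumr -(shift (fun k i => c * (ar_from0 k w * zeta i w))).
  by apply: eq_bigr => i _; rewrite /V; case: ifP; rewrite ?mul0r// mulrA.
have S2E w : \sum_(k < j + N) V k w ^+ 2 = c ^+ 2 * \sum_(k < N) ar_from0 k w ^+ 2.
  rewrite mulr_sumr -(shift (fun k i => c ^+ 2 * ar_from0 k w ^+ 2)).
  by apply: eq_bigr => i _; rewrite /V; case: ifP; rewrite ?expr0n// exprMn.
have c1 : 0 <= 4 * C * c ^+ 2 by rewrite mulr_ge0 ?sqr_ge0// mulr_ge0.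
have := exp_moment_sum_sqr N c1 ca.
under [X in exp_moment P X]eq_fun do rewrite -(mulrA (4 * C)) -S2E.
move=> /(exp_moment_predictable phiE mphi phiC mV).
by under [X in exp_moment P X]eq_fun do rewrite SE.
Qed.

End exponential_moments.

Lemma exp_moment_sum_capped_cube (b s t : R) N : 0 <= s ->
  (exp_moment mu (fun x => s * capped_cube (t / (1 - theta) * x))%R <= (expR b)%:E)%E ->
  (exp_moment P (fun w => s * \sum_(k < N) capped_cube (t * ar_from0 k w))%R <=
   (expR (N%:R * b))%:E)%E.
Proof.
move=> s0 hb.
have mh : measurable_fun setT (fun x : R => s * capped_cube (t / (1 - theta) * x)).
  apply: measurable_funM => //.
  by apply: (measurableT_comp measurable_capped_cube); exact: measurable_funM.
apply: le_trans (exp_moment_sum_iid N mh hb); apply: exp_moment_le.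
- apply: measurable_funM => //; apply: measurable_sum => k.
  apply: (measurableT_comp measurable_capped_cube); apply: measurable_funM => //.
  exact: measurable_ar_from0.
- by apply: measurable_sum => k; exact: (measurableT_comp mh (measurable_funP (zeta k))).
apply: aeW => w; rewrite -mulr_sumr; apply: ler_wpM2l => //.
have := @ar_filter_sum_convex _ theta (fun i => zeta i w)
  (fun x => capped_cube (t * x)) N theta01 (fun x => capped_cube_ge0 _).
rewrite /ar_from0 => /(_ _ _)/le_trans; apply.
- by rewrite mulr0 /capped_cube normr0 expr0n/= mul0r.
- move=> p x y p01; rewrite mulrDr mulrCA [t * (_ * y)]mulrCA.
  exact: capped_cube_convex.
- by apply: ler_sum => i _; rewrite mulrA mulrAC.
Qed.

End ar_estimates.

End iid_estimates.

Section filter_second_moment.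
Context d (T : measurableType d) (R : realType) (P : probability T R).

(** By convexity of the square and Hoelder's inequality, the recursion keeps a
    uniform bound on the exponential moments, whatever the joint law of the inputs. *)
Lemma exp_moment_ar_filter_sqr (theta c b : R) (a : nat -> T -> R) k :
  0 <= theta < 1 -> 0 <= b -> (forall i, measurable_fun setT (a i)) ->
  (forall i, (exp_moment P (fun w => c / (1 - theta) ^+ 2 * a i w ^+ 2)%R <= (expR b)%:E)%E) ->
  0 <= c ->
  (exp_moment P (fun w => c * ar_filter theta (fun i => a i w) k ^+ 2)%R <= (expR b)%:E)%E.
Proof.
move=> t01 b0 ma hb c0; have /andP[t0 t1] := t01.
have e0 : 1 - theta != 0 by rewrite subr_eq0 gt_eqF.
have mf k' : measurable_fun setT (fun w => ar_filter theta (fun i => a i w) k').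
  elim: k' => [|k' IH] /=; first exact: measurable_cst.
  by apply: measurable_funD => //; exact: measurable_funM.
elim: k => [|k IH].
  by rewrite /= expr0n/= mulr0 exp_moment_cst lee_fin ler_expR.
have mk : measurable_fun setT (fun w => c * ar_filter theta (fun i => a i w) k ^+ 2).
  by apply: measurable_funM => //; exact: measurable_funX.
have mak : measurable_fun setT (fun w => c / (1 - theta) ^+ 2 * a k w ^+ 2).
  by apply: measurable_funM => //; exact: measurable_funX.
have t01' : 0 <= theta <= 1 by rewrite t0 ltW.
have := exp_moment_hoelder mk mak t01' IH (hb k).
rewrite -mulrDl subrKC mul1r; apply: le_trans; apply: exp_moment_le.
- by apply: measurable_funM => //; apply: measurable_funX; exact: (mf k.+1).
- by apply: measurable_funD; exact: measurable_funM.
apply: aeW => w /=.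
have := sqr_convex (ar_filter theta (fun i => a i w) k) (a k w / (1 - theta)) t01'.
rewrite [(1 - theta) * (_ / _)]mulrC divfK// expr_div_n.
move=> /(ler_wpM2l c0) /le_trans; apply.
by rewrite mulrDr le_eqVlt; apply/orP; left; apply/eqP; ring.
Qed.

(** Jensen's inequality: the weights [(1 - theta) theta^k] add up to at most 1. *)
Lemma exp_moment_geometric_sum (theta c b : R) (F : nat -> T -> R) N :
  0 <= theta < 1 -> 0 <= b -> (forall k, measurable_fun setT (F k)) ->
  (forall k, (exp_moment P (fun w => c / (1 - theta) * F k w)%R <= (expR b)%:E)%E) ->
  (exp_moment P (fun w => c * \sum_(k < N) theta ^+ k * F k w)%R <= (expR b)%:E)%E.
Proof.
move=> /andP[t0 t1] b0 mF hF.
have e0 : 0 < 1 - theta by rewrite subr_gt0.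
have := @exp_moment_jensen _ _ _ P _ (index_enum 'I_N)
  (fun k => (1 - theta) * theta ^+ k) (fun k w => c / (1 - theta) * F k w) b.
have -> : (fun w => \sum_(i <- index_enum 'I_N) (1 - theta) * theta ^+ i *
      (c / (1 - theta) * F i w)) = (fun w => c * \sum_(k < N) theta ^+ k * F k w).
  apply/funext => w; rewrite mulr_sumr; apply: eq_bigr => k _.
  by field; rewrite lt0r_neq0.
apply => //.
- by move=> k; exact: measurable_funM.
- by move=> k; rewrite mulr_ge0 ?exprn_ge0// ltW.
- by rewrite -mulr_sumr; exact: geometric_sum_le1.
Qed.

End filter_second_moment.

(** * The stationary process *)

Section measurable_limit.
Context d (T : measurableType d) (R : realType).

(** Convergence through countably many conditions, for measurability. *)
Lemma cvgn_cauchyP (u : nat -> R) : cvgn u <->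
  forall j : nat, exists N : nat, forall n : nat, (N <= n)%N ->
    `|u n - u N| <= j.+1%:R^-1.
Proof.
split.
  move=> /cvg_ex[l /cvgrPdist_le ul] j.
  have j0 : 0 < (j.+1%:R : R)^-1 / 2 by rewrite divr_gt0// invr_gt0.
  have [N _ hN] := ul _ j0; exists N => n Nn.
  have := hN n Nn; have := hN N (leqnn N) => /= h1 h2.
  rewrite -(subrKA l) (splitr (j.+1%:R^-1)); apply: le_trans (ler_normD _ _) _.
  by rewrite lerD// distrC.
move=> H; apply: cauchy_cvg; apply: cauchy_exP => eps eps0.
have [j _ hj] : exists2 j : nat, True & (j.+1%:R : R)^-1 < eps.
  have := @near_infty_natSinv_lt R (PosNum eps0).
  by case=> N _ /(_ N (leqnn N)) /= h; exists N.
have [N hN] := H j; exists (u N); exists N => // n Nn /=.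
by rewrite /ball/= distrC; apply: le_lt_trans hj; exact: hN.
Qed.

Lemma measurable_cvgn (u : nat -> T -> R) :
  (forall n, measurable_fun setT (u n)) ->
  measurable [set w | cvgn (fun n => u n w)].
Proof.
move=> mu.
rewrite (_ : [set w | _] = \bigcap_j \bigcup_N \bigcap_(n in [set n | (N <= n)%N])
    [set w | `|u n w - u N w| <= j.+1%:R^-1]); last first.
  apply/seteqP; split => w /=.
    by move=> /cvgn_cauchyP h j _; have [N hN] := h j; exists N => // n /= Nn; exact: hN.
  move=> h; apply/cvgn_cauchyP => j; have [N _ hN] := h j I.
  by exists N => n Nn; exact: hN.
apply: bigcapT_measurable => j; apply: bigcupT_measurable => N.
apply: bigcap_measurableType => n _.
rewrite (_ : [set w | _] = [set w | - j.+1%:R^-1 <= - `|u n w - u N w|]).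
  apply: measurable_ge; apply: measurable_funN; apply: measurableT_comp => //.
  exact: measurable_funB.
by apply/seteqP; split => w /=; rewrite lerN2.
Qed.

(** Off the measurable set of convergence, [limn] is the constant default value. *)
Lemma measurable_fun_limn (u : nat -> T -> R) :
  (forall n, measurable_fun setT (u n)) ->
  measurable_fun setT (fun w => limn (fun n => u n w)).
Proof.
move=> mu; have mO := measurable_cvgn mu.
rewrite -(setUv [set w | cvgn (fun n => u n w)]).
apply/measurable_funU => //; first exact: measurableC.
split.
  apply: (@measurable_fun_cvg _ _ _ _ u) => [n|w /= cw].
    exact: measurable_funTS.
  exact: cw.
apply: (@eq_measurable_fun _ _ _ _ _ (cst point)).
  by move=> w; rewrite inE/= => /dvgP ->.
exact: measurable_cst.
Qed.

End measurable_limit.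

Section fatou.
Context d (T : measurableType d) (R : realType) (P : probability T R).

(** Fatou's lemma; almost everywhere the lower limit is the exponential of the limit. *)
Lemma exp_moment_fatou (g : nat -> T -> R) (f : T -> R) (M : R) :
  (forall m, measurable_fun setT (g m)) -> measurable_fun setT f ->
  {ae P, forall w, g m w @[m --> \oo] --> f w} ->
  (forall m, exp_moment P (g m) <= M%:E)%E -> (exp_moment P f <= M%:E)%E.
Proof.
move=> mg mf gf gM.
pose u w m := (expR (g m w))%:E.
have mu m : measurable_fun setT (u ^~ m) by exact: measurable_exp_fun.
have u0 w m : (0 <= u w m)%E by rewrite lee_fin expR_ge0.
apply: (@le_trans _ _ (\int[P]_w limn_einf (u w))%E).
  apply: ae_ge0_le_integral => //.
  - exact: measurable_exp_fun.
  - move=> w _; rewrite limn_einf_lim; apply: lime_ge; first exact: is_cvg_einfs.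
    by apply: nearW => n; apply: le_ereal_inf_tmp => _ [k _ <-].
  - rewrite (_ : (fun w => _) = (fun w => - limn_esup (fun m => - u w m))%E).
      apply: measurableT_comp => //; apply: measurable_fun_limn_esup => m.
      exact: measurableT_comp.
    by apply/funext => w; rewrite -[LHS]oppeK -limn_esupN.
  - apply: filterS gf => w gw _.
    have uw : u w m @[m --> \oo] --> (expR (f w))%:E.
      apply: cvg_EFin; first exact: nearW.
      by apply: continuous_cvg => //; exact: continuous_expR.
    by rewrite (cvg_limn_einf_sup uw).1.
apply: le_trans (fatou P measurableT mu (fun m w _ => u0 w m)) _.
rewrite limn_einf_lim; apply: lime_le; first exact: is_cvg_einfs.
apply: nearW => n; apply: le_trans (gM n); apply: ereal_inf_lbound.
by exists n => /=.
Qed.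

End fatou.

Section stationary.
Context d (T : measurableType d) (R : realType) (P : probability T R).
Variables (xi : int -> {RV P >-> R}) (theta : R).

Local Notation X := (ar_process theta (fun k => xi k)).

Lemma measurable_ar_process k : measurable_fun setT (X k).
Proof.
apply: measurable_fun_limn => n; apply: measurable_sum => p.
by apply: measurable_funM => //; exact: measurable_funP.
Qed.

Lemma measurable_empirical_covariance n l : measurable_fun setT (empirical_covariance X n l).
Proof.
apply: measurable_funM => //; apply: measurable_sum => k.
by apply: measurable_funM; exact: measurable_ar_process.
Qed.

(** The shift by one makes [innovation k] the noise that enters between the times [k]
    and [k + 1], as for the inputs of [ar_filter]. *)
Definition innovation i : {RV P >-> R} := xi i.+1%:Z.

Lemma ar_process_recursion w k :
  cvgn (series (fun p => theta ^+ p * xi (k%:Z - p%:Z) w)) ->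
  cvgn (series (fun p => theta ^+ p * xi (k.+1%:Z - p%:Z) w)) /\
  X k.+1 w = theta * X k w + innovation k w.
Proof.
move=> ck.
have H : series (fun p => theta ^+ p * xi (k.+1%:Z - p%:Z) w) n @[n --> \oo] -->
    theta * X k w + innovation k w.
  rewrite -(cvg_shiftS _ _).
  have -> : (fun n => series (fun p => theta ^+ p * xi (k.+1%:Z - p%:Z) w) n.+1) =
     (fun n => theta * series (fun p => theta ^+ p * xi (k%:Z - p%:Z) w) n + innovation k w).
    apply/funext => n; rewrite /series/= big_nat_recl//= expr0 mul1r subr0 addrC.
    congr (_ + _); rewrite mulr_sumr; apply: eq_bigr => p _.
    by rewrite exprS mulrA; congr (_ * xi _ w); lia.
  apply: cvgD; last exact: cvg_cst.
  by apply: cvgZr; exact: ck.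
by split; [apply/cvg_ex; exists (theta * X k w + innovation k w)|exact/cvg_lim].
Qed.

(** Convergence of the series at time 0 propagates to all later times. *)
Lemma ar_process_from0 w k :
  cvgn (series (fun p => theta ^+ p * xi (0%:Z - p%:Z) w)) ->
  X k w = ar_filter theta (fun i => innovation i w) k + theta ^+ k * X 0 w.
Proof.
move=> c0.
suff [] : cvgn (series (fun p => theta ^+ p * xi (k%:Z - p%:Z) w)) /\
  X k w = ar_filter theta (fun i => innovation i w) k + theta ^+ k * X 0 w by [].
elim: k => [|k [ck IH]]; first by rewrite /= add0r mul1r.
have [cS E] := ar_process_recursion ck; split => //.
by rewrite E IH /= exprS; ring.
Qed.

Hypothesis theta01 : 0 <= theta < 1.
Variable m1 : R.
Hypothesis abs_moment : forall i, (\int[P]_w (`|xi i w|)%:E <= m1%:E)%E.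

(** The series of the absolute values has a finite expectation, bounded by a
    geometric sum. *)
Lemma ar_series_cvg_ae : {ae P, forall w,
  cvgn (series (fun p => theta ^+ p * xi (0%:Z - p%:Z) w))}.
Proof.
have /andP[t0 t1] := theta01.
pose f (p : nat) w := (`|theta ^+ p * xi (0%:Z - p%:Z) w|)%:E.
have mf p : measurable_fun setT (f p).
  apply/measurable_EFinP; apply: measurableT_comp => //.
  by apply: measurable_funM => //; exact: measurable_funP.
have f0 p w : (0 <= f p w)%E by rewrite lee_fin.
have intf : P.-integrable setT (fun w => \sum_(0 <= p <oo) f p w)%E.
  apply/integrableP; split; first exact: ge0_emeasurable_sum.
  under eq_integral do rewrite gee0_abs ?nneseries_ge0//.
  rewrite integral_nneseries//.
  apply: (@le_lt_trans _ _ (m1 / (1 - theta))%:E); last exact: ltry.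
  have m10 : 0 <= m1.
    by rewrite -lee_fin; apply: le_trans (abs_moment 0); exact: integral_ge0.
  apply: lime_le; first by apply: is_cvg_nneseries => n _ _; exact: integral_ge0.
  apply: nearW => n.
  apply: (@le_trans _ _ (\sum_(0 <= p < n) (theta ^+ p * m1)%:E)%E).
    apply: lee_sum => p _; rewrite /f.
    under eq_integral do rewrite normrM (ger0_norm (exprn_ge0 _ t0)) EFinM.
    rewrite ge0_integralZl_EFin ?exprn_ge0//.
      by rewrite EFinM; apply: lee_wpmul2l; rewrite ?lee_fin ?exprn_ge0.
    apply/measurable_EFinP; apply: measurableT_comp => //; exact: measurable_funP.
  rewrite sumEFin lee_fin -mulr_suml mulrC ler_wpM2l// big_mkord.
  have e0 : 0 < 1 - theta by rewrite subr_gt0.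
  rewrite -(ler_pM2l e0) mulfV ?lt0r_neq0//; exact: geometric_sum_le1.
apply: filterS (integrable_ae measurableT intf) => w /(_ I) fw.
apply: normed_cvg; apply: nondecreasing_is_cvgn.
  apply/nondecreasing_seqP => n; rewrite -subr_ge0 seriesSB.
  exact: normr_ge0.
exists (fine (\sum_(0 <= p <oo) f p w)%E) => _ [n _ <-].
rewrite -lee_fin fineK// /series/= -sumEFin.
by apply: nneseries_lim_ge => p _ _; exact: f0.
Qed.

(** Each partial sum of the series is an [ar_filter] of the noise in reversed order of
    time; the bound passes to the limit. *)
Lemma exp_moment_stationary c b : 0 <= c -> 0 <= b ->
  (forall i, (exp_moment P (fun w => c / (1 - theta) ^+ 2 * xi i w ^+ 2)%R <= (expR b)%:E)%E) ->
  (exp_moment P (fun w => c * X 0 w ^+ 2)%R <= (expR b)%:E)%E.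
Proof.
move=> c0 b0 hb.
pose S m w := series (fun p => theta ^+ p * xi (0%:Z - p%:Z) w) m.
have mS m : measurable_fun setT (S m).
  by apply: measurable_sum => p; apply: measurable_funM => //; exact: measurable_funP.
have mcS m : measurable_fun setT (fun w => c * S m w ^+ 2).
  by apply: measurable_funM => //; exact: measurable_funX.
have hS m : (exp_moment P (fun w => c * S m w ^+ 2)%R <= (expR b)%:E)%E.
  pose a i w := xi (0%:Z - (m.-1 - i)%N%:Z) w.
  have -> : (fun w => c * S m w ^+ 2) = (fun w => c * ar_filter theta (fun i => a i w) m ^+ 2).
    apply/funext => w; congr (_ * _ ^+ 2); rewrite ar_filterE /S /series/=.
    rewrite big_mkord (reindex_inj rev_ord_inj)/=; apply: eq_bigr => i _.
    by rewrite /a subnS -subn1 subnAC subn1.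
  by apply: exp_moment_ar_filter_sqr => // i; exact: hb.
have mX0 : measurable_fun setT (fun w => c * X 0 w ^+ 2).
  by apply: measurable_funM => //; apply: measurable_funX; exact: measurable_ar_process.
apply: (exp_moment_fatou mcS mX0 _ hS).
apply: filterS ar_series_cvg_ae => w cw.
apply: cvgM; first exact: cvg_cst.
by apply: cvgM; exact: cw.
Qed.

End stationary.

(** * Calculus of exponentially negligible sequences *)

Section negligible_calculus.
Context d (T : measurableType d) (R : realType) (P : probability T R).
Variable B : nat -> R.
Hypothesis Boo : B n @[n --> \oo] --> +oo.
Implicit Types (D : nat -> T -> R) (a e : nat -> R).

Definition small_wrt e := forall eta : R, 0 < eta ->
  \forall n \near \oo, e n <= eta * B n.

Let B0 : \forall n \near \oo, 0 < B n.
Proof. by move/cvgryPgt : Boo; exact. Qed.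

Lemma exp_negligible_le D D' :
  (forall n, measurable_fun setT (D n)) -> (forall n, measurable_fun setT (D' n)) ->
  (\forall n \near \oo, {ae P, forall w, `|D n w| <= `|D' n w|}) ->
  exp_negligible P B D' -> exp_negligible P B D.
Proof.
move=> mD mD' DD' H s eta s0 eta0.
apply: filterS2 DD' (H s eta s0 eta0) => n h; apply: le_trans.
apply: exp_moment_le.
- by apply: measurable_funM => //; exact: measurableT_comp.
- by apply: measurable_funM => //; exact: measurableT_comp.
- by apply: filterS h => w; rewrite ler_pM2l.
Qed.

(** Cauchy-Schwarz, as every multiple of a negligible sequence is
    negligible. *)
Lemma exp_negligibleD D D' :
  (forall n, measurable_fun setT (D n)) -> (forall n, measurable_fun setT (D' n)) ->
  exp_negligible P B D -> exp_negligible P B D' ->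
  exp_negligible P B (fun n w => D n w + D' n w).
Proof.
move=> mD mD' H H' s eta s0 eta0.
have s20 : 0 < 2 * s by rewrite mulr_gt0.
have h01 : 0 <= (2^-1 : R) <= 1 by apply/andP; split; lra.
have mm D0 n : (forall n, measurable_fun setT (D0 n)) ->
    measurable_fun setT (fun w => 2 * s * `|D0 n w|).
  by move=> mD0; apply: measurable_funM => //; exact: measurableT_comp.
apply: filterS2 (H _ _ s20 eta0) (H' _ _ s20 eta0) => n h h'.
have := exp_moment_hoelder (mm _ n mD) (mm _ n mD') h01 h h'.
rewrite (_ : 1 - 2^-1 = 2^-1 :> R); last by field.
rewrite (_ : 2^-1 * (eta * B n) + 2^-1 * (eta * B n) = eta * B n); last by field.
apply: le_trans; apply: exp_moment_le.
- apply: measurable_funM => //; apply: measurableT_comp => //; exact: measurable_funD.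
- apply: measurable_funD; apply: measurable_funM => //; exact: mm.
- apply: aeW => w; have := ler_wpM2l (ltW s0) (ler_normD (D n w) (D' n w)); lra.
Qed.

Lemma exp_negligible0 : exp_negligible P B (fun _ _ => 0).
Proof.
move=> s eta s0 eta0; apply: filterS B0 => n Bn0.
rewrite normr0 mulr0 exp_moment_cst lee_fin ler_expR.
by rewrite mulr_ge0// ltW.
Qed.

Lemma exp_negligible_sum m (D : 'I_m -> nat -> T -> R) :
  (forall i n, measurable_fun setT (D i n)) ->
  (forall i, exp_negligible P B (D i)) ->
  exp_negligible P B (fun n w => \sum_(i < m) D i n w).
Proof.
elim: m D => [|m IH] D mD HD.
  move=> s eta s0 eta0; apply: filterS (exp_negligible0 s0 eta0) => n.
  by under [X in (_ -> exp_moment P X <= _)%E]eq_fun do rewrite big_ord0.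
have -> : (fun n w => \sum_(i < m.+1) D i n w) =
    (fun n w => D ord0 n w + \sum_(i < m) D (lift ord0 i) n w).
  by apply/funext => n; apply/funext => w; rewrite big_ord_recl.
apply: exp_negligibleD => //; last by apply: IH.
by move=> n; exact: measurable_sum.
Qed.

Lemma exp_negligible_ge0 D :
  (forall n, measurable_fun setT (D n)) -> (forall n w, 0 <= D n w) ->
  (forall s, 0 < s -> exists2 a, small_wrt a & \forall n \near \oo,
    (exp_moment P (fun w => s * D n w)%R <= (expR (a n))%:E)%E) ->
  exp_negligible P B D.
Proof.
move=> mD D0 H s eta s0 eta0; have [a aB ha] := H s s0.
apply: filterS2 (aB _ eta0) ha => n h1 h2.
under [X in exp_moment P X]eq_fun do rewrite ger0_norm//.
by apply: le_trans h2 _; rewrite lee_fin ler_expR.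
Qed.

(** The constant [ln 2] paid for the absolute value is negligible since [B] tends to
    infinity. *)
Lemma exp_negligible_two_sided D :
  (forall n, measurable_fun setT (D n)) ->
  (forall s, exists2 a, small_wrt a & \forall n \near \oo,
    (exp_moment P (fun w => s * D n w)%R <= (expR (a n))%:E)%E) ->
  exp_negligible P B D.
Proof.
move=> mD H s eta s0 eta0.
have [a aB ha] := H s; have [a' aB' ha'] := H (- s).
have e30 : 0 < eta / 3 by rewrite divr_gt0.
have Bbig : \forall n \near \oo, 3 * ln 2 / eta < B n by move/cvgryPgt : Boo; exact.
have := eventually_and (eventually_and B0 Bbig) (eventually_and
  (eventually_and (aB _ e30) (aB' _ e30)) (eventually_and ha ha')).
apply: filterS => n [[Bn0 Bn1] [[h1 h2] [h3 h4]]].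
have msD : measurable_fun setT (fun w => s * D n w) by exact: measurable_funM.
have h3' : (exp_moment P (fun w => s * D n w)%R <= (expR (eta / 3 * B n))%:E)%E.
  by apply: le_trans h3 _; rewrite lee_fin ler_expR.
have h4' : (exp_moment P (fun w => - (s * D n w))%R <= (expR (eta / 3 * B n))%:E)%E.
  have : (exp_moment P (fun w => - s * D n w)%R <= (expR (eta / 3 * B n))%:E)%E.
    by apply: le_trans h4 _; rewrite lee_fin ler_expR.
  by under [X in exp_moment P X]eq_fun do rewrite mulNr.
have := exp_moment_abs msD h3' h4'.
under [X in exp_moment P X]eq_fun do rewrite normrM (gtr0_norm s0).
move=> /le_trans; apply; rewrite lee_fin ler_expR.
have : ln 2 <= eta / 3 * B n.
  by move: Bn1; rewrite ltr_pdivrMr// => /ltW; lra.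
have : 0 <= eta * B n by rewrite mulr_ge0 ?ltW.
lra.
Qed.

Lemma exp_negligible_cst (e : nat -> R) :
  small_wrt (fun n => `|e n|) -> exp_negligible P B (fun n _ => e n).
Proof.
move=> he s eta s0 eta0.
have es0 : 0 < eta / s by rewrite divr_gt0.
apply: filterS (he _ es0) => n h.
rewrite exp_moment_cst lee_fin ler_expR.
have := ler_wpM2l (ltW s0) h; rewrite mulrCA -mulrA mulKf ?lt0r_neq0//.
Qed.

End negligible_calculus.

(** * The negligible remainders *)

(** The facts about the law [mu] of the noise on which all estimates rest:
    [phi] is its cumulant generating function. *)
Record noise_bounds (R : realType) (mu : probability R R)
    (alpha kap C K2 K3 Kphi s2 : R) (phi : R -> R) : Prop := NoiseBounds {
  nb_alpha : 0 < alpha;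
  nb_s2 : 0 <= s2;
  nb_kap : 0 <= kap;
  nb_C : 0 <= C;
  nb_K2 : 0 <= K2;
  nb_K3 : 0 <= K3;
  nb_Kphi : 0 <= Kphi;
  nb_sqr : forall c, 0 <= c <= alpha ->
    (exp_moment mu (fun x => c * x ^+ 2)%R <= (expR (kap * c))%:E)%E;
  nb_cgf : forall u, exp_moment mu (fun x => u * x)%R = (expR (phi u))%:E;
  nb_mphi : measurable_fun setT phi;
  nb_phi_le : forall u, phi u <= C * u ^+ 2;
  nb_phi_taylor : forall u,
    `|phi u - s2 * u ^+ 2 / 2| <= Kphi * capped_cube u;
  nb_centered_sqr : forall c, `|c| <= alpha / 2 ->
    (exp_moment mu (fun x => c * (x ^+ 2 - s2))%R <= (expR (K2 * c ^+ 2))%:E)%E;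
  nb_capped_cube : forall s u, 0 <= s -> s * u ^+ 2 <= alpha / 2 ->
    (exp_moment mu (fun x => s * capped_cube (u * x))%R <=
     (expR (K3 * (s * `|u| ^+ 3)))%:E)%E }.

Lemma noise_bounds_exist (R : realType) (mu : probability R R)
    (alpha Ea s2 : R) : 0 < alpha ->
  (\int[mu]_x (expR (alpha * x ^+ 2))%:E = Ea%:E)%E ->
  (\int[mu]_x x%:E = 0)%E -> (\int[mu]_x (x ^+ 2)%:E = s2%:E)%E ->
  exists kap C K2 K3 Kphi, noise_bounds mu alpha kap C K2 K3 Kphi s2 (noise_cgf mu).
Proof.
move=> a0 muE mu1 mu2.
have s20 : 0 <= s2.
  by rewrite -lee_fin -mu2; apply: integral_ge0 => x _; rewrite lee_fin sqr_ge0.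
have E1 := noise_Ea_ge1 a0 muE mu1 mu2.
have E0 : 0 <= Ea by exact: le_trans E1.
have lnE := ln_ge0 E1.
have e9 : 0 <= 2 * expR (9 / (4 * alpha)) * Ea by rewrite mulr_ge0// mulr_ge0// expR_ge0.
have a4 : 0 <= (4 * alpha)^-1 by rewrite invr_ge0 mulr_ge0// ltW.
set c3 := 2 * expR (9 / (4 * alpha)) * Ea in e9.
exists (ln Ea / alpha), (s2 / 2 + c3 + (4 * alpha)^-1 + ln Ea),
  (8 / alpha ^+ 2 * expR (alpha * s2) * Ea), (2 * expR (2 / alpha) * Ea),
  (2 * (c3 + (s2 / 2 + c3) ^+ 2 + (s2 / 2 + c3 + (4 * alpha)^-1 + ln Ea) + s2)).
have C0 : 0 <= s2 / 2 + c3 + (4 * alpha)^-1 + ln Ea.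
  by rewrite !addr_ge0// divr_ge0.
split=> //.
- by apply: divr_ge0 => //; exact: ltW.
- by do 2 (apply: mulr_ge0 => //); rewrite ?expR_ge0// divr_ge0// sqr_ge0.
- by apply: mulr_ge0 => //; apply: mulr_ge0 => //; exact: expR_ge0.
- apply: mulr_ge0 => //; apply: addr_ge0 => //; apply: addr_ge0 => //.
  by apply: addr_ge0 => //; exact: sqr_ge0.
- exact: (noise_square a0 muE mu1 mu2).
- exact: (noise_cgfE a0 muE mu1 mu2).
- exact: measurable_noise_cgf.
- exact: (noise_cgf_le_sqr a0 muE mu1 mu2).
- exact: (noise_cgf_taylor a0 muE mu1 mu2).
- exact: (noise_centered_square a0 muE mu1 mu2).
- exact: (noise_capped_cube a0 muE mu1 mu2).
Qed.

(** The remainders are studied for an abstract tilting parameter [t], small with respect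
    to [(1 - theta)^2], and an abstract number of terms [N] such that [N t^2] is of order
    [B (1 - theta)]. *)
Section negligible_terms.
Context d (T : measurableType d) (R : realType) (P : probability T R).
Variables (mu : probability R R) (xi : int -> {RV P >-> R}).
Local Notation zeta := (innovation xi).
Hypothesis indep : mutually_independent zeta.
Hypothesis law : forall i (B : set R), measurable B ->
  distribution P (xi i) B = mu B.

Let zlaw i (B : set R) : measurable B -> distribution P (zeta i) B = mu B.
Proof. exact: law. Qed.

Variables (alpha kap C K2 K3 Kphi s2 : R) (phi : R -> R).
Hypothesis nb : noise_bounds mu alpha kap C K2 K3 Kphi s2 phi.

Let alpha0 := nb_alpha nb.
Let kap0 := nb_kap nb.
Let C0 := nb_C nb.
Let K20 := nb_K2 nb.
Let K30 := nb_K3 nb.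
Let Kphi0 := nb_Kphi nb.
Let mu_sqr := nb_sqr nb.
Let mu_cgf := nb_cgf nb.
Let mphi := nb_mphi nb.
Let phi_le := nb_phi_le nb.
Let phi_taylor := nb_phi_taylor nb.
Let mu_centered_sqr := nb_centered_sqr nb.
Let mu_capped_cube := nb_capped_cube nb.

Variables (theta B t : nat -> R) (N : nat -> nat) (L : R).
Hypothesis Boo : B n @[n --> \oo] --> +oo.
Hypothesis theta01 : \forall n \near \oo, 0 <= theta n < 1.
Hypothesis eps_small : forall eta : R, 0 < eta ->
  \forall n \near \oo, 1 - theta n <= eta.
Hypothesis t_small : forall eta : R, 0 < eta ->
  \forall n \near \oo, `|t n| <= eta * (1 - theta n) ^+ 2.
Hypothesis L0 : 0 <= L.
Hypothesis t_budget : \forall n \near \oo,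
  (N n)%:R * t n ^+ 2 <= L * B n * (1 - theta n).

Local Notation Y n := (ar_from0 zeta (theta n)).
Local Notation negligible := (exp_negligible P B).

Let B0 : \forall n \near \oo, 0 < B n.
Proof. by move/cvgryPgt : Boo; exact. Qed.

Let mY n k : measurable_fun setT (Y n k). Proof. exact: measurable_ar_from0. Qed.

Let mz k : measurable_fun setT (zeta k). Proof. exact: measurable_funP. Qed.

(** [N t^2] is at most [L B (1 - theta)], and [1 - theta] tends to 0. *)
Let small_budget (K : R) : 0 <= K ->
  small_wrt B (fun n => K * ((N n)%:R * t n ^+ 2)).
Proof.
move=> K0 eta eta0.
have e0 : 0 < eta / (K * L + 1) by rewrite divr_gt0// ltr_wpDl// mulr_ge0.
have := eventually_and B0 (eventually_and t_budget (eps_small e0)).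
apply: filterS => n [Bn0 [h1 h2]].
have KL : 0 < K * L + 1 by rewrite ltr_wpDl// mulr_ge0.
apply: le_trans (ler_wpM2l K0 h1) _.
have -> : K * (L * B n * (1 - theta n)) = (1 - theta n) * (K * L) * B n by ring.
rewrite ler_wpM2r ?(ltW Bn0)//.
have [th1|th1] := leP 0 (1 - theta n).
  move: h2; rewrite ler_pdivlMr// => h2.
  by apply: le_trans h2; rewrite ler_wpM2l// lerDl.
by apply: (@le_trans _ _ 0); [rewrite mulr_le0_ge0 ?(ltW th1)// mulr_ge0|exact: ltW].
Qed.

Let small_ratio (K : R) : 0 <= K ->
  small_wrt B (fun n => K * (`|t n| / (1 - theta n) ^+ 2)).
Proof.
move=> K0 eta eta0.
have K1 : 0 < K + 1 by rewrite ltr_wpDl.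
have e0 : 0 < eta / (K + 1) by rewrite divr_gt0.
have Bbig : \forall n \near \oo, 1 < B n by move/cvgryPgt : Boo; exact.
have := eventually_and Bbig (eventually_and theta01 (t_small e0)).
apply: filterS => n [Bn1 [/andP[_ h1] h2]].
have ep : 0 < (1 - theta n) ^+ 2 by rewrite exprn_gt0// subr_gt0.
move: h2; rewrite -(ler_pdivrMr _ _ ep) => h2.
apply: (@le_trans _ _ eta); last by rewrite ler_peMr// ltW.
apply: le_trans (ler_wpM2l K0 h2) _.
rewrite mulrA ler_pdivrMr// mulrC ler_wpM2l ?ltW// ltrDl//.
Qed.

Let t_ratio (K eta : R) : 0 <= K -> 0 < eta -> \forall n \near \oo,
  K * (`|t n| / (1 - theta n) ^+ 2) <= eta.
Proof.
move=> K0 eta0.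
have K1 : 0 < K + 1 by rewrite ltr_wpDl.
have e0 : 0 < eta / (K + 1) by rewrite divr_gt0.
have := eventually_and theta01 (t_small e0).
apply: filterS => n [/andP[_ h1] h2].
have ep : 0 < (1 - theta n) ^+ 2 by rewrite exprn_gt0// subr_gt0.
move: h2; rewrite -(ler_pdivrMr _ _ ep) => h2.
apply: le_trans (ler_wpM2l K0 h2) _.
by rewrite mulrA ler_pdivrMr// mulrC ler_wpM2l ?ltW// ltrDl.
Qed.

Let t_le_ratio : \forall n \near \oo,
  `|t n| <= `|t n| / (1 - theta n) ^+ 2 /\ t n ^+ 2 <= `|t n| / (1 - theta n) ^+ 2 /\
  t n ^+ 2 / (1 - theta n) ^+ 2 <= `|t n| / (1 - theta n) ^+ 2.
Proof.
have := eventually_and theta01 (t_small ltr01).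
apply: filterS => n [/andP[h0 h1]]; rewrite mul1r => h2.
have e0 : 0 < 1 - theta n by rewrite subr_gt0.
have ep : 0 < (1 - theta n) ^+ 2 by rewrite exprn_gt0.
have e1 : (1 - theta n) ^+ 2 <= 1 by rewrite expr_le1 ?(ltW e0)// gerBl.
have t1 : `|t n| <= 1 by exact: le_trans h2 e1.
have t2 : t n ^+ 2 <= `|t n| by rewrite -(real_normK (num_real (t n))) expr2 ler_piMl.
have a : `|t n| <= `|t n| / (1 - theta n) ^+ 2 by rewrite ler_pdivlMr// ler_piMr.
by split => //; split; [exact: le_trans a|rewrite ler_pM2r ?invr_gt0].
Qed.

(** The exponential moment is of order [exp (K N c^2 / (1 - theta)^2)], that is
    [exp (K N t^2)] for a coefficient [c] of order [t (1 - theta)]. *)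
Lemma negligible_cross_product (c : nat -> R) (K : R) j :
  0 <= K -> (\forall n \near \oo, `|c n| <= K * `|t n| * (1 - theta n)) ->
  negligible (fun n w => c n * \sum_(k < N n) Y n k w * zeta (k + j)%N w).
Proof.
move=> K0 hc; apply: exp_negligible_two_sided => // [n|s].
  apply: measurable_funM => //; apply: measurable_sum => k; apply: measurable_funM => //.
exists (fun n => (kap * (4 * C * (s * K) ^+ 2) / 2) * ((N n)%:R * t n ^+ 2)).
  by apply: small_budget; rewrite divr_ge0// mulr_ge0// mulr_ge0 ?sqr_ge0// mulr_ge0.
have K4 : 0 <= 4 * C * (s * K) ^+ 2 by rewrite mulr_ge0 ?sqr_ge0// mulr_ge0.
have := eventually_and theta01 (eventually_and hc (eventually_and t_le_ratio (t_ratio K4 alpha0))).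
apply: filterS => n [th [{}hc [[_ [h2 _]] h3]]].
have e0 : 0 < 1 - theta n by case/andP : th => _; rewrite subr_gt0.
have cle : 4 * C * (s * c n) ^+ 2 / (1 - theta n) ^+ 2 <= 4 * C * (s * K) ^+ 2 * t n ^+ 2.
  rewrite ler_pdivrMr ?exprn_gt0//.
  have : c n ^+ 2 <= (K * `|t n| * (1 - theta n)) ^+ 2.
    rewrite -(real_normK (num_real (c n))) lerXn2r ?nnegrE//.
    by rewrite !mulr_ge0 ?(ltW e0).
  rewrite !exprMn real_normK ?num_real// => h.
  have h' : 4 * C * s ^+ 2 * c n ^+ 2 <= 4 * C * s ^+ 2 * (K ^+ 2 * t n ^+ 2 * (1 - theta n) ^+ 2).
    by rewrite ler_wpM2l// mulr_ge0 ?sqr_ge0// mulr_ge0.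
  lra.
have ca : 4 * C * (s * c n) ^+ 2 / (1 - theta n) ^+ 2 <= alpha.
  by apply: le_trans cle _; apply: le_trans h3; rewrite ler_wpM2l.
have := exp_moment_cross_product indep zlaw th mu_sqr j (N n) mu_cgf mphi C0 phi_le ca.
under [X in exp_moment P X]eq_fun do rewrite -mulrA.
move=> /le_trans; apply; rewrite lee_fin ler_expR.
have n0 : 0 <= (N n)%:R * kap / 2 by rewrite divr_ge0// mulr_ge0.
have := ler_wpM2l n0 cle; lra.
Qed.

(** Independent centered terms: the exponent is quadratic in [c], hence of order [N t^2]. *)
Lemma negligible_centered_squares (c : nat -> R) (K : R) :
  0 <= K -> (\forall n \near \oo, `|c n| <= K * `|t n|) ->
  negligible (fun n w => c n * \sum_(k < N n) (zeta k w ^+ 2 - s2)).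
Proof.
move=> K0 hc; apply: exp_negligible_two_sided => // [n|s].
  apply: measurable_funM => //; apply: measurable_sum => k.
  by apply: measurable_funB => //; exact: measurable_funX.
exists (fun n => (K2 * (s * K) ^+ 2) * ((N n)%:R * t n ^+ 2)).
  by apply: small_budget; rewrite mulr_ge0// sqr_ge0.
have a20 : 0 < alpha / 2 by rewrite divr_gt0.
have sK : 0 <= `|s| * K by rewrite mulr_ge0.
have := eventually_and hc (eventually_and t_le_ratio (t_ratio sK a20)).
apply: filterS => n [{}hc [[h1 _] h3]].
have ca : `|s * c n| <= alpha / 2.
  apply: le_trans h3; rewrite normrM -mulrA ler_wpM2l//.
  by apply: le_trans hc _; rewrite ler_wpM2l.
have mh : measurable_fun setT (fun x : R => s * c n * (x ^+ 2 - s2)).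
  by apply: measurable_funM => //; apply: measurable_funB => //; exact: measurable_funX.
have := exp_moment_sum_iid indep zlaw (N n) mh (mu_centered_sqr ca).
under [X in exp_moment P X]eq_fun do rewrite -mulr_sumr -mulrA.
move=> /le_trans; apply; rewrite lee_fin ler_expR.
have : c n ^+ 2 <= (K * `|t n|) ^+ 2.
  by rewrite -(real_normK (num_real (c n))) lerXn2r ?nnegrE// mulr_ge0.
rewrite !exprMn real_normK ?num_real// => h.
have h' : (N n)%:R * K2 * s ^+ 2 * c n ^+ 2 <= (N n)%:R * K2 * s ^+ 2 * (K ^+ 2 * t n ^+ 2).
  by rewrite ler_wpM2l// mulr_ge0 ?sqr_ge0// mulr_ge0.
lra.
Qed.

Let sqr_law i c : 0 <= c <= alpha ->
  (exp_moment P (fun w => c * xi i w ^+ 2)%R <= (expR (kap * c))%:E)%E.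
Proof.
move=> c01; apply: le_trans (mu_sqr c01).
rewrite (exp_moment_law (zeta := fun=> xi i) (fun _ => law i) 0 (h := fun x => c * x ^+ 2))//.
by apply: measurable_funM => //; exact: measurable_funX.
Qed.

(** A single square has exponential moments up to order [(1 - theta)^2], with respect to
    which [t] is small. *)
Lemma negligible_last_square (c : nat -> R) (K : R) (m : nat -> nat) :
  0 <= K -> (\forall n \near \oo, `|c n| <= K * `|t n|) ->
  negligible (fun n w => c n * Y n (m n) w ^+ 2).
Proof.
move=> K0 hc; apply: (@exp_negligible_le _ _ _ _ _ _ (fun n w => `|c n| * Y n (m n) w ^+ 2)).
- by move=> n; apply: measurable_funM => //; exact: measurable_funX.
- by move=> n; apply: measurable_funM => //; exact: measurable_funX.
- by apply: nearW => n; apply: aeW => w; rewrite !normrM normr_id.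
apply: exp_negligible_ge0 => [n|n w|s s0].
- by apply: measurable_funM => //; exact: measurable_funX.
- by rewrite mulr_ge0 ?sqr_ge0.
exists (fun n => (kap * (s * K)) * (`|t n| / (1 - theta n) ^+ 2)).
  by apply: small_ratio; rewrite mulr_ge0// mulr_ge0// ltW.
have sK : 0 <= s * K by rewrite mulr_ge0// ltW.
have := eventually_and theta01 (eventually_and hc (t_ratio sK alpha0)).
apply: filterS => n [th [{}hc h3]].
have e0 : 0 < (1 - theta n) ^+ 2 by rewrite exprn_gt0//; case/andP : th => _; rewrite subr_gt0.
have cle : s * `|c n| / (1 - theta n) ^+ 2 <= s * K * (`|t n| / (1 - theta n) ^+ 2).
  rewrite [leRHS]mulrA ler_pM2r ?invr_gt0// -mulrA ler_wpM2l// ltW//.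
have c1 : 0 <= s * `|c n| / (1 - theta n) ^+ 2 <= alpha.
  by rewrite (le_trans cle)// andbT divr_ge0 ?(ltW e0)// mulr_ge0// ltW.
under [X in exp_moment P X]eq_fun do rewrite mulrA.
apply: (@le_trans _ _ (expR (kap * (s * `|c n| / (1 - theta n) ^+ 2)))%:E).
  apply: (exp_moment_ar_filter_sqr (a := fun i w => zeta i w)) => //.
  - by case/andP : c1 => c1 _; rewrite mulr_ge0.
  - by move=> i; exact: sqr_law.
  - by rewrite mulr_ge0// ltW.
by rewrite lee_fin ler_expR -[leRHS]mulrA ler_wpM2l.
Qed.

(** By convexity the sum is dominated by independent terms, and its exponent is of order
    [N |t|^3 / (1 - theta)^3], the product of [N t^2 / (1 - theta)] and of
    [|t| / (1 - theta)^2]. *)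
Lemma negligible_cgf_remainder :
  negligible (fun n w => \sum_(k < N n)
    (phi (t n * Y n k w) - s2 * (t n * Y n k w) ^+ 2 / 2)).
Proof.
have mcc n k : measurable_fun setT (fun w => capped_cube (t n * Y n k w)).
  by apply: (measurableT_comp measurable_capped_cube); exact: measurable_funM.
have mp n k : measurable_fun setT (fun w => phi (t n * Y n k w)).
  by apply: (measurableT_comp mphi); exact: measurable_funM.
apply: (@exp_negligible_le _ _ _ _ _ _
  (fun n w => Kphi * \sum_(k < N n) capped_cube (t n * Y n k w))).
- move=> n; apply: measurable_sum => k; apply: measurable_funB => //.
  apply: measurable_funM => //; apply: measurable_funM => //.
  by apply: measurable_funX; exact: measurable_funM.
- by move=> n; apply: measurable_funM => //; exact: measurable_sum.
- apply: nearW => n; apply: aeW => w; apply: le_trans (ler_norm_sum _ _ _) _.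
  rewrite ger0_norm; last by rewrite mulr_ge0// sumr_ge0// => k _; exact: capped_cube_ge0.
  by rewrite mulr_sumr; apply: ler_sum => k _; exact: phi_taylor.
apply: exp_negligible_ge0 => [n|n w|s s0].
- by apply: measurable_funM => //; exact: measurable_sum.
- by rewrite mulr_ge0// sumr_ge0// => k _; exact: capped_cube_ge0.
have sK : 0 <= s * Kphi by rewrite mulr_ge0// ltW.
exists (fun n => K3 * (s * Kphi) * L * B n * (`|t n| / (1 - theta n) ^+ 2)).
  move=> eta eta0.
  have K0 : 0 <= K3 * (s * Kphi) * L by rewrite !mulr_ge0// ltW.
  apply: filterS2 B0 (t_ratio K0 eta0) => n Bn0 h.
  rewrite mulrAC ler_wpM2r// ltW//.
have a20 : 0 < alpha / 2 by rewrite divr_gt0.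
have := eventually_and theta01 (eventually_and t_budget
  (eventually_and t_le_ratio (t_ratio sK a20))).
apply: filterS => n [th [hb [[_ [_ h1]] h3]]].
have e0 : 0 < 1 - theta n by case/andP : th => _; rewrite subr_gt0.
have ca : s * Kphi * (t n / (1 - theta n)) ^+ 2 <= alpha / 2.
  by apply: le_trans h3; rewrite ler_wpM2l// expr_div_n.
under [X in exp_moment P X]eq_fun do rewrite mulrA.
have := exp_moment_sum_capped_cube indep zlaw th (N n) sK (mu_capped_cube sK ca).
move=> /le_trans; apply; rewrite lee_fin ler_expR.
rewrite normrM normfV (gtr0_norm e0) exprMn.
have -> : (N n)%:R * (K3 * (s * Kphi * (`|t n| ^+ 3 * (1 - theta n)^-1 ^+ 3))) =
   K3 * (s * Kphi) * (`|t n| / (1 - theta n) ^+ 3) * ((N n)%:R * t n ^+ 2).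
  rewrite -(real_normK (num_real (t n))); field; exact: lt0r_neq0.
apply: (@le_trans _ _ (K3 * (s * Kphi) * (`|t n| / (1 - theta n) ^+ 3) * (L * B n * (1 - theta n)))).
  apply: ler_wpM2l hb; apply: mulr_ge0; first exact: mulr_ge0.
  by apply: divr_ge0 => //; apply: exprn_ge0; exact: ltW.
rewrite le_eqVlt; apply/orP; left; apply/eqP; field; exact: lt0r_neq0.
Qed.

Let X n := ar_process (theta n) (fun k => xi k).

(** The geometric weights add up to [1 / (1 - theta)], which the factor
    [1 - theta] in the coefficient compensates; what is left is the exponential moment of single
    squares. *)
Lemma negligible_initial_condition (c : nat -> R) (K m1 : R) l :
  (forall i, (\int[P]_w (`|xi i w|)%:E <= m1%:E)%E) ->
  0 <= K -> (\forall n \near \oo, `|c n| <= K * `|t n| * (1 - theta n)) ->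
  negligible (fun n w => c n * \sum_(k < N n) theta n ^+ k *
    (2 * X n 0 w ^+ 2 + Y n k w ^+ 2 / 2 + Y n (k + l)%N w ^+ 2 / 2)).
Proof.
move=> hm1 K0 hc.
have mX n : measurable_fun setT (X n 0) by exact: measurable_ar_process.
have mF n k : measurable_fun setT (fun w =>
    2 * X n 0 w ^+ 2 + Y n k w ^+ 2 / 2 + Y n (k + l)%N w ^+ 2 / 2).
  apply: measurable_funD; [apply: measurable_funD|];
    by apply: measurable_funM => //; exact: measurable_funX.
move=> s eta s0 eta0.
pose b n := kap * (4 * s * K) * (`|t n| / (1 - theta n) ^+ 2).
have sK : 0 <= 4 * s * K by rewrite mulr_ge0// mulr_ge0// ltW.
have sb : small_wrt B b by apply: small_ratio; rewrite mulr_ge0.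
have := eventually_and (sb _ eta0) (eventually_and theta01
  (eventually_and hc (t_ratio sK alpha0))).
apply: filterS => n [hb [th [{}hc h3]]].
have /andP[th0 th1] := th.
have e0 : 0 < 1 - theta n by rewrite subr_gt0.
set F := fun (k : nat) w => 2 * X n 0 w ^+ 2 + Y n k w ^+ 2 / 2 + Y n (k + l)%N w ^+ 2 / 2.
have F0 k w : 0 <= F k w.
  rewrite /F; have := sqr_ge0 (X n 0 w); have := sqr_ge0 (Y n k w).
  by have := sqr_ge0 (Y n (k + l)%N w); lra.
apply: (@le_trans _ _ (exp_moment P (fun w => s * `|c n| * \sum_(k < N n) theta n ^+ k * F k w)%R)).
  rewrite le_eqVlt; apply/orP; left; apply/eqP; congr exp_moment; apply/funext => w.
  rewrite normrM mulrA; congr (_ * _); rewrite ger0_norm// sumr_ge0// => k _.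
  by apply: mulr_ge0; [exact: exprn_ge0|exact: F0].
apply: (@le_trans _ _ (expR (b n))%:E); last by rewrite lee_fin ler_expR.
have b0 : 0 <= b n.
  by apply: mulr_ge0; [exact: mulr_ge0|apply: divr_ge0 => //; exact: sqr_ge0].
have sc0 : 0 <= s * `|c n| / (1 - theta n).
  by apply: divr_ge0; [apply: mulr_ge0 => //; exact: ltW|exact: ltW].
have cle : 4 * (s * `|c n| / (1 - theta n)) / (1 - theta n) ^+ 2 <=
    4 * s * K * (`|t n| / (1 - theta n) ^+ 2).
  rewrite [leRHS]mulrA ler_pM2r ?invr_gt0 ?exprn_gt0//.
  rewrite -[4 * s * K * _]mulrA -[4 * s * _]mulrA ler_pM2l// mulrA ler_pdivrMr//.
  by rewrite -!mulrA ler_pM2l// mulrA.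
have base i : (exp_moment P (fun w => 4 * (s * `|c n| / (1 - theta n)) / (1 - theta n) ^+ 2 * xi i w ^+ 2)%R
    <= (expR (b n))%:E)%E.
  have c1 : 0 <= 4 * (s * `|c n| / (1 - theta n)) / (1 - theta n) ^+ 2 <= alpha.
    by rewrite (le_trans cle)// andbT divr_ge0 ?sqr_ge0// mulr_ge0.
  apply: le_trans (sqr_law i c1) _; rewrite lee_fin ler_expR /b -[leRHS]mulrA.
  by rewrite ler_wpM2l.
apply: exp_moment_geometric_sum => // k; first exact: mF.
set c' := s * `|c n| / (1 - theta n).
have hX : (exp_moment P (fun w => 4 * c' * X n 0 w ^+ 2)%R <= (expR (b n))%:E)%E.
  by apply: (exp_moment_stationary th hm1) => //; rewrite mulr_ge0.
have hY j : (exp_moment P (fun w => 4 * c' * Y n j w ^+ 2)%R <= (expR (b n))%:E)%E.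
  apply: (exp_moment_ar_filter_sqr (a := fun i w => zeta i w)) => //.
  - by move=> i; exact: base.
  - by rewrite mulr_ge0.
have h01 : 0 <= (2^-1 : R) <= 1 by apply/andP; split; lra.
have mcX : measurable_fun setT (fun w => 4 * c' * X n 0 w ^+ 2).
  by apply: measurable_funM => //; exact: measurable_funX.
have mcY j : measurable_fun setT (fun w => 4 * c' * Y n j w ^+ 2).
  by apply: measurable_funM => //; exact: measurable_funX.
have hYY := exp_moment_hoelder (mcY k) (mcY (k + l)%N) h01 (hY k) (hY (k + l)%N).
have mYY : measurable_fun setT (fun w => 2^-1 * (4 * c' * Y n k w ^+ 2) +
    (1 - 2^-1) * (4 * c' * Y n (k + l)%N w ^+ 2)).
  by apply: measurable_funD; exact: measurable_funM.
have := exp_moment_hoelder mcX mYY h01 hX hYY.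
have -> : 2^-1 * b n + (1 - 2^-1) * (2^-1 * b n + (1 - 2^-1) * b n) = b n by field.
apply: le_trans; apply: exp_moment_le.
- by apply: measurable_funM => //; exact: mF.
- by apply: measurable_funD; apply: measurable_funM.
apply: aeW => w; rewrite /F.
have p : 0 <= c' * (Y n k w ^+ 2 + Y n (k + l)%N w ^+ 2) by rewrite mulr_ge0// addr_ge0 ?sqr_ge0.
lra.
Qed.

End negligible_terms.

(** * The algebra of the tilting *)

Section algebra.
Context {R : realType}.
Implicit Types (theta tau t c : R) (a : nat -> R) (phi : R -> R).

(** The coefficient of [rho sum Y_k^2] in the exponent, where [rho] is
    [1 - theta^2]: [tau theta^l] from the lagged sum and [t^2 s2 / 2] from the
    quadratic part of [phi], both divided by [rho]. *)
Definition square_coef theta tau t (s2 : R) l : R :=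
  tau * theta ^+ l / (1 - theta ^+ 2) + t ^+ 2 * s2 / (2 * (1 - theta ^+ 2)).

(** Two substitutions: [y (k + l)] is expanded as [theta^l y k] plus the inputs received
    in between, and the energy identity then eliminates [sum y_k^2].  The first term
    on the right shows which [t] to choose: its coefficient has to be small. *)
Lemma tilting_decomposition theta tau t (s2 : R) c l N a phi : 1 - theta ^+ 2 != 0 ->
  let y := ar_filter theta a in
  let cz := square_coef theta tau t s2 l in
  tau * (\sum_(k < N) y (k + l)%N * y k - N%:R * (theta ^+ l * s2 / (1 - theta ^+ 2))) - c
    - \sum_(k < N) (t * y k * a k - phi (t * y k)) =
  (2 * theta * cz - t) * \sum_(k < N) y k * a (k + 0)%N
  + cz * \sum_(k < N) (a k ^+ 2 - s2)
  + - cz * y N ^+ 2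
  + \sum_(i < l) (tau * theta ^+ (l.-1 - i)) * \sum_(k < N) y k * a (k + i)%N
  + \sum_(k < N) (phi (t * y k) - s2 * (t * y k) ^+ 2 / 2)
  + (t ^+ 2 * s2 ^+ 2 * N%:R / (2 * (1 - theta ^+ 2)) - c).
Proof.
move=> rho0 y cz.
have energy := ar_filter_energy theta a N; rewrite -/y in energy.
have Q : \sum_(k < N) y (k + l)%N * y k = theta ^+ l * \sum_(k < N) y k ^+ 2 +
    \sum_(i < l) theta ^+ (l.-1 - i) * \sum_(k < N) y k * a (k + i)%N.
  rewrite mulr_sumr.
  have -> : \sum_(i < l) theta ^+ (l.-1 - i) * \sum_(k < N) y k * a (k + i)%N =
     \sum_(k < N) \sum_(i < l) theta ^+ (l.-1 - i) * (y k * a (k + i)%N).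
    by rewrite exchange_big/=; apply: eq_bigr => i _; rewrite mulr_sumr.
  rewrite -big_split/=; apply: eq_bigr => k _.
  rewrite /y ar_filter_shift mulrDl -mulrA -expr2; congr (_ + _).
  by rewrite mulr_suml; apply: eq_bigr => i _; rewrite mulrAC mulrA.
have S0 : \sum_(k < N) y k * a (k + 0)%N = \sum_(k < N) y k * a k.
  by apply: eq_bigr => k _; rewrite addn0.
have S1 : \sum_(k < N) (a k ^+ 2 - s2) = \sum_(k < N) a k ^+ 2 - N%:R * s2.
  by rewrite sumrB sumr_const card_ord mulr_natl.
have S2 : \sum_(k < N) (t * y k * a k - phi (t * y k)) =
    t * \sum_(k < N) y k * a k - \sum_(k < N) phi (t * y k).
  by rewrite sumrB mulr_sumr; congr (_ - _); apply: eq_bigr => k _; rewrite mulrA.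
have S3 : \sum_(k < N) (phi (t * y k) - s2 * (t * y k) ^+ 2 / 2) =
    \sum_(k < N) phi (t * y k) - s2 * t ^+ 2 / 2 * \sum_(k < N) y k ^+ 2.
  by rewrite sumrB mulr_sumr; congr (_ - _); apply: eq_bigr => k _; ring.
have S4 : \sum_(i < l) (tau * theta ^+ (l.-1 - i)) * \sum_(k < N) y k * a (k + i)%N =
    tau * \sum_(i < l) theta ^+ (l.-1 - i) * \sum_(k < N) y k * a (k + i)%N.
  by rewrite mulr_sumr; apply: eq_bigr => i _; rewrite mulrA.
rewrite Q S0 S1 S2 S3 S4 /cz /square_coef.
have -> : \sum_(k < N) y k ^+ 2 = (2 * theta * \sum_(k < N) y k * a k +
    \sum_(k < N) a k ^+ 2 - y N ^+ 2) / (1 - theta ^+ 2).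
  by rewrite -energy mulrC mulKf.
by field.
Qed.

(** The stationary process differs from the one started at 0 by [theta^k x]; every
    term of the difference carries a factor [theta^k]. *)
Lemma sum_cross_le theta (y : nat -> R) (x : R) l N : 0 <= theta <= 1 -> y 0%N = 0 ->
  `|\sum_(1 <= k < N.+1) (y (k + l)%N + theta ^+ (k + l) * x) * (y k + theta ^+ k * x)
    - \sum_(k < N.+1) y (k + l)%N * y k| <=
  \sum_(k < N.+1) theta ^+ k * (2 * x ^+ 2 + y k ^+ 2 / 2 + y (k + l)%N ^+ 2 / 2).
Proof.
move=> /andP[t0 t1] y0.
rewrite -(big_mkord xpredT (fun k => y (k + l)%N * y k)) big_nat_recl//= y0 mulr0 add0r.
rewrite -[X in _ <= X](big_mkord xpredT (fun k => theta ^+ k * (2 * x ^+ 2 + y k ^+ 2 / 2 + y (k + l)%N ^+ 2 / 2))).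
rewrite [X in _ <= X]big_nat_recl//= big_add1/= -sumrB.
apply: le_trans (ler_norm_sum _ _ _) _.
rewrite -[X in X <= _]add0r; apply: lerD.
  rewrite expr0 mul1r; have := sqr_ge0 x; have := sqr_ge0 (y 0%N).
  by have := sqr_ge0 (y (0 + l)%N); lra.
apply: ler_sum => k _.
set u := y (k.+1 + l)%N; set v := y k.+1; set p := theta ^+ k.+1.
have p0 : 0 <= p by exact: exprn_ge0.
have p1 : p <= 1 by exact: exprn_ile1.
have q0 : 0 <= theta ^+ l by exact: exprn_ge0.
have q1 : theta ^+ l <= 1 by exact: exprn_ile1.
rewrite exprD -/p.
set q := theta ^+ l in q0 q1 *.
have -> : (u + p * q * x) * (v + p * x) - u * v = p * (u * x + q * (x * v) + p * q * x ^+ 2) by ring.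
rewrite normrM (ger0_norm p0) ler_wpM2l//.
have h1 : `|u * x| <= (u ^+ 2 + x ^+ 2) / 2.
  have := sqr_ge0 (u - x); have := sqr_ge0 (u + x); rewrite sqrrB sqrrD ler_norml; lra.
have h2 : `|x * v| <= (v ^+ 2 + x ^+ 2) / 2.
  have := sqr_ge0 (v - x); have := sqr_ge0 (v + x); rewrite sqrrB sqrrD ler_norml; lra.
have h3 : `|q * (x * v)| <= (v ^+ 2 + x ^+ 2) / 2.
  by rewrite normrM (ger0_norm q0); apply: le_trans h2; rewrite ler_piMl.
have h4 : `|p * q * x ^+ 2| <= x ^+ 2.
  rewrite normrM [X in _ * X]ger0_norm ?sqr_ge0// ger0_norm ?mulr_ge0//.
  by rewrite ler_piMl ?sqr_ge0// mulr_ile1.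
apply: le_trans (ler_normD _ _) _.
have := ler_normD (u * x) (q * (x * v)); lra.
Qed.

End algebra.

(** The coefficients of the decomposition for the chosen [tau].  The critical
    one is that of [sum y_k a_k]: the leading parts of [2 theta square_coef]
    and [t] cancel, which leaves an additional factor [1 - theta]. *)
Section coefficients.
Context {R : realType}.
Variables (theta tau t s2 : R) (n l : nat).
Hypotheses (th0 : 0 <= theta) (th1 : theta < 1) (s20 : 0 <= s2).
Hypotheses (n0 : (0 < n)%N) (nl : (2 * l <= n)%N) (neps : 1 <= n%:R * (1 - theta)).
Hypothesis tauE : tau = t * (1 - theta ^+ 2) * n%:R / (2 * (n - l)%:R).
Hypothesis t_eps : `|t| <= (1 - theta) ^+ 2.

Let e0 : 0 < 1 - theta. Proof. by rewrite subr_gt0. Qed.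
Let rhoE : 1 - theta ^+ 2 = (1 - theta) * (1 + theta). Proof. by ring. Qed.
Let rho_ge : 1 - theta <= 1 - theta ^+ 2.
Proof. by rewrite rhoE ler_peMr ?(ltW e0)// lerDl. Qed.
Let rho_gt0 : 0 < 1 - theta ^+ 2. Proof. exact: lt_le_trans rho_ge. Qed.
Let rho_le : 1 - theta ^+ 2 <= 2 * (1 - theta).
Proof. have := mulr_ge0 (ltW e0) (ltW e0); lra. Qed.

Let nR : 0 < n%:R :> R. Proof. by rewrite ltr0n. Qed.
Let NR : (n - l)%:R = n%:R - l%:R :> R. Proof. by rewrite natrB//; lia. Qed.
Let N0 : 0 < (n - l)%:R :> R. Proof. by rewrite ltr0n; lia. Qed.
Let N2 : n%:R <= 2 * (n - l)%:R :> R.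
Proof. by rewrite -natrM ler_nat; lia. Qed.
Let ratio0 : 0 <= n%:R / (2 * (n - l)%:R) :> R.
Proof. by rewrite divr_ge0// mulr_ge0. Qed.
Let ratio1 : n%:R / (2 * (n - l)%:R) <= 1 :> R.
Proof. by rewrite ler_pdivrMr ?mul1r// mulr_gt0. Qed.

Lemma tau_bound : `|tau| <= 2 * `|t| * (1 - theta).
Proof.
have -> : tau = t * ((1 - theta ^+ 2) * (n%:R / (2 * (n - l)%:R))) by rewrite tauE; ring.
rewrite (_ : 2 * `|t| * (1 - theta) = `|t| * (2 * (1 - theta))); last by ring.
rewrite normrM ler_wpM2l// ger0_norm; last by rewrite mulr_ge0// ltW.
by apply: le_trans rho_le; rewrite ler_piMr// ltW.
Qed.

Let t2_rho : t ^+ 2 / (1 - theta ^+ 2) <= `|t| * (1 - theta).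
Proof.
rewrite ler_pdivrMr// -(real_normK (num_real t)) expr2 -mulrA ler_wpM2l//.
apply: le_trans t_eps _; rewrite expr2 ler_wpM2l// ltW//.
Qed.

Let tauth : tau * theta ^+ l / (1 - theta ^+ 2) = t * (theta ^+ l * (n%:R / (2 * (n - l)%:R))).
Proof. by rewrite tauE; field; rewrite lt0r_neq0// lt0r_neq0. Qed.

Let pl0 : 0 <= theta ^+ l. Proof. exact: exprn_ge0. Qed.
Let pl1 : theta ^+ l <= 1. Proof. by apply: exprn_ile1 => //; exact: ltW. Qed.

Lemma square_coef_bound : `|square_coef theta tau t s2 l| <= (1 + s2) * `|t|.
Proof.
rewrite /square_coef tauth; apply: le_trans (ler_normD _ _) _.
rewrite [leRHS]mulrDl mul1r; apply: lerD.
  rewrite normrM ler_piMr// ger0_norm ?mulr_ge0// mulr_ile1//.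
have -> : t ^+ 2 * s2 / (2 * (1 - theta ^+ 2)) = s2 * (t ^+ 2 / (1 - theta ^+ 2) / 2).
  by field; rewrite lt0r_neq0.
have t20 : 0 <= t ^+ 2 / (1 - theta ^+ 2) by rewrite divr_ge0 ?sqr_ge0// ltW.
rewrite normrM (ger0_norm s20) ler_wpM2l// ger0_norm; last exact: divr_ge0.
have := normr_ge0 t.
have : `|t| * (1 - theta) <= `|t| by rewrite ler_piMr// gerBl.
by move: t2_rho; lra.
Qed.

Lemma martingale_coef_bound : `|2 * theta * square_coef theta tau t s2 l - t| <=
  (3 * l%:R + 1 + s2) * `|t| * (1 - theta).
Proof.
have -> : 2 * theta * square_coef theta tau t s2 l - t =
    t * (theta ^+ l.+1 * (l%:R / (n - l)%:R) - (1 - theta ^+ l.+1)) +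
    s2 * theta * (t ^+ 2 / (1 - theta ^+ 2)).
  have -> : l%:R = n%:R - (n - l)%:R :> R by rewrite NR; ring.
  rewrite /square_coef tauth [theta ^+ l.+1]exprS; field; rewrite lt0r_neq0//= lt0r_neq0//.
have pS0 : 0 <= theta ^+ l.+1 by exact: exprn_ge0.
have pS1 : theta ^+ l.+1 <= 1 by apply: exprn_ile1 => //; exact: ltW.
have bern : 1 - theta ^+ l.+1 <= (l%:R + 1) * (1 - theta).
  have := subrX1 theta l.+1; rewrite -opprB -[X in _ = X * _]opprB mulNr => /oppr_inj ->.
  rewrite mulrC ler_wpM2r ?(ltW e0)//.
  apply: (@le_trans _ _ (\sum_(i < l.+1) (1 : R))).
    by apply: ler_sum => i _; apply: exprn_ile1 => //; exact: ltW.
  by rewrite sumr_const card_ord -natr1.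
have lN : l%:R / (n - l)%:R <= 2 * l%:R * (1 - theta) :> R.
  rewrite ler_pdivrMr//.
  have : l%:R * (n%:R * (1 - theta)) <= l%:R * (2 * (n - l)%:R * (1 - theta)).
    by rewrite ler_wpM2l// ler_wpM2r// ltW.
  have : l%:R * 1 <= l%:R * (n%:R * (1 - theta)) by rewrite ler_wpM2l.
  lra.
have lN0 : 0 <= l%:R / (n - l)%:R :> R by rewrite divr_ge0.
have t20 : 0 <= t ^+ 2 / (1 - theta ^+ 2) by rewrite divr_ge0 ?sqr_ge0// ltW.
apply: le_trans (ler_normD _ _) _.
have h1 : `|t * (theta ^+ l.+1 * (l%:R / (n - l)%:R) - (1 - theta ^+ l.+1))| <=
    `|t| * ((3 * l%:R + 1) * (1 - theta)).
  rewrite normrM ler_wpM2l//.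
  have : theta ^+ l.+1 * (l%:R / (n - l)%:R) <= l%:R / (n - l)%:R by rewrite ler_piMl.
  have : 0 <= theta ^+ l.+1 * (l%:R / (n - l)%:R) by rewrite mulr_ge0.
  rewrite ler_norml => a1 a2; apply/andP; split; lra.
have h2 : `|s2 * theta * (t ^+ 2 / (1 - theta ^+ 2))| <= s2 * (`|t| * (1 - theta)).
  rewrite ger0_norm; last by rewrite mulr_ge0// mulr_ge0.
  rewrite -mulrA ler_wpM2l//; apply: le_trans t2_rho.
  by rewrite ler_piMl// ltW.
lra.
Qed.

End coefficients.

(** * The Laplace transform of the empirical covariance *)

Section ar_covariance.
Context d (T : measurableType d) (R : realType) (P : probability T R).
Variables (mu : probability R R) (xi : int -> {RV P >-> R}).
Local Notation zeta := (innovation xi).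
Hypothesis indep : mutually_independent zeta.
Hypothesis law : forall i (B : set R), measurable B ->
  distribution P (xi i) B = mu B.
Variables (alpha kap C K2 K3 Kphi s2 m1 : R) (phi : R -> R).
Hypothesis nb : noise_bounds mu alpha kap C K2 K3 Kphi s2 phi.
Hypothesis abs_moment : forall i, (\int[P]_w (`|xi i w|)%:E <= m1%:E)%E.
Hypothesis s2_gt0 : 0 < s2.
Variables (theta b : nat -> R) (l : nat).
Hypothesis theta_range : forall n : nat, (1 <= n)%N -> 0 <= theta n < 1.
Hypothesis theta_lim : theta n @[n --> \oo] --> (1 : R).
Hypothesis b_gt0 : forall n : nat, (1 <= n)%N -> 0 < b n.
Hypothesis b_lim : b n @[n --> \oo] --> +oo.
Hypothesis rate_lim :
  (Num.sqrt n%:R * (1 - theta n) ^+ 2 / b n) @[n --> \oo] --> +oo.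

Local Notation X n := (ar_process (theta n) (fun k => xi k)).
Local Notation Y n := (ar_from0 zeta (theta n)).
Local Notation B := (fun n => b n ^+ 2).
Local Notation Cov n := (empirical_covariance (X n) n l).
Local Notation rho n := (1 - theta n ^+ 2).

Definition cov_scale n : R := rho n `^ (3 / 2) * Num.sqrt n%:R / b n.

(** The covariance [theta^l s2 / rho] of the stationary process at lag [l], with the
    factor [(N + 1) / N], for [N = n - l], that matches the [N + 1] summands
    [k = 0, .., N] of the martingale. *)
Definition cov_center n : R :=
  (n - l)%N.+1%:R / (n - l)%:R * (theta n ^+ l * s2 / rho n).

Definition scaled_cov n w := cov_scale n * (Cov n w - cov_center n).

Let n_ge m : \forall n \near \oo, (m <= n)%N.
Proof. by exists m. Qed.

Let theta01 : \forall n \near \oo, 0 <= theta n < 1.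
Proof. by apply: filterS (n_ge 1) => n; exact: theta_range. Qed.

Let b0 : \forall n \near \oo, 0 < b n.
Proof. by apply: filterS (n_ge 1) => n; exact: b_gt0. Qed.

Let b_big (A : R) : \forall n \near \oo, A < b n.
Proof. by move/cvgryPgt : b_lim; exact. Qed.

Lemma speed_cvgy : B n @[n --> \oo] --> +oo.
Proof.
apply/cvgryPgt => A; have := eventually_and (b_big 1) (b_big A).
apply: filterS => n [b1 bA]; apply: lt_le_trans bA _.
by rewrite expr2 ler_peMr// ltW// (lt_trans ltr01).
Qed.

Let eps_small (eta : R) : 0 < eta -> \forall n \near \oo, 1 - theta n <= eta.
Proof.
move=> eta0; move/cvgrPdist_le : theta_lim => /(_ _ eta0).
by apply: filterS => n; apply: le_trans; exact: ler_norm.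
Qed.

Let rate (A : R) : \forall n \near \oo,
  A * b n <= Num.sqrt n%:R * (1 - theta n) ^+ 2.
Proof.
move/cvgryPge : rate_lim => /(_ A) h; apply: filterS2 h b0 => n h bn.
by move: h; rewrite ler_pdivlMr.
Qed.

Section fixed_parameter.
Variable lam : R.

(** This value makes the coefficient of [sum Y_k z_k] in the decomposition small;
    the deterministic term is then [v lam^2 B / 2] to leading order. *)
Definition tilt_size n : R := 2 * lam * b n * Num.sqrt (rho n) / Num.sqrt n%:R.

Local Notation t := tilt_size.

(* the coefficient of the lagged sum in [lam * B * scaled_cov] *)
Let tau n : R := t n * rho n * n%:R / (2 * (n - l)%:R).

Let rho01 n : 0 <= theta n < 1 -> 0 < rho n <= 1.
Proof.
move=> /andP[h0 h1]; apply/andP; split; last by rewrite gerBl sqr_ge0.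
by rewrite subr_gt0 expr_lt1.
Qed.

Let t_small (eta : R) : 0 < eta ->
  \forall n \near \oo, `|t n| <= eta * (1 - theta n) ^+ 2.
Proof.
move=> eta0; have := eventually_and (rate (2 * `|lam| / eta))
  (eventually_and theta01 (eventually_and b0 (n_ge 1))).
apply: filterS => n [h [th [bn n1]]].
have sn : 0 < Num.sqrt n%:R :> R by rewrite sqrtr_gt0 ltr0n.
rewrite /t normrM normfV (gtr0_norm sn) ler_pdivrMr//.
apply: (@le_trans _ _ (2 * `|lam| * b n)).
  rewrite !normrM (gtr0_norm bn) (ger0_norm (ler0n _ 2)) ler_piMr//.
    by rewrite mulr_ge0 ?(ltW bn)// mulr_ge0.
  rewrite ger0_norm ?sqrtr_ge0//.
  by rewrite -[leRHS](@sqrtr1 R) ler_sqrt//; case/andP : (rho01 th).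
move: h; rewrite -(ler_pM2l eta0) mulrA [eta * (_ / _)]mulrC divfK ?lt0r_neq0//.
by move=> /le_trans; apply; rewrite mulrCA mulrC mulrAC mulrC mulrA.
Qed.

Let t_sqr n : (0 < n)%N -> 0 <= theta n < 1 ->
  t n ^+ 2 = 4 * lam ^+ 2 * b n ^+ 2 * rho n / n%:R.
Proof.
move=> n0 th; case/andP : (rho01 th) => rho0 _.
rewrite /t !exprMn exprVn !sqr_sqrtr ?(ltW rho0)//.
by rewrite -natrX.
Qed.

Let t_budget : \forall n \near \oo,
  (n - l)%N.+1%:R * t n ^+ 2 <= (16 * lam ^+ 2) * b n ^+ 2 * (1 - theta n).
Proof.
have := eventually_and theta01 (n_ge 1).
apply: filterS => n [th n1]; rewrite t_sqr//.
have /andP[th0 th1] := th.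
have nR : 0 < n%:R :> R by rewrite ltr0n.
have N2 : (n - l)%N.+1%:R <= 2 * n%:R :> R.
  by rewrite -natrM ler_nat; lia.
have K0 : 0 <= 4 * lam ^+ 2 * b n ^+ 2 by rewrite mulr_ge0 ?sqr_ge0// mulr_ge0 ?sqr_ge0.
have rho2 : rho n <= 2 * (1 - theta n).
  have : 0 <= (1 - theta n) ^+ 2 by exact: sqr_ge0.
  lra.
have r0 : 0 <= rho n by case/andP : (rho01 th) => /ltW.
rewrite mulrA ler_pdivrMr//.
have h1 := ler_wpM2r (mulr_ge0 K0 r0) N2.
have h2 := ler_wpM2l (mulr_ge0 K0 (ltW nR)) rho2.
lra.
Qed.

Let neps : \forall n \near \oo, 1 <= n%:R * (1 - theta n).
Proof.
have := eventually_and (rate 1) (eventually_and theta01 (eventually_and (b_big 1) (n_ge 1))).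
apply: filterS => n [h [/andP[th0 th1] [b1 n1]]].
have nR : 1 <= n%:R :> R by rewrite ler1n.
have e0 : 0 <= 1 - theta n by rewrite subr_ge0 ltW.
have e1 : 1 - theta n <= 1 by rewrite gerBl.
have h1 : 1 <= Num.sqrt n%:R * (1 - theta n) ^+ 2 by apply: le_trans h; rewrite mul1r ltW.
apply: le_trans h1 _; apply: ler_pM => //; rewrite ?sqrtr_ge0 ?sqr_ge0//.
  rewrite -[leRHS]sqr_sqrtr// expr2 ler_peMr ?sqrtr_ge0//.
  by rewrite -[leLHS](@sqrtr1 R) ler_sqrt.
by rewrite expr2 ler_piMl.
Qed.

Let regular : \forall n \near \oo, [/\ 0 <= theta n < 1, (0 < n)%N, (2 * l <= n)%N,
  1 <= n%:R * (1 - theta n) & `|t n| <= (1 - theta n) ^+ 2].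
Proof.
have := eventually_and (eventually_and theta01 (n_ge (2 * l)))
  (eventually_and (n_ge 1) (eventually_and neps (t_small ltr01))).
by apply: filterS => n [[h1 h2] [h3 [h4 h5]]]; split => //; move: h5; rewrite mul1r.
Qed.

Let s20 : 0 <= s2. Proof. exact: ltW. Qed.

Definition tilt_exponent n w := \sum_(k < (n - l).+1)
  (t n * Y n k w * zeta k w - phi (t n * Y n k w)).

Let v : R := 4 * s2 ^+ 2.

Let c n : R := v * lam ^+ 2 / 2 * b n ^+ 2.

Let cz n : R := square_coef (theta n) (tau n) (t n) s2 l.

Definition tilt_remainder n w :=
  (2 * theta n * cz n - t n) * \sum_(k < (n - l).+1) Y n k w * zeta (k + 0)%N w
  + cz n * \sum_(k < (n - l).+1) (zeta k w ^+ 2 - s2)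
  + - cz n * Y n (n - l).+1 w ^+ 2
  + \sum_(i < l) (tau n * theta n ^+ (l.-1 - i)) *
      \sum_(k < (n - l).+1) Y n k w * zeta (k + i)%N w
  + \sum_(k < (n - l).+1) (phi (t n * Y n k w) - s2 * (t n * Y n k w) ^+ 2 / 2)
  + (t n ^+ 2 * s2 ^+ 2 * (n - l).+1%:R / (2 * rho n) - c n).

Let mY n k : measurable_fun setT (Y n k). Proof. exact: measurable_ar_from0. Qed.

Let mz k : measurable_fun setT (zeta k). Proof. exact: measurable_funP. Qed.

Let mX n k : measurable_fun setT (X n k). Proof. exact: measurable_ar_process. Qed.

Let mphiY n k : measurable_fun setT (fun w => phi (t n * Y n k w)).
Proof. by apply: (measurableT_comp (nb_mphi nb)); exact: measurable_funM. Qed.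

Let mU n j : measurable_fun setT (fun w => \sum_(k < (n - l).+1) Y n k w * zeta (k + j)%N w).
Proof. by apply: measurable_sum => k; exact: measurable_funM. Qed.

Lemma measurable_tilt_exponent n : measurable_fun setT (tilt_exponent n).
Proof.
apply: measurable_sum => k; apply: measurable_funB => //.
by apply: measurable_funM => //; exact: measurable_funM.
Qed.

Lemma exp_moment_tilt_exponent n : exp_moment P (tilt_exponent n) = 1%E.
Proof.
apply: (exp_martingale indep _ (nb_cgf nb) (nb_mphi nb) (V := fun k w => t n * Y n k w)).
  by move=> i D mD; exact: law.
move=> k; apply: measurable_funM => //; exact: measurable_ar_from0_past.
Qed.

Let meas1 n : measurable_fun setT (fun w => (2 * theta n * cz n - t n) *
  \sum_(k < (n - l).+1) Y n k w * zeta (k + 0)%N w).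
Proof. exact: measurable_funM. Qed.
Let meas2 n : measurable_fun setT (fun w => cz n * \sum_(k < (n - l).+1) (zeta k w ^+ 2 - s2)).
Proof.
apply: measurable_funM => //; apply: measurable_sum => k.
by apply: measurable_funB => //; exact: measurable_funX.
Qed.
Let meas3 n : measurable_fun setT (fun w => - cz n * Y n (n - l).+1 w ^+ 2).
Proof. by apply: measurable_funM => //; exact: measurable_funX. Qed.
Let meas4 (i : 'I_l) n : measurable_fun setT (fun w => (tau n * theta n ^+ (l.-1 - i)) *
      \sum_(k < (n - l).+1) Y n k w * zeta (k + i)%N w).
Proof. exact: measurable_funM. Qed.
Let meas5 n : measurable_fun setT (fun w =>
  \sum_(k < (n - l).+1) (phi (t n * Y n k w) - s2 * (t n * Y n k w) ^+ 2 / 2)).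
Proof.
apply: measurable_sum => k; apply: measurable_funB => //.
apply: measurable_funM => //; apply: measurable_funM => //.
by apply: measurable_funX; exact: measurable_funM.
Qed.
Let meas12 n := measurable_funD (meas1 n) (meas2 n).
Let meas123 n := measurable_funD (meas12 n) (meas3 n).
Let meas4_sum n : measurable_fun setT (fun w => \sum_(i < l) (tau n * theta n ^+ (l.-1 - i)) *
      \sum_(k < (n - l).+1) Y n k w * zeta (k + i)%N w).
Proof. by apply: measurable_sum => i; exact: meas4. Qed.
Let meas1234 n := measurable_funD (meas123 n) (meas4_sum n).
Let meas12345 n := measurable_funD (meas1234 n) (meas5 n).

Lemma measurable_tilt_remainder n : measurable_fun setT (tilt_remainder n).
Proof. exact: (measurable_funD (meas12345 n) (measurable_cst _)). Qed.

Let tauE n : tau n = t n * rho n * n%:R / (2 * (n - l)%:R). Proof. by []. Qed.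

Let tau_le : \forall n \near \oo, `|tau n| <= 2 * `|t n| * (1 - theta n).
Proof.
apply: filterS regular => n [/andP[th0 th1] n0 nl ne te].
by apply: (tau_bound (n := n) (l := l)).
Qed.

Let cz_le : \forall n \near \oo, `|cz n| <= (1 + s2) * `|t n|.
Proof.
apply: filterS regular => n [/andP[th0 th1] n0 nl ne te].
by apply: (square_coef_bound (n := n)).
Qed.

Let budget0 : 0 <= 16 * lam ^+ 2.
Proof. by rewrite mulr_ge0// sqr_ge0. Qed.

Let c1_le : \forall n \near \oo, `|2 * theta n * cz n - t n| <=
  (3 * l%:R + 1 + s2) * `|t n| * (1 - theta n).
Proof.
apply: filterS regular => n [/andP[th0 th1] n0 nl ne te].
by apply: (martingale_coef_bound (n := n)).
Qed.

Let det_small : small_wrt B (fun n =>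
  `|t n ^+ 2 * s2 ^+ 2 * (n - l).+1%:R / (2 * rho n) - c n|).
Proof.
move=> eta eta0.
pose K := 2 * lam ^+ 2 * s2 ^+ 2.
have K0 : 0 <= K by rewrite mulr_ge0 ?sqr_ge0// mulr_ge0 ?sqr_ge0.
have := eventually_and regular (n_ge (Num.truncn (K * l.+1%:R / eta)).+1).
apply: filterS => n [[th n0 nl _ _] nbig].
have nR : 0 < n%:R :> R by rewrite ltr0n.
have /andP[rho0 _] := rho01 th.
rewrite t_sqr//.
have -> : 4 * lam ^+ 2 * b n ^+ 2 * rho n / n%:R * s2 ^+ 2 * (n - l).+1%:R / (2 * rho n) - c n
    = K * b n ^+ 2 * ((1 - l%:R) / n%:R).
  have -> : (n - l).+1%:R = n%:R - l%:R + 1 :> R by rewrite -natr1 natrB//; lia.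
  by rewrite /c /v /K; field; rewrite !lt0r_neq0.
have Bn : 0 <= b n ^+ 2 by exact: sqr_ge0.
move: K K0 nbig => K K0 nbig; move: (b n ^+ 2) Bn => bb Bn.
rewrite !normrM normfV (ger0_norm K0) (ger0_norm Bn) (gtr0_norm nR).
rewrite mulrAC; apply: ler_wpM2r => //.
rewrite mulrA ler_pdivrMr//.
have l1 : `|1 - l%:R| <= l.+1%:R :> R.
  by rewrite -natr1 ler_norml; have := ler0n R l; move=> ?; apply/andP; split; lra.
apply: le_trans (ler_wpM2l K0 l1) _.
rewrite [leRHS]mulrC -ler_pdivrMr// ltW//.
apply: lt_le_trans (truncnS_gt _) _.
by rewrite ler_nat.
Qed.

Lemma negligible_tilt_remainder : exp_negligible P B tilt_remainder.
Proof.
have Boo := speed_cvgy.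
have l0 : 0 <= 3 * l%:R + 1 + s2 by rewrite !addr_ge0// mulr_ge0.
have s21 : 0 <= 1 + s2 by rewrite addr_ge0.
apply: (exp_negligibleD meas12345 (fun n => measurable_cst _)); last first.
  by apply: exp_negligible_cst; exact: det_small.
apply: (exp_negligibleD meas1234 meas5); last first.
  exact: (negligible_cgf_remainder indep law nb Boo theta01 t_small budget0 t_budget).
apply: (exp_negligibleD meas123 meas4_sum); last first.
  apply: exp_negligible_sum => // i.
  apply: (negligible_cross_product indep law nb Boo theta01 eps_small t_small budget0 t_budget i (ler0n _ 2)).
  apply: filterS2 tau_le theta01 => n h /andP[th0 th1]; apply: le_trans h.
  by rewrite normrM ler_piMr// ger0_norm ?exprn_ge0// exprn_ile1// ltW.
apply: (exp_negligibleD meas12 meas3); last first.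
  apply: (negligible_last_square law nb Boo theta01 t_small
    (c := fun n => - cz n) (fun n => (n - l).+1) s21).
  by apply: filterS cz_le => n; rewrite normrN.
apply: (exp_negligibleD meas1 meas2).
  exact: (negligible_cross_product indep law nb Boo theta01 eps_small t_small budget0 t_budget 0 l0 c1_le).
exact: (negligible_centered_squares indep law nb Boo theta01 eps_small t_small budget0 t_budget s21).
Qed.

Let mCov n : measurable_fun setT (Cov n).
Proof. exact: measurable_empirical_covariance. Qed.

Let F n k w : R := 2 * X n 0 w ^+ 2 + Y n k w ^+ 2 / 2 + Y n (k + l)%N w ^+ 2 / 2.

Let G n w : R := `|tau n| * \sum_(k < (n - l).+1) theta n ^+ k * F n k w.

Let mG n : measurable_fun setT (G n).
Proof.
apply: measurable_funM => //; apply: measurable_sum => k; apply: measurable_funM => //.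
apply: measurable_funD; [apply: measurable_funD|];
  by apply: measurable_funM => //; exact: measurable_funX.
Qed.

Lemma measurable_scaled_cov n : measurable_fun setT (scaled_cov n).
Proof. by apply: measurable_funM => //; exact: measurable_funB. Qed.

Let powR32 (x : R) : 0 <= x -> x `^ (3 / 2) = x * Num.sqrt x.
Proof.
move=> x0; have -> : 3 / 2 = 1 + 2^-1 :> R by field.
rewrite powRD ?powRr1// ?powR12_sqrt//.
by apply/implyP => /eqP h; exfalso; lra.
Qed.

Let tilt_pointwise : \forall n \near \oo, {ae P, forall w,
  `|lam * (b n ^+ 2 * scaled_cov n w) - v * lam ^+ 2 / 2 * b n ^+ 2 - tilt_exponent n w|
  <= `|G n w + `|tilt_remainder n w| |}.
Proof.
have := eventually_and b0 regular.
apply: filterS => n [bn [th n0 nl _ _]].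
have /andP[th0 th1] := th; have /andP[rho0 _] := rho01 th.
have nR : 0 < n%:R :> R by rewrite ltr0n.
have NR : 0 < (n - l)%:R :> R by rewrite ltr0n; lia.
have sn : 0 < Num.sqrt n%:R :> R by rewrite sqrtr_gt0.
apply: filterS (ar_series_cvg_ae th abs_moment) => w cw.
have XE k : X n k w = Y n k w + theta n ^+ k * X n 0 w by exact: ar_process_from0.
pose Q := \sum_(1 <= k < (n - l).+1) X n (k + l)%N w * X n k w.
pose Q' := \sum_(k < (n - l).+1) Y n (k + l)%N w * Y n k w.
have QQ : `|Q - Q'| <= \sum_(k < (n - l).+1) theta n ^+ k * F n k w.
  have -> : Q = \sum_(1 <= k < (n - l).+1) (Y n (k + l)%N w + theta n ^+ (k + l) * X n 0 w)
      * (Y n k w + theta n ^+ k * X n 0 w).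
    by apply: eq_bigr => k _; rewrite -!XE.
  apply: sum_cross_le => //; apply/andP; split => //; exact: ltW.
have E : lam * (b n ^+ 2 * scaled_cov n w) =
    tau n * (Q - (n - l).+1%:R * (theta n ^+ l * s2 / rho n)).
  rewrite /scaled_cov /cov_scale /cov_center /empirical_covariance -/Q powR32 ?(ltW rho0)//.
  rewrite /tau /t.
  have : n%:R = Num.sqrt n%:R * Num.sqrt n%:R :> R by rewrite -expr2 sqr_sqrtr// ltW.
  have : rho n = Num.sqrt (rho n) * Num.sqrt (rho n) by rewrite -expr2 sqr_sqrtr// ltW.
  move: sn; set q := Num.sqrt n%:R; set p := Num.sqrt (rho n) => sn pE nE.
  set a := rho n in rho0 pE *; rewrite nE.
  by field; rewrite !lt0r_neq0.
have D := @tilting_decomposition _ (theta n) (tau n) (t n) s2 (c n) l (n - l).+1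
  (fun i => zeta i w) phi (lt0r_neq0 rho0).
rewrite E.
have -> : tau n * (Q - (n - l).+1%:R * (theta n ^+ l * s2 / rho n)) -
    v * lam ^+ 2 / 2 * b n ^+ 2 - tilt_exponent n w =
    tau n * (Q - Q') + tilt_remainder n w.
  by rewrite /tilt_remainder -D /tilt_exponent /c /Q'; ring.
have G0 : 0 <= G n w.
  apply: mulr_ge0 => //; exact: le_trans QQ.
rewrite [leRHS]ger0_norm ?addr_ge0//.
apply: le_trans (ler_normD _ _) _; rewrite lerD2r normrM.
exact: ler_wpM2l.
Qed.

(** The stationary process is replaced by the one started at 0, which costs the
    term [G]; the algebraic decomposition then applies path by path. *)
Lemma negligible_tilt : exp_negligible P B (fun n w =>
  lam * (b n ^+ 2 * scaled_cov n w) - v * lam ^+ 2 / 2 * b n ^+ 2 - tilt_exponent n w).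
Proof.
have mr n : measurable_fun setT (fun w => `|tilt_remainder n w|).
  by apply: measurableT_comp => //; exact: measurable_tilt_remainder.
apply: (@exp_negligible_le _ _ _ _ _ _ (fun n w => G n w + `|tilt_remainder n w|)).
- move=> n; apply: measurable_funB; last exact: measurable_tilt_exponent.
  apply: measurable_funB => //; apply: measurable_funM => //; apply: measurable_funM => //.
  exact: measurable_scaled_cov.
- by move=> n; exact: measurable_funD.
- exact: tilt_pointwise.
apply: (exp_negligibleD mG mr).
  apply: (negligible_initial_condition law nb (fun n => (n - l).+1) speed_cvgy
    theta01 t_small (c := fun n => `|tau n|) l abs_moment (ler0n _ 2)).
  by apply: filterS tau_le => n; rewrite normr_id.
apply: (exp_negligible_le mr measurable_tilt_remainder _ negligible_tilt_remainder).
by apply: nearW => n; apply: aeW => w; rewrite normr_id.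
Qed.

End fixed_parameter.

Lemma scaled_cov_log_mgf : gaussian_log_mgf P B scaled_cov (4 * s2 ^+ 2).
Proof.
apply: gaussian_log_mgf_of_tilting.
- by rewrite mulr_gt0// exprn_gt0.
- exact: speed_cvgy.
- exact: measurable_scaled_cov.
- move=> lam; exists (tilt_exponent lam); split.
  + exact: measurable_tilt_exponent.
  + by apply: nearW => n; exact: exp_moment_tilt_exponent.
  + exact: negligible_tilt.
Qed.

End ar_covariance.

(** * Transfer to the common law of the noise *)

Section noise_moments.
Context d (T : measurableType d) (R : realType) (P : probability T R).
Variables (xi : int -> {RV P >-> R}) (alpha Ea : R).
Hypothesis xi_id : identically_distributed xi.
Hypothesis alpha0 : 0 < alpha.
Hypothesis expE : (\int[P]_w (expR (alpha * xi 0 w ^+ 2))%:E = Ea%:E)%E.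
Local Notation mu := (distribution P (xi 0)).

Lemma noise_law i (B : set R) : measurable B -> distribution P (xi i) B = mu B.
Proof. exact: xi_id. Qed.

Lemma noise_integral_ge0 i (f : R -> R) : measurable_fun setT f ->
  (forall x, 0 <= f x) -> (\int[P]_w (f (xi i w))%:E = \int[mu]_x (f x)%:E)%E.
Proof.
move=> mf f0.
transitivity (\int[distribution P (xi i)]_x (f x)%:E)%E; last first.
  by apply: eq_measure_integral => A mA _; exact: noise_law.
rewrite (@ge0_integral_distribution _ _ _ _ _ P (xi i) (fun x => (f x)%:E))//.
  exact/measurable_EFinP.
Qed.

Let mexp : measurable_fun setT (fun x : R => expR (alpha * x ^+ 2)).
Proof.
by apply: measurableT_comp => //; apply: measurable_funM => //; exact: measurable_funX.
Qed.

Lemma noise_integrable (f : R -> R) (c : R) : measurable_fun setT f ->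
  (forall x, `|f x| <= c * expR (alpha * x ^+ 2)) ->
  P.-integrable setT (fun w => (f (xi 0 w))%:E).
Proof.
move=> mf fc.
have mE : measurable_fun setT (fun w => expR (alpha * xi 0 w ^+ 2)).
  exact: (measurableT_comp mexp).
have iE : P.-integrable setT (EFin \o fun w => expR (alpha * xi 0 w ^+ 2)).
  apply/integrableP; split; first exact/measurable_EFinP.
  under eq_integral do rewrite abse_EFin ger0_norm ?expR_ge0//.
  by rewrite expE ltry.
apply: (le_integrable measurableT _ _ (integrable_mull c iE)).
  by apply/measurable_EFinP; exact: (measurableT_comp mf).
move=> w _; change (`|f (xi 0 w)|%:E <= `|c * expR (alpha * xi 0 w ^+ 2)|%:E)%E.
by rewrite lee_fin; apply: le_trans (fc _) _; exact: ler_norm.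
Qed.

Lemma noise_sqr_integrable : P.-integrable setT (fun w => (xi 0 w ^+ 2)%:E).
Proof.
apply: (noise_integrable (f := fun x => x ^+ 2) (c := alpha^-1)); first exact: measurable_funX.
by move=> x; rewrite ger0_norm ?sqr_ge0//; exact: sqr_le_exp alpha0.
Qed.

Lemma noise_abs_moment i : (\int[P]_w (`|xi i w|)%:E <= ((1 + alpha^-1) * Ea)%:E)%E.
Proof.
have a0 : 0 <= 1 + alpha^-1 by rewrite addr_ge0// invr_ge0 ltW.
have mn : measurable_fun setT (fun x : R => `|x|) by exact: measurableT_comp.
rewrite (noise_integral_ge0 i mn)// -(noise_integral_ge0 0 mn)//.
apply: (@le_trans _ _ (\int[P]_w (((1 + alpha^-1)%:E * (expR (alpha * xi 0 w ^+ 2))%:E)))%E).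
  apply: ge0_le_integral => //.
  - by apply/measurable_EFinP; exact: (measurableT_comp mn).
  - apply: measurable_funeM; apply/measurable_EFinP; exact: (measurableT_comp mexp).
  - by move=> w _; rewrite -EFinM lee_fin; exact: abs_le_exp alpha0.
rewrite ge0_integralZl//.
  by rewrite expE EFinM.
by apply/measurable_EFinP; exact: (measurableT_comp mexp).
Qed.

Lemma noise_law_exp : (\int[mu]_x (expR (alpha * x ^+ 2))%:E = Ea%:E)%E.
Proof. by rewrite -(noise_integral_ge0 0 mexp)// => x; exact: expR_ge0. Qed.

Lemma noise_law_mean (m : \bar R) : (\int[P]_w (xi 0 w)%:E = m)%E ->
  (\int[mu]_x x%:E = m)%E.
Proof.
move=> <-; rewrite (@integral_distribution _ _ _ _ _ P (xi 0) EFin)//.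
by apply: (noise_integrable (f := id) _ (fun x => abs_le_exp x alpha0)); exact: measurable_id.
Qed.

Lemma noise_law_sqr (s : \bar R) : (\int[P]_w (xi 0 w ^+ 2)%:E = s)%E ->
  (\int[mu]_x (x ^+ 2)%:E = s)%E.
Proof.
move=> <-; symmetry; apply: (noise_integral_ge0 0 (f := fun x => x ^+ 2)) => [|x].
  exact: measurable_funX.
exact: sqr_ge0.
Qed.

End noise_moments.

(** Independence is transported along the injection [i |-> i + 1] of the naturals into the
    integers; unconstrained indices receive the full event. *)
Lemma independent_innovation d (T : measurableType d) (R : realType)
    (P : probability T R) (xi : int -> {RV P >-> R}) :
  mutually_independent xi -> mutually_independent (innovation xi).
Proof.
move=> ind J B uJ mB.
pose f (i : nat) : int := i.+1%:Z.
have fi : injective f by move=> i j; rewrite /f => -[].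
pose B' (z : int) := if z is Posz k.+1 then B k else setT.
have mB' z : measurable (B' z) by rewrite /B'; case: z => [[|k]|k]; [exact: measurableT|exact: mB|exact: measurableT].
have := ind (map f J) B'; rewrite map_inj_uniq// => /(_ uJ mB').
rewrite big_map => E; rewrite -E; congr (P _).
apply/seteqP; split => w /= h.
  by move=> z /mapP[i iJ ->]; exact: h.
by move=> i iJ; have := h (f i); apply; exact: map_f.
Qed.

(** Centering at the mean is insensitive to a preliminary shift of the variable. *)
Lemma centered_affine_integral d (T : measurableType d) (R : realType)
    (P : probability T R) (f : T -> R) (a c : R) : a != 0 ->
  P.-integrable setT (EFin \o (fun w => a * (f w - c))) ->
  forall w, a * (f w - fine (\int[P]_x (f x)%:E)) =
    a * (f w - c) - \int[P]_x (a * (f x - c)).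
Proof.
move=> a0 intf w.
have intg := integrable_mull a^-1 intf.
have intc := finite_measure_integrable_cst P c.
have E : (fun x => f x) = (fun x => a^-1 * (a * (f x - c)) + c).
  by apply/funext => x; rewrite mulKf// subrK.
have -> : fine (\int[P]_x (f x)%:E) = \int[P]_x f x by [].
have -> : \int[P]_x f x = a^-1 * \int[P]_x (a * (f x - c)) + c.
  rewrite -RintegralZl// -[X in _ + X](Rintegral_cst_probability P) -RintegralD//.
    by apply: eq_Rintegral => x _; rewrite mulKf// subrK.
  exact: intc.
by move: (\int[P]_x _) => I; field.
Qed.

Theorem theorem2p1 (d : measure_display) (T : measurableType d) (R : realType)
    (P : probability T R) (xi : int -> {RV P >-> R}) (theta b : nat -> R)
    (M : nat)
    (xi_indep : mutually_independent xi)
    (xi_id : identically_distributed xi)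
    (xi_mean : ('E_P[xi 0%R] = 0)%E)
    (xi_var : (0 < 'E_P[fun w => (xi 0 w ^+ 2)%R])%E)
    (xi_exp : exists alpha : R, 0 < alpha /\
       ('E_P[fun w => expR (alpha * xi 0 w ^+ 2)%R] < +oo)%E)
    (theta_range : forall n : nat, (1 <= n)%N -> 0 <= theta n < 1)
    (theta_lim : theta n @[n --> \oo] --> (1 : R))
    (b_gt0 : forall n : nat, (1 <= n)%N -> 0 < b n)
    (b_lim : b n @[n --> \oo] --> +oo)
    (rate_lim :
       (Num.sqrt n%:R * (1 - theta n) ^+ 2 / b n) @[n --> \oo] --> +oo) :
  forall (r : R) (l : nat), 0 < r -> (l <= M)%N ->
  let C (n : nat) : T -> R :=
    empirical_covariance (ar_process (theta n) (fun k => xi k)) n l in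
  let A (n : nat) : set T :=
    [set w | r <= (1 - theta n ^+ 2) `^ (3 / 2) * Num.sqrt n%:R / b n
                  * `|C n w - fine 'E_P[C n]|] in
  (((b n ^+ 2)^-1)%:E * lne (P (A n)))%E @[n --> \oo] -->
  (- (r ^+ 2 / (8 * fine 'E_P[fun w => xi 0 w ^+ 2] ^+ 2)))%:E.
Proof.
move=> r l r0 _ C A.
have [alpha [alpha0 expoo]] := xi_exp.
move: expoo xi_mean xi_var; rewrite unlock => expoo mean0 var0.
pose Ea := fine (\int[P]_w (expR (alpha * xi 0 w ^+ 2))%:E).
have expE : (\int[P]_w (expR (alpha * xi 0 w ^+ 2))%:E = Ea%:E)%E.
  rewrite fineK// ge0_fin_numE//.
  by apply: integral_ge0 => w _; rewrite lee_fin expR_ge0.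
set s2 := fine (\int[P]_w (xi 0 w ^+ 2)%:E).
have varE : (\int[P]_w (xi 0 w ^+ 2)%:E = s2%:E)%E.
  have := noise_sqr_integrable alpha0 expE.
  by move/(integrable_fin_num measurableT) => fin; rewrite fineK.
have s20 : 0 < s2 by rewrite -lte_fin -varE.
have [kap [K [K2 [K3 [Kphi nb]]]]] := noise_bounds_exist alpha0
  (noise_law_exp xi_id expE) (noise_law_mean alpha0 expE mean0) (noise_law_sqr xi_id varE).
have law := noise_law xi_id.
have mgf := scaled_cov_log_mgf (independent_innovation xi_indep) law nb
  (noise_abs_moment xi_id alpha0 expE) s20 l theta_range theta_lim b_gt0 b_lim rate_lim.
have v0 : 0 < 4 * s2 ^+ 2 by rewrite mulr_gt0// exprn_gt0.
have Boo := speed_cvgy b_lim.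
set W := scaled_cov _ _ _ _ _ in mgf.
have mW n : measurable_fun setT (W n) by exact: measurable_scaled_cov.
have [intW meanW] := gaussian_log_mgf_mean v0 Boo mW mgf.
have mgf' := gaussian_log_mgf_shift Boo mW meanW mgf.
have mW' n : measurable_fun setT (fun w => W n w - \int[P]_x W n x).
  exact: measurable_funB.
have := gaussian_log_mgf_ldp v0 r0 Boo mW' mgf'.
have -> : 2 * (4 * s2 ^+ 2) = 8 * s2 ^+ 2 :> R by ring.
(* the two events agree for all large [n], for which [W n] is integrable *)
apply: cvg_trans; apply: near_eq_cvg.
have n1 : \forall n \near \oo, (1 <= n)%N by exists 1%N.
apply: filterS2 n1 intW => n n1 intWn.
congr (_ * lne (P _))%E; apply/seteqP.
have /andP[th0 th1] := theta_range n n1.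
have a0 : 0 < cov_scale theta b n.
  rewrite /cov_scale divr_gt0 ?b_gt0// mulr_gt0 ?sqrtr_gt0 ?ltr0n// powR_gt0//.
  by rewrite subr_gt0 expr_lt1.
have E w : `|W n w - \int[P]_x W n x| =
    (1 - theta n ^+ 2) `^ (3 / 2) * Num.sqrt n%:R / b n * `|C n w - fine (\int[P]_x (C n x)%:E)|.
  rewrite -(centered_affine_integral (lt0r_neq0 a0) intWn) normrM gtr0_norm//.
by split => w; rewrite /A /= unlock E.
Qed.
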